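(* Let $k$ be an algebraically closed field of characteristic $0$ and let $X\subset\mathbf{P}^n_k$ be an integral non-linear hypersurface which either has dimension at least four, or has dimension three and degree at least three. Suppose that for every hyperplane $\Pi\subset\mathbf{P}^n$, the scheme-theoretic hyperplane section $\Pi\cap X$ is covered by its linear divisors. Then $X$ is covered by its linear divisors.
   Context: Let $Z\subset\mathbf{P}^n_k$ ($k$ algebraically closed) be a closed equidimensional subscheme of dimension $s\ge1$. $Z$ is said to be covered by its linear divisors if every closed point of $Z$ lies on some linear subspace of $\mathbf{P}^n$ of dimension $s-1$ which is contained in $Z$ (as a closed subscheme); equivalently, the projection to $Z$ of the universal family over the Hilbert scheme $F_{s-1}(Z)$ of $(s-1)$-planes contained in $Z$ is surjective. Hyperplane sections are scheme-theoretic intersections (possibly reducible or non-reduced). *)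

(* Defs.v *)
From HB Require Import structures.
From mathcomp Require Import all_boot all_order all_algebra.
From mathcomp Require Import mpoly.
Set Implicit Arguments. Unset Strict Implicit. Unset Printing Implicit Defensive.
Import Order.TTheory GRing.Theory.
Local Open Scope ring_scope.

Section Defs.
Variable k : fieldType.

(* a polynomial is "constant" iff its total degree is 0 (msize = 1 + degree) *)
Definition mconst (m : nat) (p : {mpoly k[m]}) : bool := (msize p <= 1)%N.

Definition mirreducible (m : nat) (F : {mpoly k[m]}) : Prop :=
  ~~ mconst F /\ forall G H : {mpoly k[m]}, F = G * H -> mconst G \/ mconst H.

Definition linform (N : nat) (h : 'cV[k]_N) : {mpoly k[N]} :=
  \sum_(j < N) h j 0 *: 'X_j.

Definition lin_param (s N : nat) (M : 'M[k]_(s, N)) : N.-tuple {mpoly k[s]} :=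
  [tuple \sum_(i < s) M i j *: 'X_i | j < N].

Definition peval (N : nat) (F : {mpoly k[N]}) (p : 'rV[k]_N) : k :=
  F.@[fun j => p 0 j].

(* The linear subspace P(rowspace M) of P^(N-1) is contained, as a closed
   subscheme, in the subscheme defined by the homogeneous ideal generated by
   gs: every generator lies in the (prime) ideal of the subspace, i.e. pulls
   back to the zero polynomial along the parametrisation t |-> t *m M. *)
Definition lin_in_scheme (s N : nat) (M : 'M[k]_(s, N)) (gs : seq {mpoly k[N]}) :=
  forall g, g \in gs -> comp_mpoly (lin_param M) g = 0.

(* The closed subscheme Z of P^(N-1) with homogeneous ideal generated by gs,
   assumed equidimensional of dimension s, is covered by its linear divisors:
   every closed point [p] of Z lies on an (s-1)-plane (rowspace of a row-free
   s x N matrix) contained in Z. *)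
Definition covered_by_linear_divisors (N s : nat) (gs : seq {mpoly k[N]}) : Prop :=
  forall p : 'rV[k]_N, p != 0 -> (forall g, g \in gs -> peval g p = 0) ->
    exists M : 'M[k]_(s, N),
      [/\ row_free M, (p <= M)%MS & lin_in_scheme M gs].
End Defs.

(* Main.v *)
(* Let H be the Hessian of F at a smooth point p of X and T the tangent hyperplane at p.
   Applied to hyperplanes e through p other than T, the hypothesis gives a linear space of
   codimension one in e, through p and inside X; it is isotropic for H.  If H restricted
   to T is nonzero of rank at most two, it is a product of two linear forms, and the kernel
   in T of one of them must lie in X.  Rank three or more is impossible for n >= 5; for
   n = 4 it would put the whole isotropic cone of H|T inside X, and letting p run along a
   line of X one finds a linear vector field preserving X, directed at each point towards
   the point of the line whose tangent hyperplane contains it.  This forces F to be a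
   multiple of z^d on a plane where its second order term is nonzero, so that d = 2.
   In characteristic 0, H|T cannot vanish along all of X unless X is a hyperplane.
   Finally, lying on an (n-2)-plane of X is a closed condition, by elimination theory in
   Pluecker coordinates, and X is irreducible, so that generic points suffice. *)

Require Import Defs.
From HB Require Import structures.
From mathcomp Require Import all_boot all_order all_algebra.
From mathcomp Require Import mpoly.
From mathcomp Require Import ring zify.
From Stdlib Require Import Classical.
Import Order.TTheory GRing.Theory.
Set Implicit Arguments. Unset Strict Implicit. Unset Printing Implicit Defensive.
Local Open Scope ring_scope.

(** * Factoriality of polynomial rings *)

(** Genericity is expressed by divisibility. Once the irreducible [F] is known to be prime, a
    polynomial vanishing on the hypersurface is a multiple of [F]; a dense open part of X is the
    locus where some [G] not divisible by [F] is nonzero, and two such loci always meet.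
    Factoriality and elimination serve this purpose. The obstacle is n = 4. On the tangent space the
    Hessian form always has [p] in its radical, so three orthogonal non-isotropic vectors and [p]
    span a space of dimension four. For n >= 5 some hyperplane other than T contains that space; for
    n = 4 it is T itself. There the rank bound comes from a second radical vector, that is, from a
    vanishing Hessian determinant on X. This vanishing has to be derived from d >= 3: a smooth
    quadric threefold satisfies the condition on hyperplane sections, has nondegenerate Hessian and
    contains no plane. *)

Definition divides (A : comPzRingType) (a b : A) : Prop := exists c, b = a * c.

Definition prime_elt (A : idomainType) (p : A) : Prop :=
  [/\ p != 0, p \isn't a GRing.unit &
      forall a b, divides p (a * b) -> divides p a \/ divides p b].

(** The factors are prime, not merely irreducible, so that existence of a factorisation already
    carries uniqueness. The index counts the primes and serves as an induction measure. *)
Inductive pfact (A : idomainType) : nat -> A -> Prop :=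
| Pfact_unit u : u \is a GRing.unit -> pfact 0 u
| Pfact_mul n p a : prime_elt p -> pfact n a -> pfact n.+1 (p * a).

Definition factorial_ring (A : idomainType) : Prop :=
  forall a : A, a != 0 -> exists n, pfact n a.

Section PFact.
Variable A : idomainType.
Implicit Types (a b p u : A).

Lemma pfact_unit_mul n u a : u \is a GRing.unit -> pfact n a -> pfact n (u * a).
Proof.
move=> uU; elim=> {n a} [v vU|n p a pP _ IH]; first by constructor; rewrite unitrM uU.
by rewrite mulrCA; constructor.
Qed.

Lemma pfact_mul m n a b : pfact m a -> pfact n b -> pfact (m + n) (a * b).
Proof.
move=> + bP; elim=> {m a} [u uU|m p a pP _ IH]; first exact: pfact_unit_mul.
by rewrite addSn -mulrA; constructor.
Qed.

(** A prime dividing a product of primes is associated to one of them, so cancelling it lowers the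
    count by exactly one. *)
Lemma pfact_prime_quot n a p b :
  pfact n a -> prime_elt p -> a = p * b -> exists2 m, n = m.+1 & pfact m b.
Proof.
move=> aP; elim: aP p b => {n a} [u uU p b [_ /negP pU _] uE|n q a qP aP IH p b pP qaE].
  by case: pU; move: uU; rewrite uE unitrM => /andP[].
case: (pP) => p0 pU pM; case: (qP) => q0 qU qM.
case: (pM q a); first by exists b.
  case=> c qE; have c0 : c != 0 by apply: contraNneq q0 => c0; rewrite qE c0 mulr0.
  have [|[e pE]|[e cE]] := qM p c; first by exists 1; rewrite mulr1.
    have eU : e \is a GRing.unit.
      by apply/unitrPr; exists c; apply: (mulfI q0); rewrite mulrA -pE -qE mulr1.
    exists n => //; have -> : b = e^-1 * a; last by apply: pfact_unit_mul aP; rewrite unitrV.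
      apply: (mulfI p0); rewrite -qaE pE -mulrA; congr (_ * _).
      by rewrite mulrA divrr // mul1r.
  case/negP: pU; apply/unitrPr; exists e; apply: (mulfI q0).
  by rewrite mulrCA -cE mulr1 qE.
case=> a' aE; case: (IH p a' pP aE) => m nE a'P; rewrite nE; exists m.+1 => //.
have -> : b = q * a' by apply: (mulfI p0); rewrite -qaE aE mulrCA.
by constructor.
Qed.

End PFact.

Section Factorial.
Variable A : idomainType.
Implicit Types (a b p u : A) (f g h : {poly A}).

Lemma dividesC_coef p f : divides p%:P f <-> forall i, divides p f`_i.
Proof.
split=> [[g ->] i|]; first by exists g`_i; rewrite coefCM.
elim/poly_ind: f => [_|f c IH pf]; first by exists 0; rewrite mulr0.
case: IH => [i|g fE]; first by have := pf i.+1; rewrite -cons_poly_def coef_cons.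
case: (pf 0%N) => e; rewrite -cons_poly_def coef_cons /= => ->.
by exists (g * 'X + e%:P); rewrite cons_poly_def fE polyCM mulrDr mulrA.
Qed.

(** Gauss's lemma without the quotient ring: [p] divides the product of the two constant terms,
    hence one of them; that term is subtracted, a factor ['X] is cancelled, and the total size
    drops. *)
Lemma prime_polyC p : prime_elt p -> prime_elt p%:P.
Proof.
case=> p0 pU pM; split.
- by rewrite polyC_eq0.
- by rewrite poly_unitE size_polyC p0 coefC eqxx (negPf pU).
move=> f g; move: {2}(size f + size g)%N (leqnn (size f + size g)) => n.
elim: n f g => [|n IH] f g szn.
  move: szn; rewrite leqn0 addn_eq0 => /andP[]; rewrite size_poly_eq0 => /eqP-> _ _.
  by left; exists 0; rewrite mulr0.
move=> /dividesC_coef fg.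
have [->|f0] := eqVneq f 0; first by left; exists 0; rewrite mulr0.
have [->|g0] := eqVneq g 0; first by right; exists 0; rewrite mulr0.
have stripX h : divides p%:P (h * 'X) -> divides p%:P h.
  by move=> /dividesC_coef hX; apply/dividesC_coef=> i; have := hX i.+1; rewrite coefMX.
have addX h e : divides p%:P h -> divides p e -> divides p%:P (h * 'X + e%:P).
  by case=> q -> [e' ->]; exists (q * 'X + e'%:P); rewrite polyCM mulrDr mulrA.
have decX h : h != 0 -> exists h' e, h = h' * 'X + e%:P /\ (size h' < size h)%N.
  elim/poly_ind: h => [|h e _] he0; first by rewrite eqxx in he0.
  exists h, e; split=> //; rewrite -cons_poly_def size_cons_poly.
  case: ifP => // /andP[/nilP h0 /eqP e0].
  have h0' : h = 0 by apply/eqP; rewrite -size_poly_eq0 h0.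
  by move: he0; rewrite e0 h0' mul0r addr0 eqxx.
have [f1 [a [fE szf]]] := decX f f0; have [g1 [b [gE szg]]] := decX g g0.
have ab : divides p (a * b).
  by have := fg 0%N; rewrite fE gE coef0M -!cons_poly_def !coef_cons.
case: (pM a b ab) => [pa|pb].
  have {}fg : divides p%:P (f1 * g).
    apply: stripX; apply/dividesC_coef=> i.
    have -> : f1 * g * 'X = f * g - a%:P * g by rewrite fE mulrDl addrK mulrAC.
    rewrite coefB coefCM; case: (fg i) pa => x -> [y ->].
    by exists (x - y * g`_i); rewrite mulrBr mulrA.
  case: (IH f1 g) => //.
  - by rewrite -ltnS (leq_trans _ szn) // ltn_add2r.
  - by move=> f1P; left; rewrite fE; apply: addX.
  - by right.
have {}fg : divides p%:P (f * g1).
  apply: stripX; apply/dividesC_coef=> i.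
  have -> : f * g1 * 'X = f * g - b%:P * f by rewrite gE mulrDr mulrA [f * b%:P]mulrC addrK.
  rewrite coefB coefCM; case: (fg i) pb => x -> [y ->].
  by exists (x - y * f`_i); rewrite mulrBr mulrA.
case: (IH f g1) => //.
- by rewrite -ltnS (leq_trans _ szn) // ltn_add2l.
- by left.
- by move=> g1P; right; rewrite gE; apply: addX.
Qed.

Definition primitive f := forall p, prime_elt p -> ~ divides p%:P f.

Lemma primitive_strip n c f h :
  pfact n c -> primitive f -> divides f (c%:P * h) -> divides f h.
Proof.
move=> cP fP; elim: cP h => {n c} [u uU h [q qE]|n p a pP _ IH h].
  exists ((u^-1)%:P * q); rewrite mulrCA -qE mulrA -polyCM mulVr //.
  by rewrite mul1r.
rewrite polyCM -mulrA => -[q qE].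
have p0 : p%:P != 0 by case: pP; rewrite polyC_eq0.
have [_ _ pM] := prime_polyC pP.
case: (pM f q); first by exists (a%:P * h); rewrite -qE.
  by move/(fP p pP).
case=> q' qE'; apply: IH; exists q'; apply: (mulfI p0).
by rewrite qE qE' mulrCA.
Qed.

(** Each prime of [c] divides [g] or [h] and is cancelled there. Those taken from [h] are collected
    in [e]; those taken from [g] do not affect its size. *)
Lemma primitive_split n c f g h :
  pfact n c -> primitive f -> c%:P * f = g * h ->
  exists g' h' e, [/\ f = g' * h', size g' = size g, e != 0 & h = e%:P * h'].
Proof.
move=> cP fP; elim: cP g h => {n c} [u uU g h|n p a pP _ IH g h].
  move=> E; exists ((u^-1)%:P * g), h, 1; split; rewrite ?oner_eq0 ?mul1r //.
    by rewrite -mulrA -E mulrA -polyCM mulVr // mul1r.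
  by rewrite mul_polyC size_scale // invr_eq0; apply: contraTneq uU => ->; rewrite unitr0.
rewrite polyCM -mulrA => E.
have p0 : p != 0 by case: pP.
have p0' : p%:P != 0 by rewrite polyC_eq0.
have [_ _ pM] := prime_polyC pP.
case: (pM g h); first by exists (a%:P * f); rewrite -E.
  case=> g1 gE; case: (IH g1 h) => [|g' [h' [e [fE sg e0 hE]]]].
    by apply: (mulfI p0'); rewrite E gE mulrA.
  exists g', h', e; split=> //; rewrite sg gE mul_polyC size_scale //.
case=> h1 hE; case: (IH g h1) => [|g' [h' [e [fE sg e0 h1E]]]].
  by apply: (mulfI p0'); rewrite E hE mulrCA.
exists g', h', (p * e); split; rewrite ?mulf_neq0 //.
by rewrite hE h1E polyCM mulrA.
Qed.

Hypothesis factA : factorial_ring A.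

(** The resultant replaces the fraction field. A common factor of [f] and [g] of positive degree is
    all of [f] up to constants; without one, the resultant is a nonzero constant in the ideal of [f]
    and [g], so its product with [h] is a multiple of [f]. Primitivity then removes the
    constants. *)
Lemma primitive_irreducible_prime f :
    primitive f -> (1 < size f)%N ->
    (forall g h, f = g * h -> (1 < size g)%N -> (1 < size h)%N -> False) ->
  prime_elt f.
Proof.
move=> fP f1 firr; have f0 : f != 0 by rewrite -size_poly_gt0 ltnW.
split=> //; first by rewrite poly_unitE eqn_leq leqNgt f1.
move=> g h fgh.
have [->|g0] := eqVneq g 0; first by left; exists 0; rewrite mulr0.
have stripC c q : c != 0 -> divides f (c%:P * q) -> divides f q.
  by move=> /factA[n cP]; apply: primitive_strip cP fP.
have [g1|g1] := leqP (size g) 1.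
  right; apply: (stripC g`_0); last by rewrite -size1_polyC.
  by apply: contraNneq g0 => c0; rewrite (size1_polyC g1) c0.
have := resultant_eq0 f g; case: ltnP => [D1 _|_ /eqP/eqP r0].
  left; have := dvdp_gcdl f g; have := dvdp_gcdr f g.
  set D := gcdp f g in D1 * => /Pdiv.Idomain.dvdpP[[c2 q2] /= c20 gE].
  move=> /Pdiv.Idomain.dvdpP[[c q] /= c0 fE].
  have [n cP] := factA c0.
  rewrite -mul_polyC in fE.
  have [q' [D' [e [fE' sq e0 DE]]]] := primitive_split cP fP fE.
  have D'1 : (1 < size D')%N by rewrite -(size_scale D' e0) -mul_polyC -DE.
  have q'1 : (size q' <= 1)%N by rewrite leqNgt; apply/negP=> /firr/(_ D'1); apply.
  have bE := size1_polyC q'1.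
  have b0 : q'`_0 != 0.
    by apply: contraNneq f0 => b0; rewrite fE' bE b0 mul0r.
  apply: (stripC (q'`_0 * c2)); first by rewrite mulf_neq0.
  exists (q2 * e%:P); have gE' : c2%:P * g = q2 * (e%:P * D') by rewrite mul_polyC gE DE.
  by rewrite fE' polyCM -bE -mulrA gE'; ring.
have [[u v] /= _ rE] := resultant_in_ideal f1 g1.
right; apply: (stripC (resultant f g)); first by rewrite r0.
rewrite rE mulrDl; case: fgh => w ghE.
exists (u * h + v * w); rewrite -[v * g * h]mulrA ghE; ring.
Qed.

(** Two nested inductions, on a bound for the size and on the number of primes in the leading
    coefficient. A prime constant dividing [f] divides its leading coefficient, so dividing it out
    lowers the second measure; a primitive [f] is a unit, is prime, or splits into two factors of
    smaller size. *)
Lemma factorial_poly : factorial_ring {poly A}.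
Proof.
suff main N n f : (size f <= N)%N -> f != 0 -> pfact n (lead_coef f) ->
    exists m, pfact m f.
  move=> f f0; have [|n fP] := factA (a := lead_coef f); first by rewrite lead_coef_eq0.
  exact: (main (size f) n f).
elim: N n f => [|N IHN] n f; first by rewrite leqn0 size_poly_eq0 => /eqP-> /eqP.
have prim f' : (size f' <= N.+1)%N -> f' != 0 -> primitive f' -> exists m, pfact m f'.
  move=> szf f0 fP; have [f1|f1] := leqP (size f') 1.
    have f0' : f'`_0 != 0 by apply: contraNneq f0 => c0; rewrite (size1_polyC f1) c0.
    have [m cP] := factA f0'; rewrite (size1_polyC f1).
    inversion cP as [u uU|m' p a pP aP cE xE].
      by exists 0%N; constructor; rewrite poly_unitE size_polyC f0' coefC /= uU.
    case: (fP p pP); rewrite (size1_polyC f1) -xE polyCM; by exists a%:P.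
  case: (classic (exists g h, [/\ f' = g * h, (1 < size g)%N & (1 < size h)%N])).
    case=> g [h [fE g1 h1]].
    have g0 : g != 0 by rewrite -size_poly_gt0 ltnW.
    have h0 : h != 0 by rewrite -size_poly_gt0 ltnW.
    have szE : size f' = (size g + size h).-1 by rewrite fE size_mul.
    have [|ng gP] := factA (a := lead_coef g); first by rewrite lead_coef_eq0.
    have [|nh hP] := factA (a := lead_coef h); first by rewrite lead_coef_eq0.
    case: (IHN ng g) => // [|mg {}gP].
      by move: szf; rewrite szE; lia.
    case: (IHN nh h) => // [|mh {}hP].
      by move: szf; rewrite szE; lia.
    by exists (mg + mh)%N; rewrite fE; apply: pfact_mul.
  move=> nfact; exists 1%N; rewrite -[f']mulr1; constructor; last by constructor; rewrite unitr1.
  apply: primitive_irreducible_prime => // g h fE g1 h1.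
  by apply: nfact; exists g, h.
elim: n f => [|n IHn] f szf f0 lP;
  (case: (classic (exists p, prime_elt p /\ divides p%:P f));
    last by move=> nf; apply: prim => // p pP pf; apply: nf; exists p);
  case=> p [pP [g fE]];
  have [] := @pfact_prime_quot A _ _ p (lead_coef g) lP pP;
    rewrite ?fE ?lead_coefM ?lead_coefC // => m [<-] gP.
have p0 : p != 0 by case: pP.
have g0 : g != 0 by apply: contraNneq f0 => g0; rewrite fE g0 mulr0.
case: (IHn g) => // [|m' {}gP].
  by move: szf; rewrite fE mul_polyC size_scale.
exists m'.+1; constructor => //; exact: prime_polyC.
Qed.

End Factorial.

(** The resultant works unless the gcd has positive degree. In that case a constant multiple of [f]
    is the gcd times some [q], and primality of [f] makes either the gcd constant or [g] a multiple
    of [f]. *)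
Lemma prime_eliminant (A : idomainType) (f g : {poly A}) :
  prime_elt f -> ~ divides f g ->
  exists (r : A) (u v : {poly A}), r != 0 /\ r%:P = u * f + v * g.
Proof.
move=> fP nfg; case: (fP) => f0 fU fM.
have g0 : g != 0 by apply: contra_notN nfg => /eqP->; exists 0; rewrite mulr0.
have [f1|f1] := leqP (size f) 1.
  exists f`_0, 1, 0; rewrite mul0r addr0 mul1r -size1_polyC //; split=> //.
  by apply: contraNneq f0 => c0; rewrite (size1_polyC f1) c0.
have [g1|g1] := leqP (size g) 1.
  exists g`_0, 0, 1; rewrite mul0r add0r mul1r -size1_polyC //; split=> //.
  by apply: contraNneq g0 => c0; rewrite (size1_polyC g1) c0.
have := resultant_eq0 f g; case: ltnP => [D1 _|_ /eqP/eqP r0]; last first.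
  have [[u v] /= _ rE] := resultant_in_ideal f1 g1.
  by exists (resultant f g), u, v; rewrite r0.
have := dvdp_gcdl f g; have := dvdp_gcdr f g.
set D := gcdp f g in D1 * => /Pdiv.Idomain.dvdpP[[c2 q2] /= c20 gE].
move=> /Pdiv.Idomain.dvdpP[[c q] /= c0 fE].
have D0 : D != 0 by rewrite -size_poly_gt0 ltnW.
case: (fM q D); first by exists c%:P; rewrite -fE -mul_polyC mulrC.
  case=> q' qE; have : c%:P = q' * D.
    by apply: (mulfI f0); rewrite mulrA -qE -fE mulrC mul_polyC.
  move/(congr1 (size \o @polyseq _)) => /=; have [->|q'0] := eqVneq q' 0.
    by rewrite mul0r size_poly0 size_polyC c0.
  rewrite size_mul // size_polyC c0 => sz; move: D1; rewrite -size_poly_gt0 in q'0.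
  by lia.
case=> e DE; case: (fM c2%:P g).
- by exists (q2 * e); rewrite mul_polyC gE DE mulrCA.
- case=> h hE; have := congr1 (size \o @polyseq _) hE.
  rewrite /= size_polyC c20; have [->|h0] := eqVneq h 0; first by rewrite mulr0 size_poly0.
  rewrite size_mul // => sz; rewrite -size_poly_gt0 in h0; lia.
- by [].
Qed.

(** * Multivariate polynomials as polynomials in one chosen variable *)

Lemma mpoly_morph_ext (R : comNzRingType) (S : nzRingType) (n : nat)
    (f g : {rmorphism {mpoly R[n]} -> S}) :
  (forall c, f c%:MP = g c%:MP) -> (forall i, f 'X_i = g 'X_i) -> f =1 g.
Proof.
move=> fgC fgX p; rewrite (mpolyE p) !rmorph_sum; apply: eq_bigr => m _.
rewrite -mul_mpolyC !rmorphM fgC; congr (_ * _).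
rewrite mpolyXE_id !rmorph_prod; apply: eq_bigr => i _.
by rewrite !rmorphXn fgX.
Qed.

Lemma mmapXi (R S : comNzRingType) (n : nat) (f : {rmorphism R -> S}) (h : 'I_n -> S) j :
  mmap f h 'X_j = h j.
Proof. by rewrite mmapX mmap1U. Qed.

Section SplitVariable.
Variables (k : fieldType) (N : nat) (i : 'I_N.+1).

Definition msplit : {mpoly k[N.+1]} -> {poly {mpoly k[N]}} :=
  mmap (polyC \o @mpolyC N k)
    (fun j => if unlift i j is Some j' then ('X_j')%:P else 'X).

Definition mlift : {mpoly k[N]} -> {mpoly k[N.+1]} :=
  mmap (@mpolyC N.+1 k) (fun j => 'X_(lift i j)).

HB.instance Definition _ := GRing.RMorphism.on msplit.
HB.instance Definition _ := GRing.RMorphism.on mlift.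

Definition munsplit : {poly {mpoly k[N]}} -> {mpoly k[N.+1]} :=
  horner_eval 'X_i \o map_poly mlift.

HB.instance Definition _ := GRing.RMorphism.on munsplit.

Lemma munsplitM (p q : {poly {mpoly k[N]}}) : munsplit (p * q) = munsplit p * munsplit q.
Proof. exact: rmorphM. Qed.

Lemma munsplitD (p q : {poly {mpoly k[N]}}) : munsplit (p + q) = munsplit p + munsplit q.
Proof. exact: rmorphD. Qed.

Lemma msplitC c : msplit c%:MP = (c%:MP)%:P.
Proof. by rewrite /msplit mmapC. Qed.

Lemma msplitXi : msplit 'X_i = 'X.
Proof. by rewrite /msplit mmapXi unlift_none. Qed.

Lemma msplitX_lift j : msplit 'X_(lift i j) = ('X_j)%:P.
Proof. by rewrite /msplit mmapXi liftK. Qed.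

Lemma mliftC c : mlift c%:MP = c%:MP.
Proof. by rewrite /mlift mmapC. Qed.

Lemma mliftX j : mlift 'X_j = 'X_(lift i j).
Proof. by rewrite /mlift mmapXi. Qed.

Lemma munsplitC c : munsplit c%:P = mlift c.
Proof. by rewrite /munsplit /= map_polyC /= /horner_eval hornerC. Qed.

Lemma munsplitX : munsplit 'X = 'X_i.
Proof. by rewrite /munsplit /= map_polyX /horner_eval hornerX. Qed.

Lemma msplitK : cancel msplit munsplit.
Proof.
move=> p; apply: (mpoly_morph_ext (f := munsplit \o msplit) (g := idfun)) => [c|j] /=.
  by rewrite msplitC munsplitC mliftC.
case: (unliftP i j) => [j' ->|->]; last by rewrite msplitXi munsplitX.
by rewrite msplitX_lift munsplitC mliftX.
Qed.

Lemma msplit_mlift p : msplit (mlift p) = p%:P.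
Proof.
apply: (mpoly_morph_ext (f := msplit \o mlift) (g := polyC)) => [c|j] /=.
  by rewrite mliftC msplitC.
by rewrite mliftX msplitX_lift.
Qed.

Lemma munsplitK : cancel munsplit msplit.
Proof.
elim/poly_ind => [|p c IH]; first by rewrite !rmorph0.
by rewrite !rmorphD !rmorphM /= IH munsplitX msplitXi munsplitC msplit_mlift.
Qed.

Lemma meval_mlift (x : 'I_N.+1 -> k) p : (mlift p).@[x] = p.@[fun j => x (lift i j)].
Proof.
apply: (mpoly_morph_ext (f := meval x \o mlift) (g := meval _)) => [c|j] /=.
  by rewrite mliftC !mevalC.
by rewrite mliftX !mevalXU.
Qed.

Lemma meval_msplit (x : 'I_N.+1 -> k) p :
  p.@[x] = (map_poly (meval (fun j => x (lift i j))) (msplit p)).[x i].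
Proof.
apply: (mpoly_morph_ext (f := meval x)
   (g := horner_eval (x i) \o map_poly (meval (fun j => x (lift i j))) \o msplit))
     => [c|j] /=.
  by rewrite msplitC map_polyC /= /horner_eval hornerC !mevalC.
case: (unliftP i j) => [j' ->|->].
  by rewrite msplitX_lift map_polyC /= /horner_eval hornerC !mevalXU.
by rewrite msplitXi map_polyX /horner_eval hornerX mevalXU.
Qed.

End SplitVariable.


Lemma prime_elt_transport (A B : idomainType) (f : {rmorphism A -> B})
    (g : {rmorphism B -> A}) :
  cancel f g -> cancel g f -> forall p, prime_elt p -> prime_elt (f p).
Proof.
move=> fK gK p [p0 pU pM]; split.
- by apply: contraNneq p0 => fp0; rewrite -[p]fK fp0 rmorph0.
- by apply: contra pU => fpU; rewrite -[p]fK rmorph_unit.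
move=> c d [e cdE]; case: (pM (g c) (g d)).
- by exists (g e); rewrite -rmorphM cdE rmorphM fK.
- by case=> x /(congr1 f); rewrite gK rmorphM => ->; left; exists (f x).
- by case=> x /(congr1 f); rewrite gK rmorphM => ->; right; exists (f x).
Qed.

Lemma pfact_transport (A B : idomainType) (f : {rmorphism A -> B})
    (g : {rmorphism B -> A}) :
  cancel f g -> cancel g f -> forall n b, pfact n b -> pfact n (g b).
Proof.
move=> fK gK n b; elim=> {n b} [u uU|n p b pP _ IH].
  by constructor; rewrite rmorph_unit.
by rewrite rmorphM; constructor => //; apply: prime_elt_transport pP.
Qed.

Lemma mpoly_const_unit (k : fieldType) n (p : {mpoly k[n]}) :
  p != 0 -> mconst p -> p \is a GRing.unit.
Proof.
move=> p0 /msize1_polyC pE; rewrite pE; apply: rmorph_unit.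
by rewrite unitfE; apply: contraNneq p0 => c0; rewrite pE c0.
Qed.

Lemma mpoly_unit_const (k : fieldType) n (p : {mpoly k[n]}) :
  p \is a GRing.unit -> mconst p.
Proof. by case/andP=> /eqP-> _; rewrite /mconst msizeC; case: (_ == _). Qed.

Lemma factorial_mpoly (k : fieldType) n : factorial_ring {mpoly k[n]}.
Proof.
elim: n => [|n IH] p p0.
  exists 0%N; constructor; apply: mpoly_const_unit => //.
  by rewrite -[p]mpolyKC /mconst msizeC; case: (_ == _).
have [|m mP] := factorial_poly IH (a := msplit ord0 p).
  by apply: contraNneq p0 => sp0; rewrite -[p](msplitK ord0) sp0 rmorph0.
exists m; rewrite -[p](msplitK ord0).
exact: (@pfact_transport {mpoly k[n.+1]} {poly {mpoly k[n]}} (msplit ord0)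
  (munsplit ord0) (msplitK ord0) (munsplitK ord0)).
Qed.

(** Irreducibility leaves a single prime, up to a unit, in a prime factorisation of [F]. *)
Lemma mirreducible_prime (k : fieldType) n (F : {mpoly k[n]}) :
  mirreducible F -> prime_elt F.
Proof.
case=> Fnc Firr; have F0 : F != 0 by apply: contraNneq Fnc => ->; rewrite /mconst msize0.
case: (factorial_mpoly F0) => m; case: m => [|m] FP; inversion FP as [u uU uE FE|m' p a pP aP cE FE].
  by rewrite mpoly_unit_const in Fnc.
case: (Firr p a) => // [pc|ac]; first by case: pP => p0 /negP[]; apply: mpoly_const_unit.
have a0 : a != 0 by apply: contraNneq F0 => a0; rewrite -FE a0 mulr0.
have aU := mpoly_const_unit a0 ac.
case: pP => p0 pU pM; split; rewrite FE //; first by apply: contra Fnc => /mpoly_unit_const.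
move=> x y [z xyE]; case: (pM x y).
- by exists (a * z); rewrite xyE -FE mulrA.
- by case=> w ->; left; exists (a^-1 * w); rewrite -FE -mulrA mulVKr.
- by case=> w ->; right; exists (a^-1 * w); rewrite -FE -mulrA mulVKr.
Qed.

Lemma eliminant_transport (A B : idomainType) (f : {rmorphism B -> {poly A}})
    (g : {rmorphism {poly A} -> B}) (x y : B) :
  cancel f g -> cancel g f -> prime_elt x -> ~ divides x y ->
  exists (r : A) (u v : B), r != 0 /\ g r%:P = u * x + v * y.
Proof.
move=> fK gK xP nxy.
have [|r [u [v [r0 rE]]]] := prime_eliminant (g := f y) (prime_elt_transport fK gK xP).
  case=> w /(congr1 g); rewrite rmorphM !fK => yE.
  by apply: nxy; exists (g w).
by exists r, (g u), (g v); rewrite rE rmorphD !rmorphM /= !fK.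
Qed.

Lemma mpoly_eliminant (k : fieldType) n (i : 'I_n.+1) (F g : {mpoly k[n.+1]}) :
  prime_elt F -> ~ divides F g ->
  exists (r : {mpoly k[n]}) (u v : {mpoly k[n.+1]}),
    r != 0 /\ mlift i r = u * F + v * g.
Proof.
move=> FP nFg.
have [r [u [v [r0 rE]]]] := @eliminant_transport {mpoly k[n]} {mpoly k[n.+1]}
  (msplit i) (munsplit i) F g (msplitK i) (munsplitK i) FP nFg.
by exists r, u, v; split; [exact: r0 | exact: etrans (esym (munsplitC i r)) rE].
Qed.

(** * Nullstellensatz for one irreducible hypersurface *)

Section Closed.
Variable k : closedFieldType.

Lemma mpoly_nonroot n (p : {mpoly k[n]}) : p != 0 -> exists x, p.@[x] != 0.
Proof.
elim: n p => [|n IH] p p0.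
  exists (fun=> 0); move: p0; rewrite -[p]mpolyKC mevalC.
  by apply: contraNneq => ->.
have sp0 : msplit ord0 p != 0.
  by apply: contraNneq p0 => sp0; rewrite -[p](msplitK ord0) sp0 rmorph0.
have [|x xP] := IH (lead_coef (msplit ord0 p)); first by rewrite lead_coef_eq0.
have : map_poly (meval x) (msplit ord0 p) != 0.
  by rewrite -size_poly_eq0 size_poly_eq // size_poly_eq0.
case/closed_nonrootP=> a ap.
exists (fun j => if unlift ord0 j is Some j' then x j' else a).
rewrite (meval_msplit ord0) unlift_none.
rewrite (eq_map_poly (g := meval x)) // => q; apply: meval_eq => j.
by rewrite liftK.
Qed.

Lemma mpoly_ext n (p q : {mpoly k[n]}) : (forall x, p.@[x] = q.@[x]) -> p = q.
Proof.
move=> pq; apply/eqP; rewrite -subr_eq0; apply/negPn/negP => /mpoly_nonroot[x].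
by rewrite mevalB pq subrr eqxx.
Qed.

(** If [F] had degree zero in every variable, the coordinates of a point could be replaced by 0 one
    after the other without changing the value of [F]. *)
Lemma mpoly_nonconst_var n (F : {mpoly k[n.+1]}) :
  ~~ mconst F -> exists i, (1 < size (msplit i F))%N.
Proof.
move=> Fnc; apply: NNPP => ni; case/negP: Fnc.
have const_i i (x y : 'I_n.+1 -> k) : (forall j, x (lift i j) = y (lift i j)) -> F.@[x] = F.@[y].
  move=> xy; have sF : (size (msplit i F) <= 1)%N.
    by rewrite leqNgt; apply/negP=> ?; apply: ni; exists i.
  rewrite !(meval_msplit i) (size1_polyC sF) !map_polyC /= !hornerC.
  exact: meval_eq.
have all_eq (x : 'I_n.+1 -> k) : F.@[x] = F.@[fun=> 0].
  pose y j (i : 'I_n.+1) := if (i < j)%N then x i else 0.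
  have step j : (j <= n.+1)%N -> F.@[y j] = F.@[fun=> 0].
    elim: j => [_|j IH jn]; first by apply: meval_eq => i; rewrite /y ltn0.
    rewrite -(IH (ltnW jn)); apply: (const_i (Ordinal jn)) => j'; rewrite /y.
    have : lift (Ordinal jn) j' != j :> nat by rewrite eq_sym; apply: (neq_lift (Ordinal jn)).
    by rewrite ltnS leq_eqVlt => /negPf->.
  rewrite -(step n.+1) //; apply: meval_eq => i; by rewrite /y ltn_ord.
have -> : F = (F.@[fun=> 0])%:MP by apply: mpoly_ext => x; rewrite mevalC.
by rewrite /mconst msizeC; case: (_ == _).
Qed.

(** Otherwise eliminating a variable that occurs in [F] yields a nonzero [r] in the ideal of [F] and
    [g]. Over a point [x] where neither [r] nor the leading coefficient of [F] vanishes, [F] has a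
    root; [g] vanishes there as well, which forces [r] to vanish at [x]. *)
Lemma vanishing_divides n (F g : {mpoly k[n.+1]}) :
  mirreducible F -> (forall x, F.@[x] = 0 -> g.@[x] = 0) -> divides F g.
Proof.
move=> Firr van; apply: NNPP => nFg.
have [i sF] : exists i, (1 < size (msplit i F))%N by apply: mpoly_nonconst_var; case: Firr.
have [r [u [v [r0 rE]]]] := mpoly_eliminant i (mirreducible_prime Firr) nFg.
have [|x] := @mpoly_nonroot _ (r * lead_coef (msplit i F)).
  by rewrite mulf_neq0 // lead_coef_eq0 -size_poly_gt0 ltnW.
rewrite mevalM mulf_eq0 negb_or => /andP[rx lx].
have : size (map_poly (meval x) (msplit i F)) != 1%N.
  by rewrite size_poly_eq // neq_ltn sF orbT.
case/closed_rootP=> a /rootP ra.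
pose y j := if unlift i j is Some j' then x j' else a.
have yx j : y (lift i j) = x j by rewrite /y liftK.
have Fy : F.@[y] = 0.
  rewrite (meval_msplit i) {2}/y unlift_none -[RHS]ra; congr horner.
  by apply: eq_map_poly => q; apply: meval_eq.
case/negP: rx; have := congr1 (meval y) rE.
rewrite meval_mlift mevalD !mevalM Fy van // !mulr0 addr0 => <-.
by apply/eqP; apply: meval_eq => j; rewrite yx.
Qed.

End Closed.

(** * Elimination theory *)

Notation hcomp := (pihomog mdeg).

Lemma pihomog_dE_if (R : comNzRingType) n d e (p : {mpoly R[n]}) :
  p \is e.-homog -> hcomp d p = if e == d then p else 0.
Proof.
move=> pe; case: eqP => [<-|/eqP ne]; first exact: pihomog_dE.
by rewrite (pihomog_ne0 ne).
Qed.

Lemma pihomogMr (R : comNzRingType) n d e (a f : {mpoly R[n]}) :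
  f \is e.-homog ->
  hcomp d (a * f) = if (e <= d)%N then hcomp (d - e) a * f else 0.
Proof.
move=> fe; have ha : (msize a <= maxn (msize a) d.+1)%N by rewrite leq_maxl.
rewrite {1}(pihomog_partitionE ha) mulr_suml linear_sum /=.
have term (j : 'I_(maxn (msize a) d.+1)) :
    hcomp d (hcomp j a * f) = if (j + e == d)%N then hcomp j a * f else 0.
  by apply: pihomog_dE_if; apply: dhomogM fe; apply: pihomogP.
rewrite (eq_bigr _ (fun j _ => term j)) -big_mkcond /=.
case: leqP => ed; last first.
  by apply: big1 => j /eqP jd; exfalso; lia.
have lt_d : (d - e < maxn (msize a) d.+1)%N by rewrite leq_max ltnS leq_subr orbT.
rewrite (big_pred1 (Ordinal lt_d)) // => j /=.
by rewrite -val_eqE /= -(eqn_add2r e (val j)) subnK.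
Qed.

Lemma dhomog_bigprod (R : comNzRingType) n (I : Type) (r : seq I)
    (h : I -> {mpoly R[n]}) (e : I -> nat) :
  (forall i, h i \is (e i).-homog) -> \prod_(i <- r) h i \is (\sum_(i <- r) e i).-homog.
Proof.
move=> he; elim: r => [|i r IH]; first by rewrite !big_nil dhomog1.
by rewrite !big_cons; apply: dhomogM.
Qed.

Lemma dhomog_mmap (R : comNzRingType) n m d (h : 'I_n -> {mpoly R[m]})
    (p : {mpoly R[n]}) :
  (forall i, h i \is 1.-homog) -> p \is d.-homog ->
  mmap (@mpolyC m R) h p \is d.-homog.
Proof.
move=> h1 /dhomogP pd; rewrite /mmap big_seq; apply: rpred_sum => u up /=.
rewrite mul_mpolyC; apply: dhomogZ; rewrite -(pd u up) /= mdegE /mmap1.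
by apply: dhomog_bigprod => i; have := dhomogMn (u i) (h1 i); rewrite mul1n.
Qed.

Lemma dhomog_mlift (k : fieldType) N (i : 'I_N.+1) d (p : {mpoly k[N]}) :
  p \is d.-homog -> mlift i p \is d.-homog.
Proof.
by apply: dhomog_mmap => j; rewrite dhomogX /= mdeg1.
Qed.

Lemma pihomog_mlift (k : fieldType) N (i : 'I_N.+1) d (p : {mpoly k[N]}) :
  hcomp d (mlift i p) = mlift i (hcomp d p).
Proof.
have hp : (msize p <= maxn (msize p) d.+1)%N by rewrite leq_maxl.
rewrite {1}(pihomog_partitionE hp) rmorph_sum linear_sum /=.
have dp : (d < maxn (msize p) d.+1)%N by rewrite leq_max ltnSn orbT.
rewrite (bigD1 (Ordinal dp)) //= big1 ?addr0 => [|j jd].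
  by apply: pihomog_dE; apply: dhomog_mlift; apply: pihomogP.
rewrite (@pihomog_dE_if _ _ _ j); last by apply: dhomog_mlift; apply: pihomogP.
by move: jd; rewrite -val_eqE /= => /negPf->.
Qed.

Lemma meval_dhomog (R : comNzRingType) n d (p : {mpoly R[n]}) (c : R) (x : 'I_n -> R) :
  p \is d.-homog -> p.@[fun i => c * x i] = c ^+ d * p.@[x].
Proof.
move/dhomogP=> pd; rewrite !mevalE mulr_sumr big_seq [RHS]big_seq.
apply: eq_bigr => m /pd <-; rewrite mulrCA; congr (_ * _).
rewrite (eq_bigr (fun i => c ^+ m i * x i ^+ m i)) => [|i _]; last by rewrite exprMn.
by rewrite big_split /= prodrXr -mdegE.
Qed.

Lemma msplit_dhomog (k : fieldType) N (i : 'I_N.+1) d (p : {mpoly k[N.+1]}) :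
  p \is d.-homog ->
  (size (msplit i p) <= d.+1)%N /\ exists c, (msplit i p)`_d = c%:MP.
Proof.
move=> /dhomogP pd; rewrite (mpolyE p) rmorph_sum big_seq /=.
pose P (q : {poly {mpoly k[N]}}) := (size q <= d.+1)%N /\ exists c, q`_d = c%:MP.
apply: (big_ind P) => [|q r [sq [c qc]] [sr [e re]]|m /pd md].
- by split; [rewrite size_poly0 | exists 0; rewrite coef0 mpolyC0].
- split; first by rewrite (leq_trans (size_polyD _ _)) // geq_max sq.
  by exists (c + e); rewrite coefD qc re mpolyCD.
have -> : msplit i (p@_m *: 'X_[m])
    = ((p@_m)%:MP * \prod_j 'X_j ^+ m (lift i j))%:P * 'X^(m i).
  rewrite -mul_mpolyC rmorphM /= msplitC polyCM -mulrA; congr (_ * _).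
  rewrite mpolyXE_id rmorph_prod (bigD1_ord i) //= rmorphXn /= msplitXi mulrC.
  congr (_ * _); rewrite rmorph_prod; apply: eq_bigr => j _.
  by rewrite !rmorphXn /= msplitX_lift.
have mE : (m i + \sum_j m (lift i j))%N = d by rewrite -md /= mdegE (bigD1_ord i).
split.
  rewrite mul_polyC (leq_trans (size_scale_leq _ _)) // size_polyXn ltnS.
  by rewrite -mE leq_addr.
rewrite coefCM coefXn; case: eqP => [dE|_]; last by exists 0; rewrite mulr0 mpolyC0.
exists p@_m; rewrite mulr1 big1 ?mulr1 // => j _.
suff -> : m (lift i j) = 0%N by rewrite expr0.
apply/eqP; rewrite -leqn0; have := mE; rewrite dE -{2}[m i]addn0 => /eqP.
by rewrite eqn_add2l (bigD1 j) //= addn_eq0 => /andP[/eqP->].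
Qed.

(** The conditions on leading coefficients keep the Sylvester matrix of the same size, so
    specialisation commutes with its determinant. *)
Lemma resultant_map (R S : nzRingType) (g : {rmorphism R -> S}) (p q : {poly R}) :
  g (lead_coef p) != 0 -> g (lead_coef q) != 0 ->
  resultant (map_poly g p) (map_poly g q) = g (resultant p q).
Proof.
move=> nz_fp nz_fq; rewrite /resultant /Sylvester_mx !size_map_poly_id0 //.
rewrite -det_map_mx /= map_col_mx; congr (\det (col_mx _ _));
  by apply/esym/map_lin1_mx => v; rewrite map_poly_rV rmorphM /= map_rVpoly.
Qed.

Definition hideal (R : comNzRingType) n (I : {mpoly R[n]} -> Prop) : Prop :=
  [/\ I 0, forall p q, I p -> I q -> I (p + q), forall p q, I q -> I (p * q) &
      forall d p, I p -> I (hcomp d p)].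

Lemma hideal_sum (R : comNzRingType) n (I : {mpoly R[n]} -> Prop) (T : Type)
    (r : seq T) (P : pred T) (f : T -> {mpoly R[n]}) :
  hideal I -> (forall t, P t -> I (f t)) -> I (\sum_(t <- r | P t) f t).
Proof. by case=> I0 ID _ _ If; apply: big_ind. Qed.

Lemma resultant_in_contraction (A B : comNzRingType) (f : {rmorphism B -> {poly A}})
    (g : {rmorphism {poly A} -> B}) (I : B -> Prop) (x y : B) :
  cancel f g -> (forall p q, I p -> I q -> I (p + q)) ->
  (forall p q, I q -> I (p * q)) -> I x -> I y ->
  (1 < size (f x))%N -> (1 < size (f y))%N -> I (g (resultant (f x) (f y))%:P).
Proof.
move=> fK ID IM Ix Iy fx fy; have [[u v] /= _ ->] := resultant_in_ideal fx fy.
by rewrite rmorphD !rmorphM /= !fK; apply: ID; apply: IM.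
Qed.

Lemma unit_lead_division (A : idomainType) (F s : {poly A}) :
  lead_coef F \is a GRing.unit ->
  exists q r, s = q * F + r /\ (size r < size F)%N.
Proof.
move=> FU; exists (s %/ F), (s %% F); split; first exact: Pdiv.IdomainUnit.divp_eq.
by apply: Pdiv.Idomain.ltn_modpN0; apply: contraTneq FU => ->; rewrite lead_coef0 unitr0.
Qed.

(** The image of [I] in the principal ideal ring [{poly k}] is generated by a nonzero element of
    least size; a root of the generator would be a root of the whole image. *)
Lemma ideal_specialization (k : closedFieldType) (B : comNzRingType)
    (phi : {rmorphism B -> {poly k}}) (psi : {poly k} -> B) (I : B -> Prop) :
  cancel psi phi -> (forall p q, I p -> I q -> I (p + q)) ->
  (forall p q, I q -> I (p * q)) -> (exists2 f, I f & phi f != 0) ->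
  (forall b, exists2 h, I h & ~~ root (phi h) b) -> exists2 g, I g & size (phi g) = 1%N.
Proof.
move=> psiK ID IM [f If f0] noroot.
have [g [Ig gn0 gmin]] : exists g, [/\ I g, phi g != 0 &
    forall h, I h -> phi h != 0 -> (size (phi g) <= size (phi h))%N].
  have : exists m, exists g, [/\ I g, phi g != 0 & (size (phi g) <= m)%N].
    by exists (size (phi f)), f.
  case=> m; elim: m => [|m IHm] [g [Ig g0 gm]].
    by move: gm; rewrite leqn0 size_poly_eq0 (negPf g0).
  case: (classic (exists h, [/\ I h, phi h != 0 & (size (phi h) <= m)%N])) => [//|nh].
  exists g; split=> // h Ih h0; rewrite (leq_trans gm) // ltnNge.
  by apply/negP=> hm; apply: nh; exists h.
have gdvd h : I h -> phi g %| phi h.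
  move=> Ih; apply/modp_eq0P; apply/eqP/negPn/negP => m0.
  have hE : phi (h + - psi (phi h %/ phi g) * g) = phi h %% phi g.
    by rewrite rmorphD rmorphM rmorphN psiK mulNr {1}(divp_eq (phi h) (phi g)) addrAC subrr add0r.
  have := gmin (h + - psi (phi h %/ phi g) * g).
  rewrite hE => /(_ _ m0); rewrite leqNgt ltn_modp gn0 => H.
  by suff: false by []; apply: H; apply: ID => //; apply: IM.
exists g => //; apply/eqP/negPn/negP => /closed_rootP[b /rootP gb].
have [h Ih] := noroot b; case/dvdpP: (gdvd h Ih) => q ->.
by rewrite /root hornerM gb mulr0 eqxx.
Qed.

(* Projective Nullstellensatz, by eliminating the variable [X_0].  The ideal
   contains some [f] with unit leading coefficient in [X_0]; if the elimination ideal
   had a nonzero zero [a], some [g] would be constant over [a], and the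
   resultant of [f] and [g] would lie in the elimination ideal without vanishing at [a]. *)
Theorem projective_nullstellensatz (k : closedFieldType) n (I : {mpoly k[n]} -> Prop) :
  hideal I ->
  (forall x : 'I_n -> k, (exists j, x j != 0) -> exists2 p, I p & p.@[x] != 0) ->
  exists D, forall d p, (D <= d)%N -> p \is d.-homog -> I p.
Proof.
elim: n I => [|n IH] I hI noz; case: (hI) => I0 ID IM IH'.
  exists 1%N => d p d1 pd; suff -> : p = 0 by [].
  rewrite -(pihomog_dE pd); apply: (pihomog_ne0 (d := 0)); last exact: nvar0_homog.
  by rewrite neq_ltn d1.
(* A form of [I] not vanishing at this coordinate point has a nonzero scalar as top coefficient in
   ['X_ord0]. *)
pose e (j : 'I_n.+1) : k := (j == ord0)%:R.
have [|p Ip pe] := noz e; first by exists ord0; rewrite /e eqxx oner_eq0.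
have [D [f [If fD fe]]] : exists D f, [/\ I f, f \is D.-homog & f.@[e] != 0].
  apply: NNPP => nD; case/negP: pe; rewrite (pihomog_partitionE (leqnn (msize p))).
  rewrite rmorph_sum big1 // => j _; apply/eqP/negPn/negP => pj.
  by apply: nD; exists j, (hcomp j p); split; [apply: IH' | apply: pihomogP | ].
have [sf [c cE]] := msplit_dhomog ord0 fD.
have c0 : c != 0.
  apply: contraNneq fe => c0; pose x0 (j : 'I_n) : k := 0.
  pose q := map_poly (meval x0) (msplit ord0 f).
  have fq t : f.@[fun j => t * e j] = q.[t].
    rewrite (meval_msplit ord0) /e eqxx mulr1 /q; congr horner.
    apply: eq_map_poly => r; apply: meval_eq => j.
    by rewrite eq_sym (negPf (neq_lift _ _)) mulr0.
  have qE : q = f.@[e] *: 'X^D.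
    apply/eqP; rewrite -subr_eq0; apply/negPn/negP => /closed_nonrootP[t].
    by rewrite /root hornerD hornerN hornerZ hornerXn -fq (meval_dhomog _ _ fD) mulrC subrr eqxx.
  have := congr1 (fun r : {poly k} => r`_D) qE.
  by rewrite coefZ coefXn eqxx mulr1 /q coef_map /= cE c0 mpolyC0 meval0 => <-.
have szf : size (msplit ord0 f) = D.+1.
  apply/eqP; rewrite eqn_leq sf /= ltnNge; apply: contra c0 => /leq_sizeP/(_ D (leqnn _)).
  by rewrite cE => /eqP; rewrite mpolyC_eq0.
have lcf : lead_coef (msplit ord0 f) = c%:MP by rewrite lead_coefE szf.
pose I' (g : {mpoly k[n]}) := I (mlift ord0 g).
have hI' : hideal I'.
  split; rewrite /I'.
  - by rewrite rmorph0.
  - by move=> g h; rewrite rmorphD; apply: ID.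
  - by move=> g h; rewrite rmorphM; apply: IM.
  - by move=> d g /(IH' d); rewrite pihomog_mlift.
case: (IH I' hI') => [a [ja aj0]|D' PD'].
  apply: NNPP => nI'.
  have I'a r : I' r -> r.@[a] = 0.
    by move=> Ir; apply/eqP/negPn/negP => ra; apply: nI'; exists r.
  pose sp := map_poly (meval a) \o msplit ord0.
  have spf : size (sp f) = D.+1.
    by rewrite /sp /= size_map_poly_id0 ?szf // lcf /= mevalC.
  have [|||g Ig sg1] := @ideal_specialization k {mpoly k[n.+1]} sp
    (munsplit ord0 \o map_poly (@mpolyC n k)) I _ ID IM.
  - move=> q; rewrite /sp /= munsplitK -map_poly_comp map_poly_id // => b _ /=.
    by rewrite mevalC.
  - by exists f => //; rewrite -size_poly_eq0 spf.
  - move=> b; pose x j := if unlift ord0 j is Some j' then a j' else b.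
    have [|h Ih hx] := noz x; first by exists (lift ord0 ja); rewrite /x liftK.
    exists h => //; move: hx; rewrite (meval_msplit ord0) {2}/x unlift_none /root.
    suff -> : map_poly (meval (fun j => x (lift ord0 j))) (msplit ord0 h) = sp h by [].
    by apply: eq_map_poly => q; apply: meval_eq => j; rewrite /x liftK.
  have [D0|D0] := posnP D.
    have fE : f = c%:MP.
      rewrite -[f](msplitK ord0) (size1_polyC (p := msplit ord0 f)) ?szf ?D0 //.
      by rewrite munsplitC -{1}D0 cE mliftC.
    have I1 : I 1.
      rewrite (_ : 1 = (c^-1)%:MP * f); first exact: IM.
      by rewrite fE -mpolyCM mulVf.
    have := I'a 1; rewrite /I' rmorph1 meval1 => /(_ I1)/eqP.
    by rewrite oner_eq0.
  pose K := size (msplit ord0 g).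
  (* Adding a multiple of [f] gives [g'] the scalar leading coefficient of [f], so the resultant
     specialises well at [a]; the common factors with [f] over [a] stay the same. *)
  have [g' Ig' sg'E] : exists2 g', I g' & msplit ord0 g' = msplit ord0 g + 'X^K * msplit ord0 f.
    exists (g + 'X_ord0 ^+ K * f); first by apply: ID => //; apply: IM.
    by rewrite rmorphD rmorphM rmorphXn /= msplitXi.
  have szXf : size ('X^K * msplit ord0 f) = (D.+1 + K)%N.
    by rewrite mulrC size_mulXn -?size_poly_eq0 szf // addnC.
  have lt_sz : (size (msplit ord0 g) < size ('X^K * msplit ord0 f)%R)%N.
    by rewrite szXf addSn ltnS leq_addl.
  have lcg' : lead_coef (msplit ord0 g') = c%:MP.
    by rewrite sg'E lead_coefDr // lead_coefM lead_coefXn mul1r.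
  have szg' : size (msplit ord0 g') = (D.+1 + K)%N by rewrite sg'E addrC size_polyDl.
  have f1 : (1 < size (msplit ord0 f))%N by rewrite szf ltnS.
  have g1 : (1 < size (msplit ord0 g'))%N by rewrite szg' addSn ltnS addn_gt0 D0.
  have Ir : I' (resultant (msplit ord0 f) (msplit ord0 g')).
    have := @resultant_in_contraction {mpoly k[n]} {mpoly k[n.+1]} (msplit ord0)
      (munsplit ord0) I f g' (msplitK ord0) ID IM If Ig' f1 g1.
    by rewrite /= munsplitC.
  have rE := @resultant_map {mpoly k[n]} k (meval a) (msplit ord0 f) (msplit ord0 g').
  have lcfa : meval a (lead_coef (msplit ord0 f)) != 0 by rewrite lcf /= mevalC.
  have lcga : meval a (lead_coef (msplit ord0 g')) != 0 by rewrite lcg' /= mevalC.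
  have /eqP := etrans (rE lcfa lcga) (I'a _ Ir).
  rewrite (resultant_eq0 (sp f) (sp g')).
  have -> : sp g' = sp g + 'X^K * sp f.
    by rewrite /sp /= sg'E rmorphD rmorphM /= rmorphXn /= map_polyX.
  set G := gcdp _ _ => G1; have Gf : G %| sp f by apply: dvdp_gcdl.
  have : G %| sp g.
    rewrite -(dvdp_addl (sp g) (dvdp_mull 'X^K Gf)); exact: dvdp_gcdr.
  by move/dvdp_leq; rewrite sg1 leqNgt G1 -size_poly_eq0 sg1 => /(_ isT).
(* Division by [f] leaves degree less than [D] in ['X_ord0], so the coefficients that remain have
   degree at least [D'] and lie in the elimination ideal. *)
exists (D' + D)%N => d q dd qd.
have [|u [r [sE szr]]] := @unit_lead_division {mpoly k[n]} (msplit ord0 f) (msplit ord0 q).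
  by rewrite lcf rmorph_unit // unitfE.
rewrite szf ltnS in szr.
have qE : q = munsplit ord0 u * f + munsplit ord0 r.
  by rewrite -[LHS](msplitK ord0) sE munsplitD munsplitM; congr (_ * _ + _); exact: msplitK.
rewrite -(pihomog_dE qd) qE.
rewrite pihomogD; apply: ID; first by apply: IH'; apply: IM.
rewrite -[r]coefK poly_def rmorph_sum linear_sum /=.
apply: hideal_sum => //.
move=> j _.
have jD : (j < D)%N := leq_trans (ltn_ord j) szr.
rewrite -mul_polyC rmorphM rmorphXn /= munsplitC munsplitX.
have Xj : 'X_ord0 ^+ j \is [in k[n.+1], j.-homog].
  by have := @dhomogMn n.+1 k mdeg 1 'X_ord0 j; rewrite mul1n; apply; rewrite dhomogX /= mdeg1.
rewrite (pihomogMr _ _ Xj); case: leqP => // jd.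
rewrite mulrC; apply: IM; rewrite pihomog_mlift.
apply: (PD' (d - j)%N); last exact: pihomogP.
by lia.
Qed.

Lemma dhomog_map (R S : comNzRingType) (g : {rmorphism R -> S}) n d (p : {mpoly R[n]}) :
  p \is d.-homog -> map_mpoly g p \is d.-homog.
Proof.
move=> /dhomogP pd; apply/dhomogP => m; rewrite mcoeff_msupp mcoeff_map_mpoly => gm.
by apply: pd; rewrite mcoeff_msupp; apply: contraNneq gm => ->; rewrite raddf0.
Qed.

Lemma map_mpolyK (R S : comNzRingType) (f : {rmorphism R -> S}) (g : {rmorphism S -> R}) n
    (p : {mpoly R[n]}) : cancel f g -> map_mpoly g (map_mpoly f p) = p.
Proof. by move=> fK; apply/mpolyP => m; rewrite !mcoeff_map_mpoly /= fK. Qed.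

(* If the system has no solution over [x0], projective Nullstellensatz
   writes each monomial [m] of some degree [D] as a combination of the equations over [x0];
   lifting the coefficients gives forms [P_m], and the determinant of their
   coefficient matrix detects the fibres without solutions near [x0]. *)
Theorem elimination (k : closedFieldType) (A : comNzRingType) (iota : {rmorphism k -> A})
    (x0 : {rmorphism A -> k}) (T : Type) N (f : T -> {mpoly A[N]}) (e : T -> nat) :
  cancel iota x0 -> (forall t, f t \is (e t).-homog) ->
  (forall y : 'I_N -> k, (exists j, y j != 0) ->
     exists t, (map_mpoly x0 (f t)).@[y] != 0) ->
  exists2 g, x0 g != 0 & forall phi : {rmorphism A -> k}, phi g != 0 ->
    forall y : 'I_N -> k, (exists j, y j != 0) ->
     exists t, (map_mpoly phi (f t)).@[y] != 0.
Proof.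
move=> x0K fe noz.
pose I (p : {mpoly k[N]}) := exists s : seq (T * {mpoly k[N]}),
  p = \sum_(u <- s) u.2 * map_mpoly x0 (f u.1).
have f0e t : map_mpoly x0 (f t) \is (e t).-homog by apply: dhomog_map.
have hcompI d s : hcomp d (\sum_(u <- s) u.2 * map_mpoly x0 (f u.1)) =
    \sum_(u <- s) (if (e u.1 <= d)%N then hcomp (d - e u.1) u.2 else 0)
                     * map_mpoly x0 (f u.1).
  rewrite linear_sum /=; apply: eq_bigr => u _; rewrite (pihomogMr _ _ (f0e _)).
  by case: ifP => // _; rewrite mul0r.
have hI : hideal I.
  split.
  - by exists [::]; rewrite big_nil.
  - by move=> p q [s ->] [s' ->]; exists (s ++ s'); rewrite big_cat.
  - move=> p q [s ->]; exists [seq (u.1, p * u.2) | u <- s].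
    by rewrite big_map mulr_sumr; apply: eq_bigr => u _; rewrite mulrA.
  - move=> d p [s ->]; rewrite hcompI.
    exists [seq (u.1, if (e u.1 <= d)%N then hcomp (d - e u.1) u.2 else 0) | u <- s].
    by rewrite big_map.
have [y yj|D ID] := projective_nullstellensatz hI.
  have [t ft] := noz y yj; exists (map_mpoly x0 (f t)) => //.
  by exists [:: (t, 1)]; rewrite big_seq1 mul1r.
pose S := [set m : 'X_{1..N < D.+1} | mdeg m == D].
pose mon (j : 'I_#|S|) : 'X_{1..N} := bmnm (@enum_val _ (mem S) j).
have lift (i : 'I_#|S|) : exists P : {mpoly A[N]},
    [/\ P \is D.-homog, map_mpoly x0 P = 'X_[mon i] &
     forall phi : {rmorphism A -> k}, forall y : 'I_N -> k,
      (forall t, (map_mpoly phi (f t)).@[y] = 0) -> (map_mpoly phi P).@[y] = 0].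
  have XD : 'X_[mon i] \is [in k[N], D.-homog].
    by rewrite dhomogX /= /mon; have := enum_valP i; rewrite inE.
  have [s sE] := ID D _ (leqnn D) XD.
  have {sE} := congr1 (hcomp D) sE; rewrite hcompI (pihomog_dE XD) => sE.
  (* The multipliers found over [x0] are kept, made constant by [iota], while the equations [f] are
     taken over [A]. *)
  exists (\sum_(u <- s) map_mpoly iota (if (e u.1 <= D)%N then hcomp (D - e u.1) u.2 else 0)
                     * f u.1); split.
  - apply: rpred_sum => u _; case: leqP => eD; last by rewrite rmorph0 mul0r rpred0.
    rewrite -(subnK eD); apply: dhomogM (fe _).
    by rewrite subnK //; apply: dhomog_map; apply: pihomogP.
  - rewrite sE rmorph_sum; apply: eq_bigr => u _.
    by rewrite rmorphM /= map_mpolyK.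
  - move=> phi y fy; rewrite [map_mpoly phi _]rmorph_sum /= [LHS]rmorph_sum big1 // => u _.
    by rewrite /= [map_mpoly phi _]rmorphM /= mevalM fy mulr0.
have [P PP] := fin_all_exists lift.
pose C : 'M[A]_#|S| := \matrix_(i, j) (P i)@_(mon j).
exists (\det C).
  rewrite -det_map_mx (_ : map_mx _ _ = 1%:M) ?det1 ?oner_eq0 //.
  apply/matrixP => i j; rewrite !mxE; have [_ PX _] := PP i.
  have := congr1 (mcoeff (mon j)) PX; rewrite mcoeff_map_mpoly mcoeffX => ->.
  by rewrite /mon (inj_eq val_inj) (inj_eq enum_val_inj).
move=> phi phiC y [j0 yj0]; apply: NNPP => nt.
have fy t : (map_mpoly phi (f t)).@[y] = 0.
  by apply/eqP/negPn/negP => ft; apply: nt; exists t.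
case/negP: phiC; rewrite -det_map_mx -det_tr; apply/det0P.
(* The values at [y] of all monomials of degree [D] form a kernel vector; it is nonzero because of
   the [D]-th power of the nonzero coordinate [y j0]. *)
exists (\row_j \prod_l y l ^+ mon j l).
  pose m0 : 'X_{1..N} := (U_(j0) *+ D)%MM.
  have m0D : mdeg m0 = D by rewrite mdegMn mdeg1 mul1n.
  have m0b : (mdeg m0 < D.+1)%N by rewrite m0D.
  have m0S : BMultinom m0b \in S by rewrite inE /= m0D.
  apply/eqP => /rowP/(_ (enum_rank_in m0S (BMultinom m0b))); rewrite !mxE /mon enum_rankK_in //=.
  apply/eqP/prodf_neq0 => l _; rewrite mulmnE mnm1E.
  by case: (eqVneq j0 l) => [<-|_] /=; rewrite ?mul1n ?mul0n ?expr0 ?oner_eq0 ?expf_neq0.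
apply/rowP => i; rewrite !mxE.
have [PD _ /(_ phi y fy) Py] := PP i; rewrite -[RHS]Py.
have PhiD := dhomog_map phi PD.
have szP : (msize (map_mpoly phi (P i)) <= D.+1)%N.
  rewrite msizeE; apply/bigmax_leqP_seq => m /(dhomog_mf PhiD) /= -> _; exact: leqnn.
rewrite (mpolywE szP) rmorph_sum /= (bigID [pred m | m \in S]) /= [X in _ = _ + X]big1.
  rewrite addr0 [RHS]big_enum_val /=; apply: eq_bigr => j _.
  by rewrite !mxE mevalZ mevalX mulrC mcoeff_map_mpoly.
move=> m; rewrite inE => mD; rewrite (dhomog_nemf_coeff PhiD) //.
by rewrite scale0r meval0.
Qed.

(** * Planes contained in a hypersurface *)

Lemma lin_in_schemeP (k : closedFieldType) s N (M : 'M[k]_(s, N)) (F : {mpoly k[N]}) :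
  lin_in_scheme M [:: F] <-> forall x : 'rV_N, (x <= M)%MS -> peval F x = 0.
Proof.
have evalE (t : 'I_s -> k) :
    (comp_mpoly (lin_param M) F).@[t] = peval F ((\row_i t i) *m M).
  rewrite comp_mpoly_meval /peval; apply: meval_eq => j.
  rewrite tnth_mktuple rmorph_sum mxE; apply: eq_bigr => i _.
  by rewrite /= mevalZ mevalXU !mxE mulrC.
split=> [H x /submxP[t ->]|H g]; last first.
  rewrite inE => /eqP->; apply: mpoly_ext => t; rewrite meval0 evalE.
  by apply: H; apply: submxMl.
rewrite (_ : t = \row_i t 0 i); last by apply/rowP => i; rewrite mxE.
by rewrite -evalE H ?mem_head // meval0.
Qed.

Definition covered_at (k : fieldType) N s (F : {mpoly k[N]}) (p : 'rV[k]_N) : Prop :=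
  exists M : 'M[k]_(s, N), [/\ row_free M, (p <= M)%MS & lin_in_scheme M [:: F]].

Lemma row_free_base (K : fieldType) m N s (W : 'M[K]_(m, N)) :
  \rank W = s -> exists2 M : 'M[K]_(s, N), row_free M & (M :=: W)%MS.
Proof.
by move=> <-; exists (row_base W); [apply: row_base_free | apply: eq_row_base].
Qed.

Lemma covered_at_subspace (k : closedFieldType) N s m (F : {mpoly k[N]}) (p : 'rV[k]_N)
    (W : 'M[k]_(m, N)) :
  \rank W = s -> (p <= W)%MS -> (forall x : 'rV_N, (x <= W)%MS -> peval F x = 0) ->
  covered_at s F p.
Proof.
case/row_free_base=> M Mfree MW pW FW; exists M; rewrite Mfree MW; split=> //.
by apply/lin_in_schemeP => x; rewrite MW; apply: FW.
Qed.

Lemma pevalZ (k : fieldType) N d (F : {mpoly k[N]}) (c : k) (x : 'rV[k]_N) :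
  F \is d.-homog -> peval F (c *: x) = c ^+ d * peval F x.
Proof.
move=> Fd; rewrite /peval -(meval_dhomog _ _ Fd).
by apply: meval_eq => j; rewrite mxE.
Qed.

(* The Pluecker description of [covered_at]: [Om] is [a /\ b] for two linear
   forms [a], [b] cutting out the plane. *)
Section Pluecker.
Variables (k : closedFieldType) (n d : nat) (F : {mpoly k[n.+1]}).
Hypotheses (n_gt0 : (0 < n)%N) (Fhom : F \is d.-homog).
Implicit Types (Om : 'M[k]_n.+1) (p t : 'rV[k]_n.+1).

(** For [Om] the wedge of [a] and [b], this is a vector on which both forms vanish, whatever [t] is;
    for [t] already in the plane it is [Om i j *: t]. Letting [t] vary thus parametrises the plane
    when [Om i j] is nonzero. *)
Definition pluecker_vec Om i j t : 'rV[k]_n.+1 :=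
  Om i j *: t - (t *m (row i Om)^T) 0 0 *: delta_mx 0 j
              + (t *m (row j Om)^T) 0 0 *: delta_mx 0 i.

(** All conditions are homogeneous in the entries of [Om], linear or of degree [d], as [elimination]
    requires. *)
Definition pluecker_sol p Om : Prop :=
  [/\ forall i, Om i i = 0, forall i j, i != j -> Om i j + Om j i = 0,
      p *m Om = 0 & forall i j t, peval F (pluecker_vec Om i j t) = 0].

(** If [Om i j] is nonzero, the alternating property makes rows [i] and [j] independent. On their
    common kernel [pluecker_vec] is [Om i j *: t], so this plane of codimension two lies in the
    hypersurface. *)
Lemma covered_of_pluecker p Om : Om != 0 -> pluecker_sol p Om -> covered_at (n - 1) F p.
Proof.
move=> Om0 [Odiag Oalt pO FO].
have Oanti i j : Om i j = - Om j i.
  have [->|ij] := eqVneq i j; first by rewrite Odiag oppr0.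
  by apply/eqP; rewrite -addr_eq0 Oalt.
have [i [j Oij]] : exists i j, Om i j != 0.
  apply: NNPP => nO; case/eqP: Om0; apply/matrixP => i j; rewrite mxE.
  by apply/eqP/negPn/negP => Oij; apply: nO; exists i, j.
pose B := col_mx (row i Om) (row j Om).
have Bfree : row_free B.
  apply: inj_row_free => v vB.
  have v0 m : v 0 (lshift 1 0) * Om i m + v 0 (rshift 1 0) * Om j m = 0.
    have := congr1 (fun w : 'rV[k]_n.+1 => w 0 m) vB.
    by rewrite /B -[v in v *m _]hsubmxK mul_row_col !mxE !big_ord1 !mxE.
  have l0 : v 0 (lshift 1 0) = 0.
    have /eqP := v0 j; rewrite Odiag mulr0 addr0 mulf_eq0 (negPf Oij) orbF.
    by move/eqP.
  have r0 : v 0 (rshift 1 0) = 0.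
    have /eqP := v0 i; rewrite Odiag mulr0 add0r mulf_eq0 Oanti oppr_eq0 (negPf Oij) orbF.
    by move/eqP.
  apply/rowP => m; rewrite mxE -[m]splitK.
  by case: (split m) => q; rewrite ord1 /= ?l0 ?r0.
have inW (x : 'rV[k]_n.+1) : (x <= kermx B^T)%MS =
    ((x *m (row i Om)^T == 0) && (x *m (row j Om)^T == 0)).
  rewrite sub_kermx /B tr_col_mx mul_mx_row; apply/eqP/andP => [E|[/eqP-> /eqP->]].
    by split; apply/eqP; [have := congr1 lsubmx E | have := congr1 rsubmx E];
      rewrite ?row_mxKl ?row_mxKr ?linear0.
  by rewrite row_mx0.
apply: (@covered_at_subspace _ _ _ _ _ _ (kermx B^T)).
- by rewrite mxrank_ker mxrank_tr (eqP Bfree) addn1 subSS.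
- have prow l : p *m (row l Om)^T = 0.
    have E : \sum_q p 0 q * Om q l = 0.
      by have := congr1 (fun w : 'rV[k]_n.+1 => w 0 l) pO; rewrite !mxE.
    apply/rowP => m; rewrite ord1 !mxE -[RHS]oppr0 -[in RHS]E -sumrN.
    by apply: eq_bigr => q _; rewrite !mxE Oanti mulrN.
  by rewrite inW !prow !eqxx.
move=> x; rewrite inW => /andP[/eqP xi /eqP xj].
have := FO i j x; rewrite /pluecker_vec xi xj !mxE !scale0r subr0 addr0.
by rewrite (pevalZ _ _ Fhom) => /eqP; rewrite mulf_eq0 expf_eq0 (negPf Oij) andbF => /eqP.
Qed.

Lemma pluecker_of_covered p :
  covered_at (n - 1) F p -> exists2 Om, Om != 0 & pluecker_sol p Om.
Proof.
case=> M [Mfree pM /lin_in_schemeP FM].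
have rM : \rank M = (n - 1)%N by apply/eqP.
have [B Bfree BK] : exists2 B : 'M[k]_(2, n.+1), row_free B & (B :=: kermx M^T)%MS.
  by apply: row_free_base; rewrite mxrank_ker mxrank_tr rM; lia.
have BM : B *m M^T = 0 by apply/sub_kermxP; rewrite BK.
have MB : M *m B^T = 0 by rewrite -[M *m _]trmxK trmx_mul trmxK BM trmx0.
have inM (x : 'rV[k]_n.+1) : x *m B^T = 0 -> (x <= M)%MS.
  move=> xB; have : (x <= kermx B^T)%MS by apply/sub_kermxP.
  suff /eqmxP-> : (M == kermx B^T)%MS by [].
  rewrite -(geq_leqif (mxrank_leqif_eq _)); last exact/sub_kermxP.
  by rewrite mxrank_ker mxrank_tr rM (eqP Bfree); lia.
pose a := B ord0; pose b := B ord_max.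
exists (\matrix_(i, j) (a i * b j - a j * b i)).
  apply/eqP => /matrixP O0.
  have ab i j : a i * b j = a j * b i.
    by have := O0 i j; rewrite !mxE => /eqP; rewrite subr_eq0 => /eqP.
  have indep (u v : k) : (forall j, u * a j + v * b j = 0) -> u = 0 /\ v = 0.
    move=> uv; have : (\row_(l < 2) if l == ord0 then u else v) *m B = 0.
      apply/rowP => j; rewrite !mxE !big_ord_recl big_ord0 addr0 !mxE /=.
      by rewrite -(uv j) /a /b; congr (_ * B _ _ + _ * B _ _); apply/val_inj.
    move/eqP; rewrite mulmx_free_eq0 // => /eqP/rowP w0.
    by split; [have := w0 ord0 | have := w0 ord_max]; rewrite !mxE.
  have a0 i : a i = 0.
    have [|_ -> //] := indep (- b i) (a i).
    by move=> j; rewrite mulNr addrC ab mulrC subrr.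
  have [|/eqP] := indep 1 0; last by rewrite oner_eq0.
  by move=> j; rewrite a0 mulr0 mul0r addr0.
have xB (x : 'rV[k]_n.+1) : x *m B^T = 0 <-> \sum_j x 0 j * a j = 0 /\ \sum_j x 0 j * b j = 0.
  have xBE l : (x *m B^T) 0 l = \sum_j x 0 j * B l j.
    by rewrite mxE; apply: eq_bigr => j _; rewrite mxE.
  split=> [xB|[xa xb]]; first by rewrite -!xBE xB !mxE.
  apply/rowP => l; rewrite xBE mxE.
  have [->|->] // : l = ord0 \/ l = ord_max.
  by case: l => [[|[|//]] li]; [left | right]; apply: val_inj.
have [pa pb] : \sum_j p 0 j * a j = 0 /\ \sum_j p 0 j * b j = 0.
  by apply/xB; case/submxP: pM => u ->; rewrite -mulmxA MB mulmx0.
split.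
- by move=> i; rewrite mxE subrr.
- by move=> i j _; rewrite !mxE; ring.
- apply/rowP => j; rewrite !mxE.
  transitivity ((\sum_i p 0 i * a i) * b j - (\sum_i p 0 i * b i) * a j).
    rewrite !mulr_suml -sumrB; apply: eq_bigr => i _; rewrite mxE; ring.
  by rewrite pa pb !mul0r subrr.
move=> i j t; apply: FM; apply: inM; apply/xB.
pose ta := \sum_j t 0 j * a j; pose tb := \sum_j t 0 j * b j.
have rowE l : (t *m (row l (\matrix_(i, j) (a i * b j - a j * b i)))^T) 0 0 = a l * tb - b l * ta.
  rewrite mxE /ta /tb !mulr_sumr -sumrB; apply: eq_bigr => m _; rewrite !mxE; ring.
have vecE (c : 'I_n.+1 -> k) :
    \sum_l pluecker_vec (\matrix_(i, j) (a i * b j - a j * b i)) i j t 0 l * c l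
   = (a i * b j - a j * b i) * (\sum_l t 0 l * c l) - (a i * tb - b i * ta) * c j
      + (a j * tb - b j * ta) * c i.
  have deltaE m (u : k) : u * c m = \sum_l u * (delta_mx 0 m : 'rV[k]_n.+1) 0 l * c l.
    rewrite (bigD1 m) //= mxE !eqxx mulr1 big1 ?addr0 // => l lm.
    by rewrite mxE eqxx (negPf lm) mulr0 mul0r.
  rewrite (deltaE j) (deltaE i) mulr_sumr -sumrB -big_split; apply: eq_bigr => l _ /=.
  by rewrite /pluecker_vec !rowE !mxE; ring.
by rewrite !vecE -/ta -/tb; split; ring.
Qed.

End Pluecker.

(* The Pluecker equations as forms in the entries of the matrix, with coefficients
   in a ring [A] containing the coordinates [X] of the point. *)
Section PlueckerSystem.
Variables (k : closedFieldType) (A : comNzRingType) (iota : {rmorphism k -> A}).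
Variables (n d : nat) (F : {mpoly k[n.+1]}) (X : 'I_n.+1 -> A).
Hypothesis Fhom : F \is d.-homog.

Definition pl_var (i j : 'I_n.+1) : {mpoly A[#|{: 'I_n.+1 * 'I_n.+1}|]} :=
  'X_(enum_rank (i, j)).

(** The vector [t] is part of the index, so the system is infinite; [elimination] accepts any index
    type. *)
Definition pl_index : Type :=
  ('I_n.+1 * 'I_n.+1 + 'I_n.+1 + 'I_n.+1 * 'I_n.+1 * 'rV[k]_n.+1)%type.

Definition pl_arg (i j : 'I_n.+1) (t : 'rV[k]_n.+1) (l : 'I_n.+1) :=
  iota (t 0 l) *: pl_var i j
  - (l == j)%:R *: (\sum_m iota (t 0 m) *: pl_var i m)
  + (l == i)%:R *: (\sum_m iota (t 0 m) *: pl_var j m).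

Definition pl_eqn (u : pl_index) :=
  match u with
  | inl (inl (i, j)) => if i == j then pl_var i i else pl_var i j + pl_var j i
  | inl (inr j) => \sum_i X i *: pl_var i j
  | inr (i, j, t) => mmap (@mpolyC _ A) (pl_arg i j t) (map_mpoly iota F)
  end.

Definition pl_deg (u : pl_index) := if u is inr _ then d else 1%N.

Lemma pl_var_dhomog i j : pl_var i j \is 1.-homog.
Proof. by rewrite dhomogX /= mdeg1. Qed.

Lemma pl_eqn_dhomog u : pl_eqn u \is (pl_deg u).-homog.
Proof.
case: u => [[[i j]|j]|[[i j] t]] /=.
- by case: eqP => _; rewrite ?rpredD ?pl_var_dhomog.
- by apply: rpred_sum => i _; apply: dhomogZ; apply: pl_var_dhomog.
apply: dhomog_mmap => [l|]; last exact: dhomog_map.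
rewrite /pl_arg !rpredD // ?rpredN; apply: dhomogZ; rewrite ?pl_var_dhomog //;
  by apply: rpred_sum => m _; apply: dhomogZ; apply: pl_var_dhomog.
Qed.

Variables (phi : {rmorphism A -> k}).
Hypothesis phiK : cancel iota phi.
Variable Om : 'M[k]_n.+1.

Definition pl_point (l : 'I_(#|{: 'I_n.+1 * 'I_n.+1}|)) : k :=
  Om (enum_val l).1 (enum_val l).2.

Lemma pl_varE i j : (map_mpoly phi (pl_var i j)).@[pl_point] = Om i j.
Proof. by rewrite /pl_var map_mpolyX mevalXU /pl_point enum_rankK. Qed.

Lemma pl_argE i j t l :
  (map_mpoly phi (pl_arg i j t l)).@[pl_point] = pluecker_vec Om i j t 0 l.
Proof.
have sumE i' : (map_mpoly phi (\sum_m iota (t 0 m) *: pl_var i' m)).@[pl_point]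
     = (t *m (row i' Om)^T) 0 0.
  rewrite [map_mpoly _ _]rmorph_sum /= [LHS]rmorph_sum mxE; apply: eq_bigr => m _ /=.
  by rewrite map_mpolyZ mevalZ pl_varE phiK !mxE.
rewrite /pl_arg [map_mpoly _ _]rmorphD /= [map_mpoly _ (_ - _)]rmorphB /= mevalD mevalB.
rewrite !map_mpolyZ !mevalZ pl_varE !sumE phiK !rmorph_nat /pluecker_vec !mxE.
by rewrite eqxx /= mulrC [in X in _ - X]mulrC [in X in _ + X]mulrC.
Qed.

Lemma pl_eqnE :
  (forall u, (map_mpoly phi (pl_eqn u)).@[pl_point] = 0) <->
  pluecker_sol F (\row_i phi (X i)) Om.
Proof.
have inrE i j t : (map_mpoly phi (pl_eqn (inr (i, j, t)))).@[pl_point]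
    = peval F (pluecker_vec Om i j t).
  rewrite /peval /=.
  apply: (mpoly_morph_ext (f := meval pl_point \o map_mpoly phi \o
     mmap (@mpolyC _ A) (pl_arg i j t) \o map_mpoly iota) (g := meval _)) => [c|l] /=.
    by rewrite map_mpolyC mmapC map_mpolyC !mevalC /= phiK.
  by rewrite map_mpolyX mmapXi pl_argE mevalXU.
have colE j : (map_mpoly phi (pl_eqn (inl (inr j)))).@[pl_point]
    = ((\row_i phi (X i)) *m Om) 0 j.
  rewrite /= [map_mpoly _ _]rmorph_sum /= [LHS]rmorph_sum mxE; apply: eq_bigr => m _ /=.
  by rewrite map_mpolyZ mevalZ pl_varE mxE.
split=> [H|[H1 H2 H3 H4] [[[i j]|j]|[[i j] t]]].
- split.
  + by move=> i; have := H (inl (inl (i, i))); rewrite /= eqxx pl_varE.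
  + move=> i j ij; have := H (inl (inl (i, j))); rewrite /= (negPf ij).
    by rewrite [map_mpoly _ _]rmorphD /= mevalD !pl_varE.
  + by apply/rowP => j; rewrite -colE H mxE.
  + by move=> i j t; rewrite -inrE H.
- rewrite /=; case: eqP => [->|/eqP ij]; first by rewrite pl_varE.
  by rewrite [map_mpoly _ _]rmorphD /= mevalD !pl_varE H2.
- by rewrite colE H3 mxE.
- by rewrite inrE.
Qed.

End PlueckerSystem.

(** Near an uncovered point [p0], elimination over the ring of coordinates of the point gives [g],
    nonzero at [p0], such that no covered point has [g] nonzero. Then [g * G] vanishes on the
    hypersurface, and the prime [F] would divide [g] or [G]. *)
Theorem covered_at_closed (k : closedFieldType) n d (F G : {mpoly k[n.+1]}) :
  (0 < n)%N -> F \is d.-homog -> mirreducible F -> ~ divides F G ->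
  (forall p : 'rV_n.+1, peval F p = 0 -> peval G p != 0 -> covered_at (n - 1) F p) ->
  forall p : 'rV_n.+1, peval F p = 0 -> covered_at (n - 1) F p.
Proof.
move=> n0 Fhom Firr nFG cov p0 Fp0; apply: NNPP => ncov.
pose iota := @mpolyC n.+1 k; pose X (i : 'I_n.+1) : {mpoly k[n.+1]} := 'X_i.
pose ev (p : 'rV[k]_n.+1) : {rmorphism {mpoly k[n.+1]} -> k} := meval (fun j => p 0 j).
have evX p : \row_i ev p (X i) = p by apply/rowP => i; rewrite mxE /ev /X /= mevalXU.
have evK p : cancel iota (ev p) by move=> c; rewrite /ev /iota /= mevalC.
have pointE (y : 'I_(#|{: 'I_n.+1 * 'I_n.+1}|) -> k) :
    y =1 pl_point (\matrix_(i, j) y (enum_rank (i, j))).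
  by move=> l; rewrite /pl_point mxE -surjective_pairing enum_valK.
have [||y [l yl]|g g0 gP] := @elimination k {mpoly k[n.+1]} iota (ev p0) _ _
   (pl_eqn iota F X) (pl_deg (n := n) d).
- exact: evK.
- exact: pl_eqn_dhomog.
- apply: NNPP => nt; apply: ncov.
  apply: (covered_of_pluecker Fhom (Om := \matrix_(i, j) y (enum_rank (i, j)))).
    apply: contraNneq yl => /matrixP/(_ (enum_val l).1 (enum_val l).2).
    by rewrite !mxE -surjective_pairing enum_valK => ->.
  rewrite -[p0]evX; apply/(pl_eqnE _ _ (evK p0)) => u.
  rewrite -(meval_eq _ (pointE y)); apply/eqP/negPn/negP => fu.
  by apply: nt; exists u.
have [_ _ /(_ g G)] := mirreducible_prime Firr; case.
- apply: vanishing_divides => // x Fx; rewrite mevalM.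
  pose p : 'rV[k]_n.+1 := \row_i x i.
  have pE (H : {mpoly k[n.+1]}) : peval H p = H.@[x].
    by apply: meval_eq => j; rewrite mxE.
  have [->|Gx] := eqVneq G.@[x] 0; first by rewrite mulr0.
  have [->|gx] := eqVneq g.@[x] 0; first by rewrite mul0r.
  have [|Om Om0 Osol] := pluecker_of_covered n0 Fhom (p := p).
    by apply: cov; rewrite pE.
  have gp : ev p g != 0 by rewrite /ev /= -/(peval g p) pE.
  have [l Ol] : exists l, pl_point Om l != 0.
    apply: NNPP => nO; case/eqP: Om0; apply/matrixP => i j; rewrite mxE.
    apply/eqP/negPn/negP => Oij; apply: nO; exists (enum_rank (i, j)).
    by rewrite /pl_point enum_rankK.
  have [u fu] := gP (ev p) gp (pl_point Om) (ex_intro _ l Ol).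
  case/negP: fu; apply/eqP; move: u; apply/(pl_eqnE _ _ (evK p)).
  by rewrite evX.
- case=> q gE; case/negP: g0; rewrite gE rmorphM.
  by rewrite [ev p0 F]Fp0 mul0r.
- exact: nFG.
Qed.

(** * First and second derivatives *)

Lemma mpoly_ring_ind (R : comNzRingType) n (P : {mpoly R[n]} -> Prop) :
  (forall c, P c%:MP) -> (forall i, P 'X_i) ->
  (forall p q, P p -> P q -> P (p + q)) -> (forall p q, P p -> P q -> P (p * q)) ->
  forall p, P p.
Proof.
move=> PC PX PD PM p; rewrite (mpolyE p).
apply: (big_ind P) => [||m _]; [by rewrite -mpolyC0; apply: PC | exact: PD |].
rewrite -mul_mpolyC; apply: (PM); first exact: PC.
rewrite mpolyXE_id; apply: (big_ind P) => [||i _]; [by rewrite -mpolyC1; apply: PC | exact: PM |].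
by elim: (m i) => [|e IH]; rewrite ?expr0 -?mpolyC1 // exprS; apply: PM.
Qed.

(** [D] may be any derivation killing the scalars: the derivative along a curve, or a derivation
    acting on the coefficients of a polynomial. *)
Lemma chain_rule (R S : comNzRingType) n (f : {rmorphism R -> S}) (h : 'I_n -> S)
    (D : S -> S) (p : {mpoly R[n]}) :
  (forall x y, D (x + y) = D x + D y) -> (forall x y, D (x * y) = D x * y + x * D y) ->
  (forall c, D (f c) = 0) ->
  D (mmap f h p) = \sum_i mmap f h p^`M(i) * D (h i).
Proof.
move=> DD DM DC; elim/mpoly_ring_ind: p => [c|j|p q Hp Hq|p q Hp Hq].
- by rewrite mmapC DC big1 // => i _; rewrite mderivC mmap0 mul0r.
- rewrite mmapXi (bigD1 j) //= mderivX mnm1E eqxx scale1r big1 ?addr0 => [|i ij].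
    by rewrite -{1}[U_(j)%MM]addm0 addmC addmK mpolyX0 rmorph1 mul1r.
  by rewrite mderivX mnm1E eq_sym (negPf ij) scale0r mmap0 mul0r.
- rewrite mmapD DD Hp Hq -big_split; apply: eq_bigr => i _ /=.
  by rewrite mderivD mmapD mulrDl.
- rewrite rmorphM /= DM Hp Hq mulr_suml mulr_sumr -big_split; apply: eq_bigr => i _ /=.
  by rewrite mderivM rmorphD !rmorphM /=; ring.
Qed.

Lemma mderiv_dhomog (R : comNzRingType) n d i (p : {mpoly R[n]}) :
  p \is d.-homog -> p^`M(i) \is d.-1.-homog.
Proof.
move=> /dhomogP pd; apply/dhomogP => m; rewrite mcoeff_msupp mcoeff_deriv => pm.
have /pd /= : (m + U_(i))%MM \in msupp p.
  by rewrite mcoeff_msupp; apply: contraNneq pm => ->; rewrite mul0rn.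
by rewrite mdegD mdeg1 addn1 => <-.
Qed.

Lemma poly_ext (k : closedFieldType) (p q : {poly k}) : (forall t, p.[t] = q.[t]) -> p = q.
Proof.
move=> pq; apply/eqP; rewrite -subr_eq0; apply/negPn/negP => /closed_nonrootP[t].
by rewrite /root hornerD hornerN pq subrr eqxx.
Qed.

Lemma char0_natf_neq0 (k : fieldType) (m : nat) : [pchar k] =i pred0 -> (0 < m)%N -> m%:R != 0 :> k.
Proof. by move=> /pcharf0P ->; rewrite -lt0n. Qed.

Section Bilinear.
Variables (k : fieldType) (N : nat).
Implicit Types (x y z : 'rV[k]_N) (g : 'cV[k]_N) (H : 'M[k]_N).

Definition dotp x g : k := (x *m g) 0 0.
Definition bil H x y : k := (x *m H *m y^T) 0 0.

Lemma dotpE x g : dotp x g = \sum_i x 0 i * g i 0.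
Proof. by rewrite /dotp mxE. Qed.

Lemma dotpDl x y g : dotp (x + y) g = dotp x g + dotp y g.
Proof. by rewrite /dotp mulmxDl mxE. Qed.

Lemma dotpZl c x g : dotp (c *: x) g = c * dotp x g.
Proof. by rewrite /dotp -scalemxAl mxE. Qed.

Lemma dotpDr x g1 g2 : dotp x (g1 + g2) = dotp x g1 + dotp x g2.
Proof. by rewrite /dotp mulmxDr mxE. Qed.

Lemma dotpZr c x g : dotp x (c *: g) = c * dotp x g.
Proof. by rewrite /dotp -scalemxAr mxE. Qed.

Lemma dotp0l g : dotp 0 g = 0. Proof. by rewrite /dotp mul0mx mxE. Qed.

Lemma dotp_eq0 x g : (x *m g == 0) = (dotp x g == 0).
Proof.
apply/eqP/eqP => [E|E]; first by rewrite /dotp E mxE.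
by apply/matrixP => i j; rewrite !ord1 [RHS]mxE; exact: E.
Qed.

Lemma bil_dotp H x y : bil H x y = dotp x (H *m y^T).
Proof. by rewrite /bil /dotp mulmxA. Qed.

Lemma bilE H x y : bil H x y = \sum_i \sum_j x 0 i * H i j * y 0 j.
Proof.
rewrite /bil mxE exchange_big; apply: eq_bigr => j _; rewrite !mxE mulr_suml.
by apply: eq_bigr.
Qed.

Lemma bilDl H x y z : bil H (x + y) z = bil H x z + bil H y z.
Proof. by rewrite !bil_dotp dotpDl. Qed.

Lemma bilZl H c x y : bil H (c *: x) y = c * bil H x y.
Proof. by rewrite !bil_dotp dotpZl. Qed.

Lemma bilDr H x y z : bil H x (y + z) = bil H x y + bil H x z.
Proof. by rewrite !bil_dotp linearD /= mulmxDr dotpDr. Qed.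

Lemma bilZr H c x y : bil H x (c *: y) = c * bil H x y.
Proof. by rewrite !bil_dotp linearZ /= -scalemxAr dotpZr. Qed.

Lemma bil0l H x : bil H 0 x = 0.
Proof. by rewrite bil_dotp dotp0l. Qed.

Lemma bil0r H x : bil H x 0 = 0.
Proof. by rewrite -(scale0r x) bilZr mul0r. Qed.

Lemma bilC H x y : H^T = H -> bil H x y = bil H y x.
Proof.
move=> HT; rewrite /bil -[LHS](mxE trmx_key (fun i j => (x *m H *m y^T) j i) 0 0).
by rewrite -[matrix_of_fun _ _]/((x *m H *m y^T)^T) !trmx_mul trmxK HT mulmxA.
Qed.

End Bilinear.

Section Curves.
Variables (k : closedFieldType) (N : nat).
Implicit Types (F : {mpoly k[N]}) (c : 'I_N -> {poly k}) (p v : 'rV[k]_N).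

Definition mcurve c F : {poly k} := mmap polyC c F.

Lemma mcurve_horner c F t : (mcurve c F).[t] = F.@[fun i => (c i).[t]].
Proof.
apply: (mpoly_morph_ext (f := horner_eval t \o mmap polyC c) (g := meval _)) => [a|i] /=.
  by rewrite mmapC /horner_eval hornerC mevalC.
by rewrite mmapXi mevalXU.
Qed.

Lemma mcurve_deriv c F : (mcurve c F)^`() = \sum_i mcurve c F^`M(i) * (c i)^`().
Proof.
apply: (@chain_rule k {poly k} N polyC c (@deriv k) F) => [x y|x y|a].
- exact: derivD.
- exact: derivM.
- exact: derivC.
Qed.

Definition grad F p : 'cV[k]_N := \col_i peval F^`M(i) p.
Definition hess F p : 'M[k]_N := \matrix_(i, j) peval F^`M(i)^`M(j) p.

Lemma hess_sym F p : (hess F p)^T = hess F p.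
Proof. by apply/matrixP => i j; rewrite !mxE mderiv_comm. Qed.

(** Terms of order one and two of the expansion of [F] along a conic: the bending [b] enters the
    second order through the gradient. *)
Lemma quadratic_curve F (e a b : 'rV[k]_N) :
  (forall t, peval F (e + t *: a + t ^+ 2 *: b) = 0) ->
  dotp a (grad F e) = 0 /\ bil (hess F e) a a + 2%:R * dotp b (grad F e) = 0.
Proof.
move=> van; pose c i := (e 0 i)%:P + (a 0 i)%:P * 'X + (b 0 i)%:P * 'X^2.
have cE t i : (c i).[t] = e 0 i + a 0 i * t + b 0 i * t ^+ 2 by rewrite !hornerE.
have c0 : mcurve c F = 0.
  apply: poly_ext => t; rewrite mcurve_horner horner0 -[RHS](van t).
  by apply: meval_eq => i; rewrite cE !mxE; ring.
have c' i : (c i)^`() = (a 0 i)%:P + (b 0 i)%:P * 'X *+ 2.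
  by rewrite /c expr2 !(derivD, derivM, derivC, derivX); ring.
have c'0 i : ((c i)^`()).[0] = a 0 i.
  by rewrite c' hornerD hornerMn hornerM hornerX !hornerC mulr0 mul0rn addr0.
have c0E G : (mcurve c G).[0] = peval G e.
  rewrite mcurve_horner; apply: meval_eq => i; rewrite cE; ring.
have D1 : \sum_i mcurve c F^`M(i) * (c i)^`() = 0 by rewrite -mcurve_deriv c0 deriv0.
split.
  have := congr1 (fun q => q.[0]) D1; rewrite horner_sum horner0 => <-.
  rewrite dotpE; apply: eq_bigr => i _; by rewrite hornerM c0E c'0 mxE mulrC.
have := congr1 (fun q => q^`().[0]) D1; rewrite deriv0 horner0 => <-.
rewrite bilE dotpE raddf_sum horner_sum mulr_sumr -big_split; apply: eq_bigr => i _ /=.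
have c''0 : ((c i)^`()^`()).[0] = 2%:R * b 0 i.
  by rewrite c' derivD derivMn derivM !derivC derivX mul0r !add0r mulr1 hornerMn hornerC mulr_natl.
rewrite derivM mcurve_deriv hornerD !hornerM c0E c'0 c''0 !mxE; congr (_ + _); last by ring.
rewrite horner_sum mulr_suml; apply: eq_bigr => j _.
by rewrite hornerM c0E c'0 !mxE; ring.
Qed.

Lemma line_tangent F (e a : 'rV[k]_N) :
  (forall t, peval F (e + t *: a) = 0) ->
  dotp a (grad F e) = 0 /\ bil (hess F e) a a = 0.
Proof.
move=> van; have [|ga] := @quadratic_curve F e a 0.
  by move=> t; rewrite scaler0 addr0.
by rewrite dotp0l mulr0 addr0.
Qed.

Lemma euler F d p : F \is d.-homog -> dotp p (grad F p) = d%:R * peval F p.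
Proof.
move=> Fd; pose c i := (p 0 i)%:P * 'X.
have cE : mcurve c F = peval F p *: 'X^d.
  apply: poly_ext => t; rewrite mcurve_horner hornerZ hornerXn mulrC -(pevalZ _ _ Fd).
  by apply: meval_eq => i; rewrite !hornerE mxE mulrC.
have dE : (mcurve c F)^`().[1] = d%:R * peval F p.
  by rewrite cE derivZ derivXn hornerZ hornerMn hornerXn expr1n mulrC.
rewrite -dE mcurve_deriv horner_sum dotpE; apply: eq_bigr => i _.
rewrite hornerM mcurve_horner derivM derivC derivX mul0r add0r mulr1 hornerC mxE mulrC.
congr (_ * _); apply: meval_eq => j.
by rewrite hornerM hornerC hornerX mulr1.
Qed.

Lemma hess_euler F d p : F \is d.-homog -> hess F p *m p^T = d.-1%:R *: grad F p.
Proof.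
move=> Fd; apply/colP => i; rewrite !mxE -(euler _ (mderiv_dhomog i Fd)) dotpE.
by apply: eq_bigr => j _; rewrite !mxE mulrC.
Qed.

(** Tangent vectors are therefore orthogonal to [p], so at a point of the hypersurface [p] lies in
    the radical of the Hessian form on the tangent space. *)
Lemma bil_point F d p x : F \is d.-homog ->
  bil (hess F p) x p = d.-1%:R * dotp x (grad F p).
Proof. by move=> Fhom; rewrite bil_dotp (hess_euler _ Fhom) dotpZr. Qed.

End Curves.

(** * Points whose Hessian has rank at most two on the tangent space *)

Lemma closed_sqrt (k : closedFieldType) (c : k) : exists s, s ^+ 2 = c.
Proof.
have : size ('X^2 - c%:P : {poly k}) != 1%N by rewrite size_XnsubC.
case/closed_rootP=> s /rootP; rewrite hornerD hornerN hornerXn hornerC => /eqP.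
by rewrite subr_eq0 => /eqP; exists s.
Qed.

(** The equations [A *m e = 0] leave a space of dimension at least two, which is not contained in
    the line spanned by [g]. *)
Lemma hyperplane_through (k : fieldType) m N (A : 'M[k]_(m, N)) (g : 'cV[k]_N) :
  (m + 2 <= N)%N ->
  exists e : 'cV[k]_N, [/\ A *m e = 0, ~~ (e^T <= g^T)%MS & e != 0].
Proof.
move=> mN; have : ~~ (kermx A^T <= g^T)%MS.
  apply/negP => /mxrankS; rewrite mxrank_ker mxrank_tr leqNgt => /negP; apply.
  have := rank_leq_row A; have := rank_leq_row g^T; lia.
case/row_subPn=> i ei; exists (row i (kermx A^T))^T; rewrite trmxK ei; split=> //.
  apply: trmx_inj; rewrite trmx_mul trmxK trmx0.
  by apply/sub_kermxP; apply: row_sub.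
apply: contraNneq ei => /(congr1 trmx); rewrite trmxK trmx0 => ->.
exact: sub0mx.
Qed.

Lemma isotropic_rank (k : fieldType) m N (U : 'M[k]_(m, N)) (H : 'M[k]_N) :
  (forall x y : 'rV_N, (x <= U)%MS -> (y <= U)%MS -> bil H x y = 0) ->
  (\rank U + \rank (U *m H) <= N)%N.
Proof.
move=> iso; rewrite addnC -(mxrank_tr U); apply: mulmx0_rank_max.
apply/matrixP => i j; have := iso (row i U) (row j U) (row_sub _ _) (row_sub _ _).
rewrite /bil -row_mul mxE => E; rewrite mxE [RHS]mxE -[RHS]E.
by apply: eq_bigr => l _; rewrite [row _ _ _ _]mxE !mxE.
Qed.

Lemma ord3P (i : 'I_3) : i = 0 \/ i = 1 \/ i = 2%:R.
Proof.
by case: i => [[|[|[|//]]] li]; [left|right; left|right; right]; apply: val_inj.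
Qed.

Lemma row3_eq0 (k : fieldType) (u : 'rV[k]_3) :
  u 0 0 = 0 -> u 0 1 = 0 -> u 0 2%:R = 0 -> u = 0.
Proof. by move=> *; apply/rowP => i; rewrite mxE; case: (ord3P i) => [|[]] ->. Qed.

Section PointOfHypersurface.
Variables (k : closedFieldType) (hchar : [pchar k] =i pred0).
Variables (n d : nat) (F : {mpoly k[n.+1]}) (p : 'rV[k]_n.+1).
Hypotheses (n4 : (4 <= n)%N) (d2 : (2 <= d)%N) (Fhom : F \is d.-homog).
Hypothesis Fp : peval F p = 0.
Hypothesis sect : forall e : 'cV[k]_n.+1, e != 0 -> dotp p e = 0 ->
  exists M : 'M[k]_(n - 2, n.+1),
    [/\ row_free M, (p <= M)%MS &
        forall x : 'rV_n.+1, (x <= M)%MS -> dotp x e = 0 /\ peval F x = 0].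

Let g := grad F p.
Let H := hess F p.
Implicit Types x y z v : 'rV[k]_n.+1.

Lemma two_neq0 : (2%:R : k) != 0.
Proof. exact: char0_natf_neq0. Qed.

Lemma point_tangent : dotp p g = 0.
Proof. by rewrite /g (euler _ Fhom) Fp mulr0. Qed.

Lemma bilS x y : bil H x y = bil H y x.
Proof. by apply: bilC; apply: hess_sym. Qed.

Lemma isotropic_of_vanishing m (M : 'M[k]_(m, n.+1)) :
  (p <= M)%MS -> (forall x, (x <= M)%MS -> peval F x = 0) ->
  (forall x, (x <= M)%MS -> dotp x g = 0) /\
  (forall x y, (x <= M)%MS -> (y <= M)%MS -> bil H x y = 0).
Proof.
move=> pM FM; have tang x : (x <= M)%MS -> dotp x g = 0 /\ bil H x x = 0.
  by move=> xM; apply: line_tangent => t; apply: FM; rewrite addmx_sub ?scalemx_sub.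
split=> [x /tang[]//|x y xM yM].
have [_ xx] := tang x xM; have [_ yy] := tang y yM.
have [_] := tang (x + y) (addmx_sub xM yM).
rewrite bilDl !bilDr xx yy (bilS y x) add0r addr0 => /eqP.
rewrite -mulr2n -mulr_natl mulf_eq0 (negPf two_neq0) => /eqP//.
Qed.

Hypothesis g0 : g != 0.

Lemma kernel_rank (e : 'cV[k]_n.+1) : ~~ (e^T <= g^T)%MS ->
  \rank (kermx (row_mx g e)) = n.-1.
Proof.
move=> eg; rewrite mxrank_ker -mxrank_tr tr_row_mx.
suff -> : \rank (col_mx g^T e^T) = 2 by lia.
rewrite -addsmxE; apply/eqP; rewrite eqn_leq; apply/andP; split.
  by rewrite addsmxE; apply: rank_leq_row.
have : (g^T < g^T + e^T)%MS.
  by rewrite /ltmx addsmxSl /=; apply: contra eg; apply: submx_trans; apply: addsmxSr.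
by rewrite ltmxErank => /andP[_]; rewrite rank_rV trmx_eq0 g0.
Qed.

Lemma sub_kernel (e : 'cV[k]_n.+1) x :
  (x <= kermx (row_mx g e))%MS = (dotp x g == 0) && (dotp x e == 0).
Proof.
rewrite sub_kermx mul_mx_row -!dotp_eq0; apply/eqP/andP => [E|[/eqP-> /eqP->]].
  by split; apply/eqP; [have := congr1 lsubmx E | have := congr1 rsubmx E];
    rewrite ?row_mxKl ?row_mxKr ?linear0.
by rewrite row_mx0.
Qed.

Hypothesis rank_hyp : (5 <= n)%N \/ (n = 4%N /\ \det H = 0).

Definition rows3 x y z : 'M[k]_(3, n.+1) :=
  \matrix_(i < 3, j < n.+1) (tnth [tuple x; y; z] i) 0 j.

Lemma mul_rows3 (u : 'rV[k]_3) x y z :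
  u *m rows3 x y z = u 0 0 *: x + u 0 1 *: y + u 0 2%:R *: z.
Proof.
apply/rowP => j; rewrite !mxE !big_ord_recl big_ord0 addr0 !mxE addrA.
congr (u _ _ * _ + u _ _ * _ + u _ _ * _); exact: val_inj.
Qed.

Lemma sub_rows3 v x y z : (v <= rows3 x y z)%MS ->
  exists a b c, v = a *: x + b *: y + c *: z.
Proof. by case/submxP=> u ->; rewrite mul_rows3; exists (u 0 0), (u 0 1), (u 0 2%:R). Qed.

(* A hyperplane through [p], [x], [y], [z] meets the hypersurface in a linear space of
   codimension one, whose trace on the span of [x], [y], [z] would be an isotropic plane
   for a nondegenerate form in three variables. *)
Lemma no_three_orthogonal x y z :
  dotp x g = 0 -> dotp y g = 0 -> dotp z g = 0 ->
  bil H x y = 0 -> bil H x z = 0 -> bil H y z = 0 ->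
  bil H x x != 0 -> bil H y y != 0 -> bil H z z = 0.
Proof.
move=> xg yg zg xy xz yz xx yy; apply/eqP/negPn/negP => zz.
have pb v : dotp v g = 0 -> bil H p v = 0 by move=> vg; rewrite bilS (bil_point _ _ Fhom) vg mulr0.
case: rank_hyp => [n5|[nE detH]].
  pose A := col_mx p (rows3 x y z).
  (* A hyperplane through four vectors that differs from the tangent one requires [6 <= n.+1]. *)
  have [|e [Ae eg e0]] := @hyperplane_through k (1 + 3) n.+1 A g; first by lia.
  move: Ae; rewrite mul_col_mx -[0]vsubmxK => /eq_col_mx[].
  rewrite !linear0 => pe Ae.
  have [|M [Mfree pM MF]] := sect e0; first by rewrite /dotp pe mxE.
  have [Mg Miso] := isotropic_of_vanishing pM (fun v vM => (MF v vM).2).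
  pose K := kermx (row_mx g e).
  have MK : (M <= K)%MS.
    apply/row_subP => i; rewrite sub_kernel Mg ?row_sub // eqxx /=.
    by have [-> _] := MF _ (row_sub i M).
  have AK : (rows3 x y z <= K)%MS.
    apply/row_subP => i; have ke : row i (rows3 x y z) *m e = 0 by rewrite -row_mul Ae linear0.
    rewrite sub_kernel -(dotp_eq0 _ e) ke eqxx andbT.
    have [->|[->|->]] := ord3P i.
    - by rewrite (_ : row _ _ = x) ?xg //; apply/rowP => j; rewrite !mxE.
    - by rewrite (_ : row _ _ = y) ?yg //; apply/rowP => j; rewrite !mxE.
    - by rewrite (_ : row _ _ = z) ?zg //; apply/rowP => j; rewrite !mxE.
  have rA : \rank (rows3 x y z) = 3.
    apply/eqP; apply: inj_row_free => u; rewrite mul_rows3 => u0.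
    have ux : u 0 0 = 0.
      have := congr1 (bil H x) u0; rewrite bil0r !bilDr !bilZr xy xz.
      by rewrite !mulr0 !addr0 => /eqP; rewrite mulf_eq0 (negPf xx) orbF => /eqP.
    have uy : u 0 1 = 0.
      have := congr1 (bil H y) u0; rewrite bil0r !bilDr !bilZr (bilS y x) xy yz.
      by rewrite !mulr0 addr0 add0r => /eqP; rewrite mulf_eq0 (negPf yy) orbF => /eqP.
    have uz : u 0 2%:R = 0.
      have := congr1 (bil H z) u0; rewrite bil0r !bilDr !bilZr (bilS z x) (bilS z y) xz yz.
        by rewrite !mulr0 !add0r => /eqP; rewrite mulf_eq0 (negPf zz) orbF => /eqP.
    exact: row3_eq0.
  pose U := (rows3 x y z :&: M)%MS.
  (* Inside [K], of dimension n - 1, spaces of dimensions 3 and n - 2 meet in dimension at least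
     2. *)
  have rU : (2 <= \rank U)%N.
    have := mxrank_sum_cap (rows3 x y z) M; rewrite rA (eqP Mfree) -/U.
    have : (\rank (rows3 x y z + M)%MS <= \rank K)%N by apply: mxrankS; rewrite addsmx_sub AK.
    by rewrite /K (kernel_rank eg); clear - n4; lia.
  pose C := U *m pinvmx (rows3 x y z).
  have UC : C *m rows3 x y z = U by rewrite mulmxKpV // capmxSl.
  have rC : (2 <= \rank C)%N by rewrite (leq_trans rU) // -UC mxrankM_maxl.
  pose qx := bil H x x; pose qy := bil H y y; pose qz := bil H z z.
  pose D : 'M[k]_3 := diag_mx (\row_i (tnth [tuple qx; qy; qz] i)).
  have bD (u w : 'rV[k]_3) : bil D u w = bil H (u *m rows3 x y z) (w *m rows3 x y z).
    rewrite !mul_rows3 !(bilDl, bilDr, bilZl, bilZr) xy xz yz (bilS y x) (bilS z x) (bilS z y).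
    rewrite xy xz yz !mulr0 !addr0 !add0r -/qx -/qy -/qz.
    rewrite /bil mul_mx_diag mxE !big_ord_recl big_ord0 !mxE !(tnth_nth 0) /=.
    have -> : lift ord0 ord0 = 1 :> 'I_3 by apply: val_inj.
    have -> : lift ord0 (lift ord0 ord0) = 2%:R :> 'I_3 by apply: val_inj.
    by ring.
  have Dfree : row_free D.
    rewrite row_free_unit unitmxE det_diag unitfE; apply/prodf_neq0 => i _; rewrite mxE.
    by case: i => [[|[|[|//]]] li].
  have := @isotropic_rank k _ 3 C D; rewrite mxrankMfree // => iso.
  have /iso : forall u w : 'rV_3, (u <= C)%MS -> (w <= C)%MS -> bil D u w = 0.
    move=> u w uC wC; rewrite bD.
    have inM (v : 'rV_3) : (v <= C)%MS -> (v *m rows3 x y z <= M)%MS.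
      move=> vC; apply: submx_trans (capmxSr (rows3 x y z) M); rewrite -/U -UC.
      exact: submxMr.
    by apply: Miso; apply: inM.
  by clear - rC; lia.
(* Here n = 4. The kernel vector [w] of the Hessian is tangent, and [x], [y], [z], [p], [w] turn out
   to be five independent vectors in the four-dimensional tangent space. *)
have [w w0 wH] : exists2 w : 'rV[k]_n.+1, w != 0 & w *m H = 0 by apply/det0P; rewrite detH.
have wb v : bil H w v = 0 by rewrite /bil wH mul0mx mxE.
have d1 : d.-1%:R != 0 :> k by apply: char0_natf_neq0 => //; lia.
have wg : dotp w g = 0.
  by have /eqP := bil_point p w Fhom; rewrite wb eq_sym mulf_eq0 (negPf d1) => /eqP.
pose A := col_mx (rows3 x y z) (col_mx p w).
have Afree : row_free A.
  apply: inj_row_free => u; rewrite -[u]hsubmxK -[rsubmx u]hsubmxK.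
  set a := lsubmx u; set b := lsubmx (rsubmx u); set c := rsubmx (rsubmx u).
  rewrite !mul_row_col mul_rows3 [b]mx11_scalar [c]mx11_scalar !mul_scalar_mx => u0.
  have ux : a 0 0 = 0.
    have := congr1 (bil H x) u0; rewrite bil0r !bilDr !bilZr xy xz.
    rewrite (bilS x w) wb (bilS x p) (pb x xg).
    by rewrite !mulr0 !addr0 => /eqP; rewrite mulf_eq0 (negPf xx) orbF => /eqP.
  have uy : a 0 1 = 0.
    have := congr1 (bil H y) u0; rewrite bil0r !bilDr !bilZr (bilS y x) xy yz.
    rewrite (bilS y w) wb (bilS y p) (pb y yg).
    by rewrite !mulr0 !addr0 add0r => /eqP; rewrite mulf_eq0 (negPf yy) orbF => /eqP.
  have uz : a 0 2%:R = 0.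
    have := congr1 (bil H z) u0; rewrite bil0r !bilDr !bilZr (bilS z x) (bilS z y) xz yz.
    rewrite (bilS z w) wb (bilS z p) (pb z zg).
    by rewrite !mulr0 !addr0 !add0r => /eqP; rewrite mulf_eq0 (negPf zz) orbF => /eqP.
  move: u0; rewrite ux uy uz !scale0r !add0r => u0.
  (* A vector [v] off the tangent hyperplane detects [p], since [bil H v p] is [d.-1] times
     [dotp v g]. *)
  have up : b 0 0 = 0.
    have [v vg] : exists v, dotp v g != 0.
      apply: NNPP => nv; case/eqP: g0; apply/colP => i; rewrite [RHS]mxE.
      apply/eqP/negPn/negP => gi; apply: nv; exists (delta_mx 0 i).
      by rewrite /dotp -rowE mxE.
    have := congr1 (bil H v) u0; rewrite bil0r bilDr !bilZr (bilS v w) wb (bil_point _ _ Fhom).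
    rewrite mulr0 addr0 => /eqP.
    by rewrite !mulf_eq0 (negPf d1) (negPf vg) !orbF => /eqP.
  move: u0; rewrite up scale0r add0r => /eqP; rewrite scaler_eq0 (negPf w0) orbF => /eqP uw.
  by rewrite uw raddf0 row_mx0 (row3_eq0 ux uy uz) row_mx0.
have : (A <= kermx g)%MS.
  apply/sub_kermxP; rewrite !mul_col_mx.
  have -> : rows3 x y z *m g = 0.
    apply/colP => i; rewrite [RHS]mxE.
    have [->|[->|->]] := ord3P i.
    - by rewrite -[RHS]xg dotpE mxE; apply: eq_bigr => j _; rewrite mxE.
    - by rewrite -[RHS]yg dotpE mxE; apply: eq_bigr => j _; rewrite mxE.
    - by rewrite -[RHS]zg dotpE mxE; apply: eq_bigr => j _; rewrite mxE.
  have /eqP := point_tangent; rewrite -dotp_eq0 => /eqP ->.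
  by have /eqP := wg; rewrite -dotp_eq0 => /eqP ->; rewrite !col_mx0.
move/mxrankS; rewrite (eqP Afree) mxrank_ker -mxrank_tr rank_rV trmx_eq0 g0; lia.
Qed.

Hypothesis bil_neq0 : exists x y, [/\ dotp x g = 0, dotp y g = 0 & bil H x y != 0].

Lemma tangent_nonisotropic : exists2 x, dotp x g = 0 & bil H x x != 0.
Proof.
have [x [y [xg yg xy]]] := bil_neq0.
have [xx|] := eqVneq (bil H x x) 0; last by exists x.
have [yy|] := eqVneq (bil H y y) 0; last by exists y.
exists (x + y); first by rewrite dotpDl xg yg addr0.
rewrite bilDl !bilDr xx yy (bilS y x) add0r addr0 -mulr2n -mulr_natl mulf_neq0 //.
exact: two_neq0.
Qed.

(** Orthogonal diagonalisation: by [no_three_orthogonal] at most two squares survive. A sum of two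
    squares factors with the help of a square root of [- (bil H a a / bil H b b)]; a single square
    is a product already. The last clause says that neither factor vanishes on the whole tangent
    space. *)
Lemma hessian_splits : exists (c : k) (e1 e2 : 'cV[k]_n.+1),
  [/\ forall x, dotp x g = 0 -> bil H x x = c * (dotp x e1 * dotp x e2),
      dotp p e1 = 0 /\ dotp p e2 = 0 &
      exists x, [/\ dotp x g = 0, dotp x e1 != 0 & dotp x e2 != 0]].
Proof.
have [a ag aa] := tangent_nonisotropic.
have pb v : dotp v g = 0 -> bil H p v = 0 by move=> vg; rewrite bilS (bil_point _ _ Fhom) vg mulr0.
pose proj b x := x - (bil H b x / bil H b b) *: b.
have projg b x : dotp b g = 0 -> dotp x g = 0 -> dotp (proj b x) g = 0.
  by move=> bg xg; rewrite /proj -scaleNr dotpDl dotpZl bg xg mulr0 addr0.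
have projb b x : bil H b b != 0 -> bil H b (proj b x) = 0.
  by move=> bb; rewrite /proj -scaleNr bilDr bilZr mulNr divfK // subrr.
have projq b x : bil H b b != 0 ->
    bil H x x = bil H (proj b x) (proj b x) + bil H b x ^+ 2 / bil H b b.
  move=> bb; rewrite /proj -scaleNr !(bilDl, bilDr, bilZl, bilZr) (bilS x b).
  by field.
case: (classic (exists b, [/\ dotp b g = 0, bil H a b = 0 & bil H b b != 0])).
  case=> b [bg ab bb].
  have [s sE] := closed_sqrt (- (bil H a a / bil H b b)).
  pose e1 := H *m (a + s *: b)^T; pose e2 := H *m (a - s *: b)^T.
  have dotE x c : dotp x (H *m (a + c *: b)^T) = bil H a x + c * bil H b x.
    by rewrite -bil_dotp bilDr bilZr (bilS x a) (bilS x b).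
  have split x : dotp x g = 0 -> bil H x x = (bil H a a)^-1 * (dotp x e1 * dotp x e2).
    move=> xg; rewrite (projq a) // (projq b (proj a x)) //.
    have -> : bil H (proj b (proj a x)) (proj b (proj a x)) = 0.
      apply: (@no_three_orthogonal a b) => //; rewrite ?projb //.
      + by rewrite projg // projg.
      + by rewrite /proj -!scaleNr !bilDr !bilZr ab mulr0 addr0 mulNr divfK // subrr.
    have -> : bil H b (proj a x) = bil H b x.
      by rewrite /proj -scaleNr bilDr bilZr (bilS b a) ab mulr0 addr0.
    rewrite /e1 /e2 -scaleNr !dotE.
    have -> : (bil H a x + s * bil H b x) * (bil H a x + - s * bil H b x)
       = bil H a x ^+ 2 - s ^+ 2 * bil H b x ^+ 2 by ring.
    by rewrite sE; field; rewrite aa bb.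
  exists (bil H a a)^-1, e1, e2; split=> //.
    by rewrite /e1 /e2 -scaleNr !dotE (bilS a p) (bilS b p) !pb // !mulr0 !addr0.
  exists a; have := split a ag => E.
  have : dotp a e1 * dotp a e2 != 0.
    by apply: contraNneq aa => e0; rewrite E e0 mulr0.
  by rewrite mulf_eq0 negb_or => /andP[].
move=> nb; exists (bil H a a)^-1, (H *m a^T), (H *m a^T).
have split x : dotp x g = 0 -> bil H x x = (bil H a a)^-1 * (dotp x (H *m a^T) * dotp x (H *m a^T)).
  move=> xg; rewrite (projq a) // -bil_dotp (bilS x a).
  have -> : bil H (proj a x) (proj a x) = 0.
    apply/eqP/negPn/negP => q0; apply: nb; exists (proj a x).
    by rewrite projg // projb.
  by field.
split=> //; first by rewrite -bil_dotp pb.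
by exists a; rewrite -bil_dotp.
Qed.

Lemma rows3_sub x y z :
  [/\ (x <= rows3 x y z)%MS, (y <= rows3 x y z)%MS & (z <= rows3 x y z)%MS].
Proof.
split; apply/submxP;
  [exists (delta_mx 0 0) | exists (delta_mx 0 1) | exists (delta_mx 0 2%:R)];
  by rewrite mul_rows3 !mxE /= !scale1r !scale0r ?addr0 ?add0r.
Qed.

Lemma dotp_not_parallel (e : 'cV[k]_n.+1) x :
  dotp x g = 0 -> dotp x e != 0 -> ~~ (e^T <= g^T)%MS.
Proof.
move=> xg; apply: contra => /submxP[a /(congr1 trmx)]; rewrite trmx_mul !trmxK => ->.
by rewrite /dotp mulmxA; have /eqP := xg; rewrite -dotp_eq0 => /eqP ->; rewrite mul0mx mxE.
Qed.

Let cone v := forall a b, peval F (a *: p + b *: v) = 0.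

(** A non-tangent hyperplane through [p], [v], [w] yields an isotropic linear space [M]. The product
    of the two forms vanishes on [M], and [M] is linear, so one of them does; by dimension [M] is
    the whole kernel of that form in [K], and so contains its kernel in the span of [p], [v],
    [w]. *)
Lemma cone_of_section (e1 e2 : 'cV[k]_n.+1) v w :
  (forall x, dotp x g = 0 -> bil H x x = 0 -> dotp x e1 * dotp x e2 = 0) ->
  dotp v g = 0 -> dotp w g = 0 ->
  (exists2 x, (x <= rows3 p v w)%MS & dotp x e1 != 0) ->
  (exists2 x, (x <= rows3 p v w)%MS & dotp x e2 != 0) ->
  (forall x, (x <= rows3 p v w)%MS -> dotp x e1 = 0 -> cone x) \/
  (forall x, (x <= rows3 p v w)%MS -> dotp x e2 = 0 -> cone x).
Proof.
move=> split vg wg ex1 ex2; set V := rows3 p v w.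
have [|e [Ve eg e0]] := @hyperplane_through k 3 n.+1 V g; first by clear - n4; lia.
have Vdot x : (x <= V)%MS -> dotp x g = 0 /\ dotp x e = 0.
  move=> xV; split; last first.
    by case/submxP: xV => a ->; rewrite /dotp -mulmxA Ve mulmx0 mxE.
  have [a [b [c ->]]] := sub_rows3 xV.
  by rewrite !dotpDl !dotpZl vg wg point_tangent !mulr0 !addr0.
have [|M [Mfree pM MF]] := sect e0.
  by have [pV _ _] := rows3_sub p v w; have [] := Vdot p pV.
have [Mg Miso] := isotropic_of_vanishing pM (fun x xM => (MF x xM).2).
pose K := kermx (row_mx g e).
have one e' : (forall x, (x <= M)%MS -> dotp x e' = 0) ->
    (exists2 x, (x <= V)%MS & dotp x e' != 0) ->
    forall x, (x <= V)%MS -> dotp x e' = 0 -> cone x.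
  move=> Me' [y yV ye'] x xV xe' a b.
  suff xM : (x <= M)%MS by apply: (MF _ _).2; rewrite addmx_sub ?scalemx_sub.
  have inK z : (z <= V)%MS -> (z <= K)%MS.
    by move=> /Vdot[zg ze]; rewrite sub_kernel zg ze !eqxx.
  have ker' z : (z <= kermx e')%MS = (dotp z e' == 0) by rewrite sub_kermx dotp_eq0.
  have ML : (M <= K :&: kermx e')%MS.
    apply/row_subP => i; rewrite sub_capmx sub_kernel ker'.
    by rewrite Mg ?row_sub // (MF _ (row_sub i M)).1 Me' ?row_sub // !eqxx.
  have LK : (\rank (K :&: kermx e')%MS < \rank K)%N.
    rewrite ltn_neqAle mxrankS ?capmxSl // andbT.
    apply/negP => /eqP rE; have : (K :&: kermx e' == K)%MS.
      by rewrite -(geq_leqif (mxrank_leqif_eq (capmxSl _ _))) rE.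
    case/andP=> _; move/(submx_trans (inK y yV)); rewrite sub_capmx ker' => /andP[_].
    by rewrite (negPf ye').
  have : (M == K :&: kermx e')%MS.
    rewrite -(geq_leqif (mxrank_leqif_eq ML)) (eqP Mfree).
    by move: LK; rewrite [\rank K](kernel_rank eg); clear - n4; lia.
  by move/eqmxP->; rewrite sub_capmx inK //= ker' xe'.
case: (classic (forall x, (x <= M)%MS -> dotp x e1 = 0)) => [M1|nM1].
  by left; apply: one.
right; apply: one => // x2 x2M.
have Mprod x : (x <= M)%MS -> dotp x e1 * dotp x e2 = 0.
  by move=> xM; apply: split; [apply: Mg | apply: Miso].
have [x1 x1M x1e1] : exists2 x, (x <= M)%MS & dotp x e1 != 0.
  apply: NNPP => nx; apply: nM1 => x xM; apply/eqP/negPn/negP => xe.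
  by apply: nx; exists x.
have x1e2 : dotp x1 e2 = 0.
  by have /eqP := Mprod x1 x1M; rewrite mulf_eq0 (negPf x1e1) => /eqP.
have /eqP := Mprod (x1 + x2) (addmx_sub x1M x2M).
rewrite !dotpDl x1e2 add0r mulf_eq0 => /orP[/eqP x12|/eqP//].
have /eqP := Mprod x2 x2M; rewrite mulf_eq0 => /orP[/eqP x2e1|/eqP//].
by move: x12; rewrite x2e1 addr0 => /eqP; rewrite (negPf x1e1).
Qed.

(** [cone_of_section] chooses between [e1] and [e2] for each pair of vectors separately. If neither
    choice worked throughout, there would be a counterexample [v1] for [e1] and [v2] for [e2]; the
    choice made for the pair [v1], [v2] contradicts one of them. *)
Lemma covered_of_split : covered_at (n - 1) F p.
Proof.
have [c [e1 [e2 [split [pe1 pe2] [u [ug ue1 ue2]]]]]] := hessian_splits.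
have c0 : c != 0.
  have [x xg xx] := tangent_nonisotropic.
  by apply: contraNneq xx => c0; rewrite split // c0 mul0r.
have prod0 x : dotp x g = 0 -> bil H x x = 0 -> dotp x e1 * dotp x e2 = 0.
  by move=> xg /eqP; rewrite split // mulf_eq0 (negPf c0) => /eqP.
have plane e : dotp p e = 0 -> dotp u e != 0 ->
    (forall v, dotp v g = 0 -> dotp v e = 0 -> cone v) -> covered_at (n - 1) F p.
  move=> pe ue con; apply: (@covered_at_subspace _ _ _ _ _ _ (kermx (row_mx g e))).
  - by rewrite kernel_rank ?subn1 // (dotp_not_parallel ug ue).
  - by rewrite sub_kernel pe point_tangent !eqxx.
  move=> x; rewrite sub_kernel => /andP[/eqP xg /eqP xe].
  by have := con x xg xe 0 1; rewrite scale0r scale1r add0r.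
apply: NNPP => ncov.
have bad e : dotp p e = 0 -> dotp u e != 0 ->
    exists v, [/\ dotp v g = 0, dotp v e = 0 & ~ cone v].
  move=> pe ue; apply: NNPP => nv; apply: ncov; apply: (plane e) => // v vg ve.
  by apply: NNPP => nc; apply: nv; exists v.
have [v1 [v1g v1e1 v1c]] := bad e1 pe1 ue1.
have [v2 [v2g v2e2 v2c]] := bad e2 pe2 ue2.
have both v : dotp v g = 0 -> dotp v e1 = 0 -> dotp v e2 = 0 -> cone v.
  move=> vg ve1 ve2; have [_ vV uV] := rows3_sub p v u.
  by case: (cone_of_section prod0 vg ug) => [||C|C]; [exists u | exists u | apply: C | apply: C].
have v1e2 : dotp v1 e2 != 0.
  by apply/eqP => v1e2; apply: v1c; apply: both.
have v2e1 : dotp v2 e1 != 0.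
  by apply/eqP => v2e1; apply: v2c; apply: both.
have [_ v1V v2V] := rows3_sub p v1 v2.
case: (cone_of_section prod0 v1g v2g) => [||C|C].
- by exists v2.
- by exists v1.
- by apply: v1c; apply: C.
- by apply: v2c; apply: C.
Qed.

End PointOfHypersurface.

(** * Nonvanishing of the second fundamental form *)

(* [D] is a vector field along the hypersurface [P = 0] whose integral curves are
   straight lines modulo [P], up to reparametrization; so the tangent line at each point
   in the direction of [D] lies in the hypersurface. *)
Lemma tangent_flow (R0 : comNzRingType) (A : idomainType) (f : {rmorphism R0 -> A}) N
    (X r : 'I_N -> A) (D : A -> A) (F : {mpoly R0[N]}) (c kappa : A) :
  (forall x y, D (x + y) = D x + D y) -> (forall x y, D (x * y) = D x * y + x * D y) ->
  (forall a, D (f a) = 0) ->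
  let P := mmap f X F in
  prime_elt P -> D P = 0 -> ~ divides P c -> (forall m, ~ divides P m.+1%:R) ->
  (forall i, c * D (D (X i)) = kappa * D (X i) + P * r i) ->
  forall m, divides P (mmap (polyC \o f) (fun i => (X i)%:P + D (X i) *: 'X) F)`_m.
Proof.
move=> DD DM DC P [_ _ PM] DP nPc nPm curv.
have D0 : D 0 = 0 by have := DD 0 0; rewrite addr0 => E; apply: (addrI (D 0)); rewrite -E addr0.
pose h i := (X i)%:P + D (X i) *: 'X.
pose Phi q := mmap (polyC \o f) h q.
pose del (q : {poly A}) := map_poly D q.
have delE q i : (del q)`_i = D q`_i by rewrite coef_map_id0.
have Dsum (T : Type) (s : seq T) (G : T -> A) : D (\sum_(t <- s) G t) = \sum_(t <- s) D (G t).
  by elim: s => [|t s IH]; rewrite ?big_nil // !big_cons DD IH.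
have delD x y : del (x + y) = del x + del y.
  by apply/polyP => i; rewrite coefD !delE coefD DD.
have delM x y : del (x * y) = del x * y + x * del y.
  apply/polyP => i; rewrite coefD delE !coefM Dsum -big_split; apply: eq_bigr => j _ /=.
  by rewrite DM !delE.
have delC a : del ((polyC \o f) a) = 0.
  by apply/polyP => i; rewrite delE coefC coef0 /=; case: eqP; rewrite ?DC.
have delh i : del (h i) = (D (X i))%:P + D (D (X i)) *: 'X.
  apply/polyP => j; rewrite delE !coefD !coefC !coefZ !coefX.
  by rewrite DD; case: j => [|[|j]] //=; rewrite ?mulr0 ?mulr1 ?D0.
have derh i : (h i)^`() = (D (X i))%:P.
  by rewrite derivD derivC add0r derivZ derivX alg_polyC.
have E1 := @chain_rule R0 {poly A} N (polyC \o f) h del F delD delM delC.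
have E2 := @chain_rule R0 {poly A} N (polyC \o f) h (@deriv A) F (@derivD A) (@derivM A)
   (fun a => derivC (f a)).
pose S := \sum_i Phi F^`M(i) * (r i *: 'X).
(* Moving the base point along the field has, modulo [P], the same effect as moving and rescaling
   the parameter of the tangent line. *)
have rel : c%:P * del (Phi F) = c%:P * (Phi F)^`() + kappa *: ('X * (Phi F)^`()) + P *: S.
  rewrite [del _]E1 [(Phi F)^`()]E2 -!mul_polyC /S !mulr_sumr -!big_split.
  apply: eq_bigr => i _ /=; rewrite delh derh -!mul_polyC.
  have := congr1 polyC (curv i); rewrite !(polyCD, polyCM) => E.
  rewrite [LHS](_ : _ = mmap (polyC \o f) h F^`M(i) * (c%:P * (D (X i))%:P
     + (c%:P * (D (D (X i)))%:P) * 'X)); last by ring.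
  by rewrite E /Phi; ring.
have divP x y : divides P x -> divides P y -> divides P (x - y).
  by case=> a -> [b ->]; exists (a - b); rewrite mulrBr.
elim=> [|m [q qE]].
  suff -> : (Phi F)`_0 = P by exists 1; rewrite mulr1.
  rewrite -horner_coef0.
  apply: (mpoly_morph_ext (f := horner_eval 0 \o mmap (polyC \o f) h)
     (g := mmap f X)) => [a|i] /=.
    by rewrite !mmapC /= /horner_eval hornerC.
  by rewrite !mmapXi /horner_eval /h hornerD hornerC hornerZ hornerX mulr0 addr0.
(* Modulo [P] and the coefficient of order [m], this says that [c * m.+1%:R] kills the coefficient
   of order [m.+1]; [P] is prime and divides neither factor of that product. *)
have := congr1 (fun u : {poly A} => u`_m) rel.
rewrite !coefD !coefCM !coefZ delE coef_deriv coefXM [in D _]/Phi qE DM DP mul0r add0r.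
have -> : (if m == 0%N then 0 else (Phi F)^`()`_m.-1) = (Phi F)`_m * m%:R.
  case: m qE => [|m] _ /=; first by rewrite mulr0.
  by rewrite coef_deriv mulr_natr.
rewrite [in _ * m%:R]/Phi qE -mulr_natr => E.
case: (PM c ((Phi F)`_m.+1 * m.+1%:R)).
- exists (c * D q - kappa * (q * m%:R) - S`_m).
  have -> : P * (c * D q - kappa * (q * m%:R) - S`_m)
     = c * (P * D q) - kappa * (P * q * m%:R) - P * S`_m by ring.
  by rewrite E; ring.
- by move/nPc.
by case/PM => // /nPm.
Qed.

Lemma msize_dhomog (R : comNzRingType) n d (p : {mpoly R[n]}) :
  p != 0 -> p \is d.-homog -> msize p = d.+1.
Proof. by move=> p0 /dhomogP pd; rewrite -mlead_deg // -(pd _ (mlead_supp p0)). Qed.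

Lemma linform_dhomog (k : fieldType) N (g : 'cV[k]_N) : linform g \is 1.-homog.
Proof.
by rewrite /linform; apply: rpred_sum => j _; apply: dhomogZ; rewrite dhomogX /= mdeg1.
Qed.

Lemma meval_linform (k : fieldType) N (g : 'cV[k]_N) (x : 'rV[k]_N) :
  peval (linform g) x = dotp x g.
Proof.
rewrite /peval /linform [LHS]rmorph_sum dotpE; apply: eq_bigr => j _ /=.
by rewrite mevalZ mevalXU mulrC.
Qed.

Lemma linform_irreducible (k : fieldType) N (g : 'cV[k]_N) : g != 0 -> mirreducible (linform g).
Proof.
move=> g0; have l0 : linform g != 0.
  apply: contraNneq g0 => l0; apply/eqP/colP => i; rewrite mxE.
  have := meval_linform g (delta_mx 0 i); rewrite l0 /peval meval0 /dotp -rowE mxE.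
  by move=> <-.
have szl := msize_dhomog l0 (linform_dhomog g).
split; first by rewrite /mconst szl.
move=> G H E; have G0 : G != 0 by apply: contraNneq l0 => G0; rewrite E G0 mul0r.
have H0 : H != 0 by apply: contraNneq l0 => H0; rewrite E H0 mulr0.
have := mpolySpred mdeg G0; have := mpolySpred mdeg H0.
move: szl; rewrite E msizeM // /mconst; move: (msize G) (msize H) => a b sz b1 a1.
by have [ab|ab] := leqP a 1; [left | right; clear - sz b1 a1 ab; lia].
Qed.

Lemma dhomog_divides_eq0 (k : fieldType) n d e (F G : {mpoly k[n]}) :
  F \is d.-homog -> G \is e.-homog -> (e < d)%N -> divides F G -> G = 0.
Proof.
move=> Fd Ge ed [q E]; apply/eqP/negPn/negP => G0.
have F0 : F != 0 by apply: contraNneq G0 => F0; rewrite E F0 mul0r.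
have q0 : q != 0 by apply: contraNneq G0 => q0; rewrite E q0 mulr0.
have := msize_dhomog G0 Ge; rewrite E msizeM // (msize_dhomog F0 Fd).
by rewrite (mpolySpred mdeg q0); lia.
Qed.

Section SecondFundamentalForm.
Variables (k : closedFieldType) (hchar : [pchar k] =i pred0).
Variables (n d : nat) (F : {mpoly k[n.+1]}).
Hypotheses (d2 : (2 <= d)%N) (Fhom : F \is d.-homog) (Firr : mirreducible F).

Lemma mirreducible_neq0 : F != 0.
Proof. by case: Firr => Fnc _; apply: contraNneq Fnc => ->; rewrite /mconst msize0. Qed.

(** For reasons of degree [F] divides a partial derivative only if the latter is zero; if all were,
    Euler's relation in characteristic 0 would give [F = 0]. *)
Lemma not_divides_partial : exists i, ~ divides F F^`M(i).
Proof.
apply: NNPP => nd; have Fi i : F^`M(i) = 0.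
  apply: (dhomog_divides_eq0 Fhom (mderiv_dhomog i Fhom)); first by lia.
  by apply: NNPP => ni; apply: nd; exists i.
case/eqP: mirreducible_neq0; apply: mpoly_ext => x; rewrite meval0.
pose p : 'rV[k]_n.+1 := \row_i x i.
have := euler p Fhom; rewrite dotpE big1 => [|i _]; last first.
  by rewrite [grad _ _ _ _]mxE Fi /peval meval0 mulr0.
move/eqP; rewrite eq_sym mulf_eq0 (negPf (char0_natf_neq0 hchar _)); last by lia.
by move/eqP => /= <-; apply: meval_eq => i; rewrite mxE.
Qed.

Variable i0 : 'I_n.+1.
Hypothesis ndF0 : ~ divides F F^`M(i0).

(** The constant vector [a] projected to the tangent spaces along the basis vector [i0], multiplied
    by the [i0]-th partial derivative of [F] to clear denominators. *)
Definition tfield (a : 'rV[k]_n.+1) (i : 'I_n.+1) : {mpoly k[n.+1]} :=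
  a 0 i *: F^`M(i0) - (i == i0)%:R *: (\sum_j a 0 j *: F^`M(j)).

Definition tderiv (a : 'rV[k]_n.+1) (q : {mpoly k[n.+1]}) : {mpoly k[n.+1]} :=
  \sum_i tfield a i * q^`M(i).

(** The second fundamental form evaluated on [tfield a]. *)
Definition tcurv (a : 'rV[k]_n.+1) : {mpoly k[n.+1]} :=
  \sum_i tfield a i * tderiv a F^`M(i).

Lemma tfield_sum a (G : 'I_n.+1 -> {mpoly k[n.+1]}) :
  \sum_i tfield a i * G i =
  F^`M(i0) * (\sum_j a 0 j *: G j) - (\sum_j a 0 j *: F^`M(j)) * G i0.
Proof.
rewrite /tfield; set S := \sum_j a 0 j *: F^`M(j).
under eq_bigr do rewrite mulrBl; rewrite sumrB; congr (_ - _).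
  by rewrite mulr_sumr; apply: eq_bigr => i _; rewrite -scalerAl -scalerAr.
rewrite (bigD1 i0) //= eqxx scale1r big1 ?addr0 // => i ii0.
by rewrite (negPf ii0) scale0r mul0r.
Qed.

Lemma tderivF a : tderiv a F = 0.
Proof. by rewrite /tderiv tfield_sum mulrC subrr. Qed.

Lemma tderivD a x y : tderiv a (x + y) = tderiv a x + tderiv a y.
Proof. by rewrite -big_split; apply: eq_bigr => i _ /=; rewrite mderivD mulrDr. Qed.

Lemma tderivM a x y : tderiv a (x * y) = tderiv a x * y + x * tderiv a y.
Proof.
rewrite /tderiv mulr_suml mulr_sumr -big_split; apply: eq_bigr => i _ /=.
by rewrite mderivM; ring.
Qed.

Lemma tderivC a c : tderiv a c%:MP = 0.
Proof. by apply: big1 => i _; rewrite mderivC mulr0. Qed.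

Lemma tderivZ a c x : tderiv a (c *: x) = c *: tderiv a x.
Proof. by rewrite -mul_mpolyC tderivM tderivC mul0r add0r mul_mpolyC. Qed.

Lemma tderivX a i : tderiv a 'X_i = tfield a i.
Proof.
rewrite /tderiv (bigD1 i) //= mderivX mnm1E eqxx scale1r big1 ?addr0 => [|j ij].
  by rewrite -{1}[U_(i)%MM]addm0 addmC addmK mpolyX0 mulr1.
by rewrite mderivX mnm1E eq_sym (negPf ij) scale0r mulr0.
Qed.

Lemma tderiv_sum a (T : Type) (s : seq T) (G : T -> {mpoly k[n.+1]}) :
  tderiv a (\sum_(t <- s) G t) = \sum_(t <- s) tderiv a (G t).
Proof.
elim: s => [|t s IH]; last by rewrite !big_cons tderivD IH.
by rewrite !big_nil -mpolyC0 tderivC mpolyC0.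
Qed.

(** The field differentiated along itself is proportional to itself up to [tcurv a]. When [F]
    divides [tcurv a], this is the straightness condition of [tangent_flow]. *)
Lemma tderiv_tfield a i :
  F^`M(i0) * tderiv a (tfield a i) =
  tderiv a F^`M(i0) * tfield a i - (i == i0)%:R *: tcurv a.
Proof.
have -> : tderiv a (tfield a i) = a 0 i *: tderiv a F^`M(i0)
    - (i == i0)%:R *: (\sum_j a 0 j *: tderiv a F^`M(j)).
  have <- : tderiv a (\sum_j a 0 j *: F^`M(j)) = \sum_j a 0 j *: tderiv a F^`M(j).
    by rewrite tderiv_sum; apply: eq_bigr => j _; rewrite tderivZ.
  by rewrite /tfield -!scaleNr tderivD !tderivZ.
rewrite /tcurv tfield_sum /tfield; case: eqP => _; rewrite ?scale1r ?scale0r ?subr0.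
  by rewrite -!mul_mpolyC; ring.
by rewrite -!mul_mpolyC; ring.
Qed.

Lemma tfield_eval a p : [/\ dotp (\row_i peval (tfield a i) p) (grad F p) = 0,
  bil (hess F p) (\row_i peval (tfield a i) p) (\row_i peval (tfield a i) p)
    = peval (tcurv a) p &
  dotp a (grad F p) = 0 -> \row_i peval (tfield a i) p = peval F^`M(i0) p *: a].
Proof.
have sumE (G : 'I_n.+1 -> {mpoly k[n.+1]}) : peval (\sum_i G i) p = \sum_i peval (G i) p.
  by rewrite /peval [LHS]rmorph_sum.
have mulE (x y : {mpoly k[n.+1]}) : peval (x * y) p = peval x p * peval y p.
  exact: mevalM.
split.
- have := congr1 (fun q => peval q p) (tderivF a).
  rewrite /tderiv sumE /peval meval0 => <-; rewrite dotpE; apply: eq_bigr => i _.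
  by rewrite !mxE -mulE.
- rewrite /tcurv sumE bilE; apply: eq_bigr => i _.
  rewrite mulE /tderiv sumE mulr_sumr; apply: eq_bigr => j _.
  by rewrite mulE !mxE; ring.
move=> ag; have S0 : (\sum_j a 0 j *: F^`M(j)).@[fun j => p 0 j] = 0.
  rewrite -[RHS]ag dotpE [LHS]rmorph_sum; apply: eq_bigr => j _ /=.
  by rewrite mevalZ mxE.
by apply/rowP => i; rewrite !mxE /tfield /peval mevalB !mevalZ S0 mulr0 subr0 mulrC.
Qed.

Lemma tangent_line_in p a t :
  (forall b, divides F (tcurv b)) -> peval F p = 0 -> dotp a (grad F p) = 0 ->
  peval F (p + (t * peval F^`M(i0) p) *: a) = 0.
Proof.
move=> curv Fp ag; case: (curv a) => r rE.
have FE : mmap (@mpolyC n.+1 k) (fun i => 'X_i) F = F.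
  by apply: (mpoly_morph_ext (f := mmap _ _) (g := idfun)) => [c|i] /=; rewrite ?mmapC ?mmapXi.
pose Phi := mmap (polyC \o @mpolyC n.+1 k)
  (fun i => ('X_i)%:P + tderiv a 'X_i *: 'X) F.
have coefs m : divides F Phi`_m.
  have := @tangent_flow k {mpoly k[n.+1]} (@mpolyC n.+1 k) n.+1 (fun i => 'X_i)
    (fun i => - ((i == i0)%:R *: r)) (tderiv a) F F^`M(i0) (tderiv a F^`M(i0))
    (@tderivD a) (@tderivM a) (@tderivC a).
  rewrite FE => H; apply: H => //.
  - exact: mirreducible_prime.
  - exact: tderivF.
  - move=> l Fl; have := dhomog_divides_eq0 (e := 0) Fhom _ _ Fl.
    rewrite -mpolyC_nat => H; have : (l.+1%:R)%:MP_[n.+1] = 0 :> {mpoly k[n.+1]}.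
      by apply: H; [rewrite -[_%:MP]mulr1 mul_mpolyC; apply: dhomogZ; apply: dhomog1 | lia].
    move/eqP; rewrite mpolyC_eq0; apply/negP; exact: char0_natf_neq0.
  - move=> i; rewrite tderivX tderiv_tfield rE mulrN -scalerAr.
    by [].
have PhiE s : (map_poly (meval (fun j => p 0 j)) Phi).[s]
    = peval F (p + s *: \row_i peval (tfield a i) p).
  apply: (mpoly_morph_ext (f := horner_eval s \o map_poly (meval (fun j => p 0 j)) \o
     mmap (polyC \o @mpolyC n.+1 k) (fun i => ('X_i)%:P + tderiv a 'X_i *: 'X))
     (g := meval _)) => [c|i] /=.
    by rewrite mmapC map_polyC /= /horner_eval hornerC !mevalC.
  rewrite mmapXi tderivX rmorphD /= map_polyC map_polyZ map_polyX /= /horner_eval.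
  by rewrite hornerD hornerC hornerZ hornerX !mevalXU !mxE mulrC.
have [_ _ /(_ ag) wE] := tfield_eval a p.
rewrite -scalerA -wE -PhiE (_ : map_poly _ _ = 0) ?horner0 //.
apply/polyP => m; rewrite coef_map coef0 /=; case: (coefs m) => q ->.
by rewrite mevalM -/(peval F p) Fp mul0r.
Qed.

(** If [F] divided every [tcurv b], [tangent_line_in] would put the tangent hyperplane at a smooth
    point inside the hypersurface, and its linear form would divide [F]. So some [tcurv a] serves as
    [G]; where it is nonzero the field, and with it the gradient, does not vanish. *)
Lemma nonzero_second_form : exists2 G, ~ divides F G & forall p : 'rV_n.+1,
  peval F p = 0 -> peval G p != 0 ->
  grad F p != 0 /\
  exists x y, [/\ dotp x (grad F p) = 0, dotp y (grad F p) = 0 & bil (hess F p) x y != 0].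
Proof.
case: (classic (exists a, ~ divides F (tcurv a))) => [[a nFa]|nF].
  exists (tcurv a) => // p Fp; have [w0 wE _] := tfield_eval a p; rewrite -wE => ww.
  split; last by do 2!exists (\row_i peval (tfield a i) p).
  apply: contraNneq ww => g0; rewrite (_ : \row__ _ = 0) ?bil0l //.
  have gi j : peval F^`M(j) p = 0 by have := congr1 (fun q : 'cV_n.+1 => q j 0) g0; rewrite !mxE.
  apply/rowP => i; rewrite !mxE /tfield /peval mevalB !mevalZ -/(peval _ p) gi mulr0.
  rewrite [meval _ _]rmorph_sum big1 ?mulr0 ?subr0 // => j _ /=.
  by rewrite mevalZ -/(peval _ p) gi mulr0.
have curv b : divides F (tcurv b) by apply: NNPP => nb; apply: nF; exists b.
have [p [Fp F0p]] : exists p : 'rV_n.+1, peval F p = 0 /\ peval F^`M(i0) p != 0.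
  apply: NNPP => np; apply: ndF0; apply: vanishing_divides => // x Fx.
  pose p : 'rV[k]_n.+1 := \row_i x i.
  have pE (q : {mpoly k[n.+1]}) : peval q p = q.@[x] by apply: meval_eq => j; rewrite mxE.
  by apply/eqP/negPn/negP => F0x; apply: np; exists p; rewrite !pE.
have g0 : grad F p != 0.
  apply: contraNneq F0p => g0.
  by have := congr1 (fun q : 'cV_n.+1 => q i0 0) g0; rewrite !mxE => ->.
have : divides (linform (grad F p)) F.
  apply: vanishing_divides; first exact: linform_irreducible.
  move=> x; pose v : 'rV[k]_n.+1 := \row_i x i.
  have vE (q : {mpoly k[n.+1]}) : peval q v = q.@[x] by apply: meval_eq => j; rewrite mxE.
  rewrite -!vE meval_linform => vg.
  have pg : dotp p (grad F p) = 0 by rewrite (euler _ Fhom) Fp mulr0.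
  have := @tangent_line_in p (v - p) (peval F^`M(i0) p)^-1 curv Fp.
  rewrite mulVf // scale1r addrCA subrr addr0; apply.
  by rewrite -scaleN1r dotpDl dotpZl vg pg mulr0 addr0.
case=> q E; have [Fnc] := Firr; case/(_ _ _ E).
  by have [/negP] := linform_irreducible g0.
rewrite /mconst => q1; have F0 := mirreducible_neq0.
have l0 : linform (grad F p) != 0 by apply: contraNneq F0 => l0; rewrite E l0 mul0r.
have := msize_dhomog F0 Fhom; rewrite {1}E msizeM //; last first.
  by apply: contraNneq F0 => q0; rewrite E q0 mulr0.
rewrite (msize_dhomog l0 (linform_dhomog _)).
by move: q1; case: (msize q) => [|[|]] //= _ dE; move: d2; lia.
Qed.

End SecondFundamentalForm.

(** * Threefolds *)

Section LinePolynomials.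
Variables (k : closedFieldType) (N : nat).
Implicit Types (F : {mpoly k[N]}) (e a z : 'rV[k]_N).

Definition line e a F : {poly k} := mcurve (fun i => (e 0 i)%:P + a 0 i *: 'X) F.

Lemma line_horner e a F t : (line e a F).[t] = peval F (e + t *: a).
Proof.
rewrite /line mcurve_horner; apply: meval_eq => i.
by rewrite hornerD hornerC hornerZ hornerX !mxE mulrC.
Qed.

Lemma line_deriv e a F : (line e a F)^`() = \sum_i a 0 i *: line e a F^`M(i).
Proof.
rewrite /line mcurve_deriv; apply: eq_bigr => i _.
by rewrite derivD derivC add0r derivZ derivX alg_polyC mulrC mul_polyC.
Qed.

Lemma grad_deriv F e a z (psi : {poly k}) :
  (forall t, dotp z (grad F (e + t *: a)) = psi.[t]) ->
  bil (hess F e) a z = (psi^`()).[0].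
Proof.
move=> zg; have <- : \sum_i z 0 i *: line e a F^`M(i) = psi.
  apply: poly_ext => t; rewrite -zg horner_sum dotpE; apply: eq_bigr => i _.
  by rewrite hornerZ line_horner mxE.
rewrite (bilC _ _ (hess_sym F e)) bilE raddf_sum horner_sum; apply: eq_bigr => i _ /=.
rewrite derivZ hornerZ line_deriv horner_sum mulr_sumr; apply: eq_bigr => j _.
by rewrite hornerZ line_horner scale0r addr0 mxE; ring.
Qed.

Definition hess_form F z : {mpoly k[N]} := \sum_i \sum_j (z 0 i * z 0 j) *: F^`M(i)^`M(j).

Lemma hess_formE F z e : peval (hess_form F z) e = bil (hess F e) z z.
Proof.
rewrite /peval /hess_form [LHS]rmorph_sum bilE; apply: eq_bigr => i _ /=.
rewrite [LHS]rmorph_sum; apply: eq_bigr => j _ /=.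
by rewrite mevalZ mxE -/(peval _ e); ring.
Qed.

Definition hess_det F : {mpoly k[N]} := \det (\matrix_(i, j) F^`M(i)^`M(j)).

Lemma hess_detE F e : peval (hess_det F) e = \det (hess F e).
Proof.
rewrite /peval /hess_det -[LHS]det_map_mx; congr (\det _).
by apply/matrixP => i j; rewrite !mxE.
Qed.

End LinePolynomials.

(** The conic on the isotropic cone through [y] in direction [w]: [z] is made orthogonal to [w] and
    then isotropic by a multiple of [y], and its coefficient is chosen to cancel [bil H w w]. *)
Lemma isotropic_witness (k : fieldType) N (H : 'M[k]_N) (g : 'cV[k]_N) (y w z : 'rV[k]_N) :
  (2%:R : k) != 0 -> H^T = H ->
  dotp y g = 0 -> dotp w g = 0 -> dotp z g = 0 -> bil H y y = 0 -> bil H y w = 0 ->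
  bil H w w != 0 -> bil H y z != 0 ->
  exists a, dotp a g = 0 /\
    forall t, let v := y + t *: w + t ^+ 2 *: a in dotp v g = 0 /\ bil H v v = 0.
Proof.
move=> two0 Hsym yg wg zg yy yw ww yz.
pose z1 := z - (bil H w z / bil H w w) *: w.
have z1g : dotp z1 g = 0.
  by rewrite /z1 -scaleNr dotpDl dotpZl zg wg mulr0 addr0.
have wz1 : bil H w z1 = 0 by rewrite /z1 -scaleNr bilDr bilZr mulNr divfK // subrr.
have yz1 : bil H y z1 = bil H y z by rewrite /z1 -scaleNr bilDr bilZr yw mulr0 addr0.
clearbody z1; pose z2 := z1 - (bil H z1 z1 / (2%:R * bil H y z)) *: y.
have z2g : dotp z2 g = 0.
  by rewrite /z2 -scaleNr dotpDl dotpZl z1g yg mulr0 addr0.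
have wz2 : bil H w z2 = 0.
  by rewrite /z2 -scaleNr bilDr bilZr wz1 (bilC w y Hsym) yw mulr0 addr0.
have yz2 : bil H y z2 = bil H y z.
  by rewrite /z2 -scaleNr bilDr bilZr yy mulr0 addr0 yz1.
have z2z2 : bil H z2 z2 = 0.
  rewrite /z2 -scaleNr !(bilDl, bilDr, bilZl, bilZr) (bilC z1 y Hsym) yy yz1.
  by field; rewrite yz two0.
clearbody z2; exists (- (bil H w w / (2%:R * bil H y z)) *: z2); split=> [|t v].
  by rewrite dotpZl z2g mulr0.
rewrite /v scalerA; split.
  by rewrite !dotpDl !dotpZl yg wg z2g !mulr0 !addr0.
rewrite !(bilDl, bilDr, bilZl, bilZr) yy yw (bilC w y Hsym) yw (bilC z2 y Hsym).
by rewrite (bilC z2 w Hsym) wz2 yz2 z2z2; field; rewrite yz two0.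
Qed.

Section Threefold.
Variables (k : closedFieldType) (hchar : [pchar k] =i pred0).
Variables (d : nat) (F : {mpoly k[5]}).
Hypotheses (d3 : (3 <= d)%N) (Fhom : F \is d.-homog).
Hypothesis sect : forall (p : 'rV[k]_5) (e : 'cV[k]_5), p != 0 -> e != 0 ->
  peval F p = 0 -> dotp p e = 0 ->
  exists M : 'M[k]_(2, 5), [/\ row_free M, (p <= M)%MS &
        forall x : 'rV_5, (x <= M)%MS -> dotp x e = 0 /\ peval F x = 0].
Implicit Types p x y z v w : 'rV[k]_5.

Definition good p := peval F p = 0 /\ \det (hess F p) != 0.

Lemma good_free p : good p -> row_free (hess F p).
Proof. by case=> _ dH; rewrite row_free_unit unitmxE unitfE. Qed.

Lemma good_isotropic_rank p m (U : 'M[k]_(m, 5)) : good p ->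
  (forall x y, (x <= U)%MS -> (y <= U)%MS -> bil (hess F p) x y = 0) -> (\rank U <= 2)%N.
Proof.
move=> /good_free pf /isotropic_rank; rewrite mxrankMfree // => ?; lia.
Qed.

Lemma d1_neq0 : d.-1%:R != 0 :> k.
Proof. by apply: char0_natf_neq0 => //; move: d3; lia. Qed.

Lemma good_neq0 p : good p -> p != 0.
Proof.
case=> _; apply: contraNneq => ->; rewrite (_ : hess F 0 = 0) ?det0 //.
apply/matrixP => i j; rewrite !mxE -(scale0r 0).
rewrite (pevalZ _ _ (mderiv_dhomog j (mderiv_dhomog i Fhom))) expr0n.
by case: d d3 => [|[|[|d']]] // _; rewrite mul0r.
Qed.

(** The section is taken by the polar hyperplane of [v], which contains [p] because [v] is tangent.
    The isotropic plane found there is orthogonal to [v]; a nondegenerate form in five variables has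
    no isotropic space of dimension three, so that plane contains [v]. *)
Lemma isotropic_line p v : good p -> dotp v (grad F p) = 0 -> bil (hess F p) v v = 0 ->
  forall a b, peval F (a *: p + b *: v) = 0.
Proof.
move=> pgood vg vv a b; case: (pgood) => Fp dH.
have [->|v0] := eqVneq v 0.
  by rewrite scaler0 addr0 (pevalZ _ _ Fhom) Fp mulr0.
have e0 : hess F p *m v^T != 0.
  apply: contraNneq v0 => /(congr1 trmx); rewrite trmx_mul trmxK hess_sym trmx0 => /eqP.
  by rewrite mulmx_free_eq0 // good_free.
have pe : dotp p (hess F p *m v^T) = 0.
  by rewrite -bil_dotp (bilC _ _ (hess_sym _ _)) (bil_point _ _ Fhom) vg mulr0.
have [M [Mfree pM MF]] := sect (good_neq0 pgood) e0 Fp pe.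
have [Mg Miso] := isotropic_of_vanishing hchar pM (fun x xM => (MF x xM).2).
have Mv x : (x <= M)%MS -> bil (hess F p) x v = 0.
  by move=> xM; rewrite bil_dotp; case: (MF x xM).
have iso : (\rank (M + v)%MS <= 2)%N.
  apply: (good_isotropic_rank pgood) => x y.
  move=> /sub_addsmxP[[u1 u2] /= ->] /sub_addsmxP[[u3 u4] /= ->].
  rewrite [u2]mx11_scalar [u4]mx11_scalar !mul_scalar_mx.
  rewrite !(bilDl, bilDr, bilZl, bilZr) vv (bilC v _ (hess_sym _ _)).
  by rewrite Miso ?submxMl // !Mv ?submxMl // !mulr0 !addr0 mulr0 ?addr0.
have : (M == M + v)%MS.
  by rewrite -(geq_leqif (mxrank_leqif_eq (addsmxSl _ _))) (eqP Mfree).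
case/andP=> _ MvM; have vM : (v <= M)%MS := submx_trans (addsmxSr _ _) MvM.
by apply: (MF _ _).2; rewrite addmx_sub ?scalemx_sub.
Qed.

(** The orthogonal of [x] and [v] has dimension three, too large to be isotropic, which gives [w].
    If [v] were orthogonal to all tangent vectors, spaces of dimensions four and two would be
    orthogonal in dimension five. *)
Lemma good_dual x v : good x -> dotp v (grad F x) = 0 -> bil (hess F x) v v = 0 ->
  ~~ (v <= x)%MS ->
  (exists w, [/\ dotp w (grad F x) = 0, bil (hess F x) v w = 0 & bil (hess F x) w w != 0]) /\
  (exists z, dotp z (grad F x) = 0 /\ bil (hess F x) v z != 0).
Proof.
move=> xgood vg vv vx; have xfree := good_free xgood.
have x0 := good_neq0 xgood; have d1 := d1_neq0; have two0 := two_neq0 hchar.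
have bC u u' : bil (hess F x) u u' = bil (hess F x) u' u by apply: bilC; apply: hess_sym.
have gradE : grad F x = d.-1%:R^-1 *: (hess F x *m x^T).
  by rewrite (hess_euler _ Fhom) scalerA mulVf ?scale1r.
have xv_free : \rank (col_mx x v) = 2%N.
  have : (x < x + v)%MS.
    by rewrite /ltmx addsmxSl /=; apply: contra vx; apply: submx_trans; apply: addsmxSr.
  rewrite ltmxErank rank_rV x0 => /andP[_]; rewrite addsmxE => xv2.
  apply/eqP; rewrite eqn_leq; apply/andP; split; [exact: rank_leq_row | exact: xv2].
pose K := kermx (hess F x *m (col_mx x v)^T).
have inK z : (z <= K)%MS = (dotp z (grad F x) == 0) && (bil (hess F x) z v == 0).
  rewrite sub_kermx tr_col_mx !mul_mx_row mulmxA.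
  have -> : (dotp z (grad F x) == 0) = (z *m (hess F x *m x^T) == 0).
    by rewrite dotp_eq0 gradE dotpZr mulf_eq0 invr_eq0 (negPf d1).
  rewrite bil_dotp -!dotp_eq0 !mulmxA; apply/eqP/andP => [E|[/eqP-> /eqP->]].
    by split; apply/eqP; [have := congr1 lsubmx E | have := congr1 rsubmx E];
      rewrite ?row_mxKl ?row_mxKr ?linear0.
  by rewrite row_mx0.
have rK : (3 <= \rank K)%N.
  rewrite mxrank_ker; have : (\rank (hess F x *m (col_mx x v)^T) <= 2)%N.
    by rewrite (leq_trans (mxrankM_maxr _ _)) // mxrank_tr xv_free.
  by lia.
split.
  apply: NNPP => nw.
  have q0 w : (w <= K)%MS -> bil (hess F x) w w = 0.
    rewrite inK bC => /andP[/eqP wg /eqP vw]; apply/eqP/negPn/negP => ww.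
    by apply: nw; exists w.
  suff : (\rank K <= 2)%N by move: rK; lia.
  apply: (good_isotropic_rank xgood) => a b aK bK.
  have := q0 (a + b) (addmx_sub aK bK).
  rewrite bilDl !bilDr q0 // q0 // (bC b a) add0r addr0 -mulr2n -mulr_natl => /eqP.
  by rewrite mulf_eq0 (negPf two0) => /eqP.
apply: NNPP => nz; case/negP: vx.
have kv z : dotp z (grad F x) = 0 -> bil (hess F x) z v = 0.
  by move=> zg; rewrite bC; apply/eqP/negPn/negP => vz; apply: nz; exists z.
exfalso; pose C := col_mx x v.
have KC : kermx (grad F x) *m (hess F x *m C^T) = 0.
  apply/row_matrixP => i; rewrite row_mul row0 tr_col_mx !mul_mx_row.
  have ig : dotp (row i (kermx (grad F x))) (grad F x) = 0.
    have /sub_kermxP := row_sub i (kermx (grad F x)).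
    by rewrite /dotp => ->; rewrite mxE.
  have : row i (kermx (grad F x)) *m (hess F x *m x^T) = 0.
    by apply/eqP; rewrite dotp_eq0 -bil_dotp (bil_point _ _ Fhom) ig mulr0.
  have : row i (kermx (grad F x)) *m (hess F x *m v^T) = 0.
    by apply/eqP; rewrite dotp_eq0 -bil_dotp kv.
  by move=> -> ->; rewrite row_mx0.
have := mulmx0_rank_max KC.
have -> : \rank (hess F x *m C^T) = 2%N.
  by rewrite -mxrank_tr trmx_mul trmxK hess_sym mxrankMfree.
rewrite mxrank_ker; have := rank_leq_col (grad F x); lia.
Qed.

Lemma gradZ c x : grad F (c *: x) = c ^+ d.-1 *: grad F x.
Proof. by apply/colP => i; rewrite !mxE (pevalZ _ _ (mderiv_dhomog i Fhom)). Qed.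

Lemma point_line x y : peval F x = 0 -> (forall a b, peval F (a *: x + b *: y) = 0) ->
  forall a b, [/\ dotp x (grad F (a *: x + b *: y)) = 0,
    dotp y (grad F (a *: x + b *: y)) = 0 & bil (hess F (a *: x + b *: y)) y y = 0].
Proof.
move=> Fx Fl a b; have [xg _] : dotp x (grad F (a *: x + b *: y)) = 0 /\
    bil (hess F (a *: x + b *: y)) x x = 0.
  apply: line_tangent => t; rewrite addrAC -scalerDl; exact: Fl.
have [yg yy] : dotp y (grad F (a *: x + b *: y)) = 0 /\
    bil (hess F (a *: x + b *: y)) y y = 0.
  apply: line_tangent => t; rewrite -addrA -scalerDl; exact: Fl.
by split.
Qed.

(** By [isotropic_line] the points [r *: x + s *: v], with [v] on the conic, lie in the
    hypersurface; for fixed [r] and [s] they form a conic through [e], to which [quadratic_curve]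
    applies. *)
Lemma line_relations x y w a : good x ->
  dotp w (grad F x) = 0 -> dotp a (grad F x) = 0 ->
  (forall t, let v := y + t *: w + t ^+ 2 *: a in
     dotp v (grad F x) = 0 /\ bil (hess F x) v v = 0) ->
  forall r s, let e := r *: x + s *: y in
    dotp w (grad F e) = 0 /\ s * bil (hess F e) w w + 2%:R * dotp a (grad F e) = 0.
Proof.
move=> xgood wg ag cone r s e.
have [s0|s0] := eqVneq s 0.
  by rewrite /e s0 scale0r addr0 gradZ !dotpZr wg ag !mulr0 mul0r addr0.
have [|E1 E2] := @quadratic_curve k 5 F e (s *: w) (s *: a).
  move=> t; have [vg vv] := cone t.
  have := isotropic_line xgood vg vv r s; congr (peval F _ = 0).
  by rewrite /e !scalerDr !scalerA !addrA [t * s]mulrC [t ^+ 2 * s]mulrC.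
rewrite !dotpZl bilZl bilZr in E1 E2.
split; apply: (mulfI s0); rewrite mulr0 //.
by rewrite -[RHS]E2; ring.
Qed.

(** On two tangent vectors independent modulo [x], the Hessian form is a binary quadratic form and
    has a zero. *)
Lemma good_isotropic x : good x -> exists v,
  [/\ dotp v (grad F x) = 0, bil (hess F x) v v = 0 & ~~ (v <= x)%MS].
Proof.
move=> xgood; pose K := kermx (grad F x).
have rK : (4 <= \rank K)%N.
  by rewrite mxrank_ker; have := rank_leq_col (grad F x); lia.
have inK v : (v <= K)%MS = (dotp v (grad F x) == 0) by rewrite sub_kermx dotp_eq0.
have escape m (A : 'M[k]_(m, 5)) :
      (\rank A < 4)%N -> exists2 u, dotp u (grad F x) = 0 & ~~ (u <= A)%MS.
  move=> rA; have : ~~ (K <= A)%MS.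
    by apply/negP => /mxrankS; rewrite leqNgt (leq_trans rA rK).
  case/row_subPn=> i ui; exists (row i K) => //.
  by apply/eqP; rewrite -inK row_sub.
have [u1 u1g u1x] : exists2 u, dotp u (grad F x) = 0 & ~~ (u <= x)%MS.
  by apply: escape; have := rank_leq_row x; lia.
have [u2 u2g u2x] : exists2 u, dotp u (grad F x) = 0 & ~~ (u <= col_mx x u1)%MS.
  by apply: escape; have := rank_leq_row (col_mx x u1); lia.
have xA : (x <= col_mx x u1)%MS by rewrite -addsmxE addsmxSl.
have uA : (u1 <= col_mx x u1)%MS by rewrite -addsmxE addsmxSr.
have [q2|q2] := eqVneq (bil (hess F x) u2 u2) 0.
  by exists u2; split=> //; apply: contra u2x => /submx_trans; apply.
pose P := bil (hess F x) u2 u2 *: 'X^2 + (2%:R * bil (hess F x) u1 u2) *: 'X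
   + (bil (hess F x) u1 u1)%:P.
have /closed_rootP[s /rootP] : size P != 1%N.
  have szP : size (bil (hess F x) u2 u2 *: 'X^2 : {poly k}) = 3%N.
    by rewrite size_scale // size_polyXn.
  rewrite /P -addrA size_polyDl ?szP // (leq_ltn_trans (size_polyD _ _)) // gtn_max.
  rewrite size_polyC (leq_ltn_trans (size_scale_leq _ _)) ?size_polyX //=.
  by case: (_ == _).
rewrite !(hornerD, hornerZ, hornerXn, hornerX, hornerC) => Ps.
exists (u1 + s *: u2); split.
- by rewrite dotpDl dotpZl u1g u2g mulr0 addr0.
- rewrite !(bilDl, bilDr, bilZl, bilZr) (bilC u2 u1 (hess_sym _ _)) -[RHS]Ps; ring.
have [->|s0] := eqVneq s 0; first by rewrite scale0r addr0.
apply: contra u2x => /submx_trans/(_ xA) vA.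
have -> : u2 = s^-1 *: ((u1 + s *: u2) - u1).
  by rewrite addrAC subrr add0r scalerA mulVf ?scale1r.
by rewrite scalemx_sub // addmx_sub // eqmx_opp.
Qed.

Definition frame (x y w a c : 'rV[k]_5) : 'M[k]_5 :=
  \matrix_(i < 5, j < 5) (tnth [tuple x; y; w; a; c] i) 0 j.

Lemma mul_frame (u : 'rV[k]_5) x y w a c :
  u *m frame x y w a c = u 0 0 *: x + u 0 1 *: y + u 0 2%:R *: w + u 0 3%:R *: a + u 0 4%:R *: c.
Proof.
apply/rowP => j; rewrite !mxE !big_ord_recl big_ord0 addr0 !mxE !addrA.
congr (u _ _ * _ + u _ _ * _ + u _ _ * _ + u _ _ * _ + u _ _ * _); exact: val_inj.
Qed.

(* Along the line through [x] and [y], the gradient of [F] is the scalar [bil (hess F e) w w]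
   times a vector linear in [e], whose coordinates in the dual frame are [0, 0, 0, - s / 2]
   and [- r / 2]. *)
Lemma adapted_frame x : good x -> exists y w a c,
  [/\ row_free (frame x y w a c), bil (hess F x) w w != 0,
     forall r s, peval F (r *: x + s *: y) = 0 &
     forall r s, let e := r *: x + s *: y in
     [/\ dotp w (grad F e) = 0, s * bil (hess F e) w w + 2%:R * dotp a (grad F e) = 0 &
         r * bil (hess F e) w w + 2%:R * dotp c (grad F e) = 0]].
Proof.
move=> xgood; have two0 := two_neq0 hchar; have Hs p := hess_sym F p.
have x0 := good_neq0 xgood; case: (xgood) => Fx dx.
have xg : dotp x (grad F x) = 0 by rewrite (euler _ Fhom) Fx mulr0.
have [v [vg vv vx]] := good_isotropic xgood.
have [[w [wg vw ww]] [z [zg vz]]] := good_dual xgood vg vv vx.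
have xb u : dotp u (grad F x) = 0 -> bil (hess F x) x u = 0.
  by move=> ug; rewrite (bilC _ _ (Hs x)) (bil_point _ _ Fhom) ug mulr0.
(* A value of the parameter where [Q] is nonzero gives a point [y] distinct from [x], again good,
   with [w] non-isotropic there too. *)
pose Q := 'X * line x v (hess_det F * hess_form F w).
have : Q != 0.
  rewrite mulf_neq0 ?polyX_eq0 //; apply/eqP => /(congr1 (fun q => q.[0])).
  rewrite line_horner horner0 scale0r addr0 /peval mevalM -!/(peval _ x).
  by rewrite hess_detE hess_formE => /eqP; rewrite mulf_eq0 (negPf dx) (negPf ww).
case/closed_nonrootP=> s; rewrite /root hornerM hornerX line_horner /peval mevalM.
rewrite -!/(peval _ (x + s *: v)) hess_detE hess_formE !mulf_eq0 !negb_or => /and3P[s0 dy wwy].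
pose y := x + s *: v; rewrite -/y in dy wwy.
have Fl r t : peval F (r *: x + t *: y) = 0.
  rewrite /y scalerDr addrA -scalerDl scalerA; exact: isotropic_line.
have ygood : good y by split=> //; have := Fl 0 1; rewrite scale0r scale1r add0r.
have yg : dotp y (grad F x) = 0 by rewrite dotpDl dotpZl xg vg mulr0 addr0.
have yy : bil (hess F x) y y = 0.
  rewrite /y !(bilDl, bilDr, bilZl, bilZr) (bilC v x (Hs x)) !xb // vv; ring.
have yw : bil (hess F x) y w = 0 by rewrite /y bilDl bilZl xb // vw mulr0 addr0.
have yz : bil (hess F x) y z != 0.
  by rewrite /y bilDl bilZl xb // add0r mulf_neq0.
have [a [ag acone]] := isotropic_witness two0 (Hs x) yg wg zg yy yw ww yz.
have relx := line_relations xgood wg ag acone.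
have wy : dotp w (grad F y) = 0.
  by have [] := relx 0 1; rewrite scale0r scale1r add0r.
have xw : bil (hess F y) x w = 0.
  rewrite (@grad_deriv k 5 F y x w 0) ?deriv0 ?horner0 // => t; rewrite horner0.
  by have [] := relx t 1; rewrite scale1r addrC.
have Fl' r t : peval F (r *: y + t *: x) = 0 by rewrite addrC.
have Fy : peval F y = 0 by case: ygood.
have [xgy _ xxy] : [/\ dotp x (grad F y) = 0, dotp y (grad F y) = 0 & bil (hess F y) x x = 0].
  by have [] := point_line Fy Fl' 1 0; rewrite scale0r scale1r addr0.
have xy : ~~ (x <= y)%MS.
  apply: contra vx => /sub_rVP[b xE].
  have b1 : b != 0 by apply: contraNneq x0 => b0; rewrite xE b0 scale0r.
  have -> : v = ((b * s)^-1 * (1 - b)) *: x; last exact: scalemx_sub.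
  have E : (1 - b) *: x = (b * s) *: v.
    by rewrite scalerBl scale1r {1}xE /y scalerDr scalerA addrAC subrr add0r.
  by rewrite -scalerA E scalerA mulVf ?scale1r // mulf_neq0.
(* The roles of [x] and [y] are exchanged, with the same [w]; this produces [c]. *)
have [_ [z' [z'g xz']]] := good_dual ygood xgy xxy xy.
have [c [cg ccone]] := isotropic_witness two0 (Hs y) xgy wy z'g xxy xw wwy xz'.
have rely := line_relations ygood wy cg ccone.
have rel r t : let e := r *: x + t *: y in
     [/\ dotp w (grad F e) = 0, t * bil (hess F e) w w + 2%:R * dotp a (grad F e) = 0 &
         r * bil (hess F e) w w + 2%:R * dotp c (grad F e) = 0].
  have [H1 H2] := relx r t; have := rely t r.
  by rewrite [t *: y + _]addrC => -[_ H3]; split.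
exists y, w, a, c; split=> //.
have cgx : dotp c (grad F x) != 0.
  have [_ _] := rel 1 0; rewrite /= scale0r scale1r addr0 mul1r => E.
  by apply: contraNneq ww => c0; move: E; rewrite c0 mulr0 addr0 => ->.
have agy : dotp a (grad F y) != 0.
  have [_ E _] := rel 0 1; move: E; rewrite /= scale0r scale1r add0r mul1r => E.
  by apply: contraNneq wwy => a0; move: E; rewrite a0 mulr0 addr0 => ->.
(* The gradients at [x] and [y] and the Hessian pairing with [w] isolate the coefficients of [c],
   [a] and [w]. *)
apply: inj_row_free => u; rewrite mul_frame => u0.
have u4 : u 0 4%:R = 0.
  have := congr1 (fun q => dotp q (grad F x)) u0; rewrite dotp0l !dotpDl !dotpZl.
  rewrite xg yg wg ag !mulr0 !add0r => /eqP; rewrite mulf_eq0 (negPf cgx) orbF => /eqP//.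
have u3 : u 0 3%:R = 0.
  have := congr1 (fun q => dotp q (grad F y)) u0; rewrite dotp0l !dotpDl !dotpZl.
  rewrite xgy (_ : dotp y _ = 0) ?wy ?u4 ?mul0r ?mulr0 ?add0r ?addr0.
    by move=> /eqP; rewrite mulf_eq0 (negPf agy) orbF => /eqP.
  by rewrite (euler _ Fhom) Fy mulr0.
have u2 : u 0 2%:R = 0.
  have := congr1 (bil (hess F x) w) u0; rewrite bil0r !bilDr !bilZr u3 u4.
  rewrite (bilC w x (Hs x)) (bilC w y (Hs x)) xb // yw !mulr0 !mul0r !add0r !addr0 => /eqP.
  by rewrite mulf_eq0 (negPf ww) orbF => /eqP.
move: u0; rewrite u2 u3 u4 !scale0r !addr0 => u0.
have u1 : u 0 1 = 0.
  apply/eqP/negPn/negP => u1; case/negP: vx.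
  have -> : v = (- ((u 0 1 * s)^-1 * (u 0 0 + u 0 1))) *: x; last exact: scalemx_sub.
  have : (u 0 0 + u 0 1) *: x + (u 0 1 * s) *: v = 0.
    by rewrite -[RHS]u0 /y scalerDr scalerA scalerDl addrA.
  move/eqP; rewrite addr_eq0 => /eqP E.
  by rewrite scaleNr -scalerA E scalerN opprK scalerA mulVf ?scale1r // mulf_neq0.
move: u0; rewrite u1 scale0r addr0 => /eqP; rewrite scaler_eq0 (negPf x0) orbF => /eqP u00.
apply/rowP => i; rewrite mxE.
by case: i => [[|[|[|[|[|//]]]]] li]; [rewrite -[RHS]u00|rewrite -[RHS]u1|rewrite -[RHS]u2|
  rewrite -[RHS]u3|rewrite -[RHS]u4]; congr (u _ _); apply: val_inj.
Qed.

End Threefold.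

Lemma dotp_gradE (k : closedFieldType) N (F : {mpoly k[N]}) (e v : 'rV[k]_N) :
  dotp v (grad F e) = ((line e v F)^`()).[0].
Proof.
rewrite line_deriv horner_sum dotpE; apply: eq_bigr => i _.
by rewrite hornerZ line_horner scale0r addr0 mxE.
Qed.

(** * Linear changes of coordinates *)

Section LinearSubstitution.
Variables (k : closedFieldType) (m N : nat).
Implicit Types (F : {mpoly k[N]}) (B : 'M[k]_(m, N)).

Lemma peval_ext n (p q : {mpoly k[n]}) : (forall x : 'rV_n, peval p x = peval q x) -> p = q.
Proof.
move=> pq; apply: mpoly_ext => x; have := pq (\row_i x i).
by rewrite /peval !(meval_eq _ (_ : (fun j => (\row_i x i) 0 j) =1 x)) // => j; rewrite mxE.
Qed.

Lemma peval_lin_param F B (u : 'rV[k]_m) :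
  peval (F \mPo lin_param B) u = peval F (u *m B).
Proof.
rewrite /peval comp_mpoly_meval; apply: meval_eq => j.
rewrite tnth_mktuple [LHS]rmorph_sum mxE; apply: eq_bigr => i _ /=.
by rewrite mevalZ mevalXU mulrC.
Qed.

Lemma dhomog_lin_param F B d : F \is d.-homog -> F \mPo lin_param B \is d.-homog.
Proof.
apply: dhomog_mmap => j; rewrite tnth_mktuple; apply: rpred_sum => i _.
by apply: dhomogZ; rewrite dhomogX /= mdeg1.
Qed.

Lemma grad_lin_param F B (u v : 'rV[k]_m) :
  dotp v (grad (F \mPo lin_param B) u) = dotp (v *m B) (grad F (u *m B)).
Proof.
rewrite !dotp_gradE; congr (horner (deriv _) 0); apply: poly_ext => t.
by rewrite !line_horner peval_lin_param mulmxDl -scalemxAl.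
Qed.

End LinearSubstitution.

Lemma mirreducible_lin_param (k : closedFieldType) N (F : {mpoly k[N]}) (B : 'M[k]_N) :
  row_free B -> mirreducible F -> mirreducible (F \mPo lin_param B).
Proof.
rewrite row_free_unit => BU [Fnc Firr].
have const_comp (C : 'M[k]_N) (G : {mpoly k[N]}) : C \in unitmx ->
    mconst (G \mPo lin_param C) -> mconst G.
  move=> CU /msize1_polyC E; suff -> : G = ((G \mPo lin_param C)@_0)%:MP.
    by rewrite /mconst msizeC; case: (_ == _).
  apply: peval_ext => x; rewrite -[x](mulmxKV CU) -peval_lin_param E.
  by rewrite /peval !mevalC mcoeffC eqxx mulr1.
split; first by apply: contra Fnc; apply: const_comp.
move=> G H E; have IU : invmx B \in unitmx by rewrite unitmx_inv.
case: (Firr (G \mPo lin_param (invmx B)) (H \mPo lin_param (invmx B))).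
- apply: peval_ext => x; rewrite -rmorphM /= -E !peval_lin_param.
  by rewrite mulmxKV.
- by left; apply: const_comp IU _.
- by right; apply: const_comp IU _.
Qed.

Lemma deriv_eigen_eq0 (k : fieldType) (p : {poly k}) c : c != 0 -> p^`() = c *: p -> p = 0.
Proof.
move=> c0 E; apply/eqP/negPn/negP => /lt_size_deriv.
by rewrite E size_scale // ltnn.
Qed.

Lemma deriv_eq0_const (k : fieldType) (p : {poly k}) s t :
  [pchar k] =i pred0 -> p^`() = 0 -> p.[s] = p.[t].
Proof.
move=> k0 p'; have -> : p = (p`_0)%:P; last by rewrite !hornerC.
apply/polyP => i; rewrite coefC; case: i => [|i] //=.
have := congr1 (fun q : {poly k} => q`_i) p'; rewrite coef_deriv coef0 -mulr_natr => /eqP.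
by rewrite mulf_eq0 (negPf (char0_natf_neq0 k0 _)) // orbF => /eqP.
Qed.

(** * The vector field attached to a line of the threefold *)

Section ThreefoldDegree.
Variables (k : closedFieldType) (hchar : [pchar k] =i pred0).
Variables (d : nat) (F : {mpoly k[5]}).
Hypotheses (d3 : (3 <= d)%N) (Fhom : F \is d.-homog) (Firr : mirreducible F).
Hypothesis sect : forall (p : 'rV[k]_5) (e : 'cV[k]_5), p != 0 -> e != 0 ->
  peval F p = 0 -> dotp p e = 0 ->
  exists M : 'M[k]_(2, 5), [/\ row_free M, (p <= M)%MS &
        forall x : 'rV_5, (x <= M)%MS -> dotp x e = 0 /\ peval F x = 0].

Section Frame.
Variables x y w a c : 'rV[k]_5.
Hypothesis xgood : good F x.
Hypothesis Bfree : row_free (frame x y w a c).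
Hypothesis xww : bil (hess F x) w w != 0.
Hypothesis Fl : forall r s, peval F (r *: x + s *: y) = 0.
Hypothesis rel : forall r s, let e := r *: x + s *: y in
     [/\ dotp w (grad F e) = 0, s * bil (hess F e) w w + 2%:R * dotp a (grad F e) = 0 &
         r * bil (hess F e) w w + 2%:R * dotp c (grad F e) = 0].

Let Fx : peval F x = 0. Proof. by case: xgood. Qed.

(** The sign in [e] makes the contributions of [a] and [c] cancel, so [P] is tangent at [e] for
    every [u1]. A suitable [u1] makes it isotropic; the line from [e] to [P] then lies in the
    hypersurface, which is the condition on the gradient at [P]. *)
Lemma frame_point r t u0 u2 : let e := r *: x - t *: y in
  \det (hess F e) != 0 -> bil (hess F e) w w != 0 -> r != 0 ->
  exists u1, let P := u0 *: x + u1 *: y + u2 *: w + r *: a + t *: c in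
    peval F P = 0 /\ dotp e (grad F P) = 0.
Proof.
move=> e de we r0; have two0 := two_neq0 hchar.
have eE s : e + s *: y = r *: x + (s - t) *: y.
  by rewrite /e scalerBl addrA addrAC.
have egood : good F e.
  by split=> //; rewrite -[e]addr0 -(scale0r y) eE.
pose V u1 := u0 *: x + u1 *: y + u2 *: w + r *: a + t *: c.
have Vg u1 s : dotp (V u1) (grad F (e + s *: y))
    = - (r / 2%:R) * (s * bil (hess F (e + s *: y)) w w).
  rewrite eE; have [xg yg _] := point_line Fx Fl r (s - t).
  have [wg ag cg] := rel r (s - t).
  rewrite /V !dotpDl !dotpZl xg yg wg !mulr0 !add0r.
  set h := bil _ _ _ in ag cg *.
  have -> : dotp a (grad F (r *: x + (s - t) *: y)) = - ((s - t) * h) / 2%:R.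
    by move/eqP: ag; rewrite addrC addr_eq0 => /eqP <-; field.
  have -> : dotp c (grad F (r *: x + (s - t) *: y)) = - (r * h) / 2%:R.
    by move/eqP: cg; rewrite addrC addr_eq0 => /eqP <-; field.
  by field.
have Vg0 u1 : dotp (V u1) (grad F e) = 0.
  by have := Vg u1 0; rewrite scale0r addr0 mul0r mulr0.
have yV u1 : bil (hess F e) y (V u1) = - (r / 2%:R) * bil (hess F e) w w.
  rewrite (@grad_deriv k 5 F e y (V u1) (- (r / 2%:R) *: ('X * line e y (hess_form F w)))).
    rewrite derivZ derivM derivX mul1r hornerZ hornerD hornerM hornerX mul0r addr0.
    by rewrite line_horner scale0r addr0 hess_formE.
  by move=> s; rewrite Vg hornerZ hornerM hornerX line_horner hess_formE.
have yy : bil (hess F e) y y = 0.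
  by have [_ _] := point_line Fx Fl r (- t); rewrite scaleNr.
(* [y] is isotropic at [e], so the Hessian form is affine along the direction [y]. *)
have quad P : bil (hess F e) y P != 0 ->
    let s := - (bil (hess F e) P P / (2%:R * bil (hess F e) y P)) in
    bil (hess F e) (P + s *: y) (P + s *: y) = 0.
  move=> yP s; rewrite !(bilDl, bilDr, bilZl, bilZr) yy (bilC P y (hess_sym _ _)) /s.
  by field; rewrite yP two0.
have VE s : V s = V 0 + s *: y by apply/rowP => j; rewrite !mxE; ring.
have b0 : bil (hess F e) y (V 0) != 0.
  by rewrite yV mulf_neq0 // oppr_eq0 mulf_neq0 ?invr_eq0.
pose u1 := - (bil (hess F e) (V 0) (V 0) / (2%:R * bil (hess F e) y (V 0))).
have VV : bil (hess F e) (V u1) (V u1) = 0 by rewrite VE; apply: quad.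
have L := isotropic_line hchar d3 Fhom sect egood (Vg0 u1) VV.
exists u1; rewrite -/(V u1); split; first by have := L 0 1; rewrite scale0r scale1r add0r.
by have [] := @line_tangent k 5 F (V u1) e; first by move=> s; have := L s 1; rewrite scale1r addrC.
Qed.

Let G := F \mPo lin_param (frame x y w a c).
Let DG : {mpoly k[5]} := 'X_(3%:R) * G^`M(0) - 'X_(4%:R) * G^`M(1).

(* The point of the line through [x] and [y] whose tangent hyperplane contains the point
   with coordinates [u] in the frame. *)
Definition flow_dir (u : 'rV[k]_5) : 'rV[k]_5 :=
  u 0 3%:R *: delta_mx 0 0 - u 0 4%:R *: delta_mx 0 1.

Lemma peval_DG u : peval DG u = dotp (flow_dir u) (grad G u).
Proof.
have dE i : dotp (delta_mx 0 i) (grad G u) = peval G^`M(i) u by rewrite /dotp -rowE !mxE.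
rewrite /flow_dir -scaleNr dotpDl !dotpZl !dE /DG /peval mevalB !mevalM !mevalXU; ring.
Qed.

(** Otherwise eliminating the coordinate along [y] gives a nonzero [rho] in the other four, while
    over a generic choice of these [frame_point] supplies a common zero of [G] and [DG]. *)
Lemma divides_DG : divides G DG.
Proof.
have Girr : mirreducible G by apply: mirreducible_lin_param.
apply: NNPP => nG.
have [rho [U [V [rho0 rhoE]]]] := mpoly_eliminant (1 : 'I_5) (mirreducible_prime Girr) nG.
pose h : {mpoly k[5]} := hess_det F * hess_form F w.
(* Its nonvanishing is the condition for applying [frame_point]; among the four remaining variables,
   numbers 2 and 3 are the frame coordinates 3 and 4. *)
pose gen : {mpoly k[4]} :=
  (h \mPo [tuple x 0 j *: 'X_(2%:R) - y 0 j *: 'X_(3%:R) | j < 5]) * 'X_(2%:R).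
have genE (u : 'I_4 -> k) :
    gen.@[u] = peval h (u 2%:R *: x - u 3%:R *: y) * u 2%:R.
  rewrite /gen mevalM mevalXU comp_mpoly_meval; congr (_ * _); apply: meval_eq => j.
  by rewrite tnth_mktuple mevalB !mevalZ !mevalXU !mxE mulrC [u 3%:R * _]mulrC.
have hE e : peval h e = \det (hess F e) * bil (hess F e) w w.
  by rewrite -hess_detE -hess_formE /peval mevalM.
have gen0 : gen != 0.
  apply/eqP => g0; have := genE (fun j => (j == 2%:R)%:R); rewrite g0 meval0 eqxx /=.
  rewrite scale1r scale0r subr0 mulr1 hE => /esym/eqP.
  by case: xgood => _ dx; rewrite mulf_eq0 (negPf dx) (negPf xww).
have [u] := mpoly_nonroot (mulf_neq0 rho0 gen0).
rewrite mevalM genE hE !mulf_eq0 !negb_or => /and3P[rhou /andP[de we] r0].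
have [u1 [FP gP]] := frame_point (u 0) (u 1) de we r0.
pose v : 'rV[k]_5 := \row_j (if unlift 1 j is Some j' then u j' else u1).
have vl j : v 0 (lift 1 j) = u j by rewrite mxE liftK.
have v0 : v 0 0 = u 0 by rewrite -vl; congr (v _ _); apply: val_inj.
have v2 : v 0 2%:R = u 1 by rewrite -vl; congr (v _ _); apply: val_inj.
have v3 : v 0 3%:R = u 2%:R by rewrite -vl; congr (v _ _); apply: val_inj.
have v4 : v 0 4%:R = u 3%:R by rewrite -vl; congr (v _ _); apply: val_inj.
have v1 : v 0 1 = u1 by rewrite mxE unlift_none.
have vB := mul_frame v x y w a c; rewrite v0 v1 v2 v3 v4 in vB.
have Gv : peval G v = 0 by rewrite peval_lin_param vB.
have DGv : peval DG v = 0.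
  rewrite peval_DG grad_lin_param vB -[RHS]gP; congr (dotp _ _).
  by rewrite /flow_dir mulmxBl -!scalemxAl -!rowE v3 v4; congr (_ *: _ - _ *: _);
    apply/rowP => j; rewrite !mxE.
case/negP: rhou; have := congr1 (meval (fun j => v 0 j)) rhoE.
rewrite meval_mlift mevalD !mevalM -/(peval G v) -/(peval DG v) Gv DGv !mulr0 addr0 => <-.
by apply/eqP; apply: meval_eq => j; rewrite vl.
Qed.

(** By degree [DG] is a scalar multiple [b] of [G]. The direction is constant along its own lines,
    so on them [G] restricts to a polynomial whose derivative is [b] times itself; if [b] were
    nonzero, [G] would vanish. *)
Lemma flow_invariant u t : peval G (u + t *: flow_dir u) = peval G u.
Proof.
have Ghom : G \is d.-homog by apply: dhomog_lin_param.
have Girr : mirreducible G by apply: mirreducible_lin_param.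
have G0 := mirreducible_neq0 Girr.
have DGhom : DG \is d.-homog.
  have dE : d = (1 + d.-1)%N by move: d3; lia.
  have G'hom i : G^`M(i) \is d.-1.-homog by apply: mderiv_dhomog.
  have X'hom i l : 'X_i * G^`M(l) \is d.-homog.
    by have := @dhomogM _ _ mdeg 1 'X_i d.-1 G^`M(l); rewrite -dE; apply; rewrite ?dhomogX /= ?mdeg1.
  by rewrite rpredB.
have [q DGE] := divides_DG.
have [b DGb] : exists b, DG = b *: G.
  have [D0|D0] := eqVneq DG 0; first by exists 0; rewrite scale0r.
  have q0 : q != 0 by apply: contraNneq D0 => q0; rewrite DGE q0 mulr0.
  have := msize_dhomog D0 DGhom; rewrite {1}DGE msizeM // (msize_dhomog G0 Ghom) => sz.
  have /msize1_polyC qE : (msize q <= 1)%N.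
    by move: sz; case: (msize q) => [|[|l]] //; lia.
  by exists q@_0; rewrite DGE {1}qE mulrC mul_mpolyC.
have phiE v : (line v (flow_dir v) G)^`() = b *: line v (flow_dir v) G.
  apply: poly_ext => s; rewrite hornerZ !line_horner.
  have -> : b * peval G (v + s *: flow_dir v) = peval DG (v + s *: flow_dir v).
    by rewrite DGb /peval mevalZ.
  have fE : flow_dir (v + s *: flow_dir v) = flow_dir v.
    rewrite /flow_dir !mxE /=; congr (_ *: _ - _ *: _);
      by rewrite !(mulr0, subr0, addr0).
  rewrite peval_DG fE line_deriv horner_sum dotpE; apply: eq_bigr => i _.
  by rewrite hornerZ line_horner [grad _ _ _ _]mxE.
have b0 : b = 0.
  apply/eqP/negPn/negP => b0; case/eqP: G0; apply: peval_ext => v.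
  have := congr1 (fun q : {poly k} => q.[0]) (deriv_eigen_eq0 b0 (phiE v)).
  by rewrite line_horner scale0r addr0 horner0 /peval meval0.
have phi' : (line u (flow_dir u) G)^`() = 0 by rewrite phiE b0 scale0r.
by have := deriv_eq0_const t 0 hchar phi'; rewrite !line_horner scale0r addr0.
Qed.

(** Where the coordinates along [y] and [c] are zero, the flow translates along [x] only. Hence [F]
    at [x + u2 *: w] equals its value at [u2 *: w], a multiple of [u2 ^+ d]; as d >= 3 there is no
    second-order term, against [xww]. *)
Lemma frame_absurd : False.
Proof.
have Gframe u0 u2 u3 : peval F (u0 *: x + u2 *: w + u3 *: a) =
    peval G (\row_j tnth [tuple u0; 0; u2; u3; 0] j).
  rewrite peval_lin_param mul_frame !mxE !(tnth_nth 0) /=.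
  by rewrite !scale0r !addr0.
have shift u2 u3 : u3 != 0 -> peval F (x + u2 *: w + u3 *: a) = peval F (u2 *: w + u3 *: a).
  move=> u30; rewrite -[x in LHS]scale1r Gframe.
  have := Gframe 0 u2 u3; rewrite scale0r add0r => ->.
  (* The coordinate along [x] moves at speed [u3], so it goes from 0 to 1 in time [u3^-1]. *)
  rewrite -[RHS](flow_invariant _ u3^-1); congr (peval G _); apply/rowP => j.
  rewrite /flow_dir !mxE !(tnth_nth 0) /= mul0r subr0.
  by case: j => [[|[|[|[|[|//]]]]] lj]; rewrite /= ?mulr0 ?addr0 // mulr1 add0r mulVf.
have shift0 u2 : peval F (x + u2 *: w) = u2 ^+ d * peval F w.
  have E : line (x + u2 *: w) a F = line (u2 *: w) a F.
    (* The values are compared for [t != 0] only; the factor ['X] takes care of [t = 0]. *)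
    have X0 : 'X != 0 :> {poly k} by rewrite polyX_eq0.
    apply: (mulfI X0); apply: poly_ext => t; rewrite !hornerM !hornerX !line_horner.
    by have [->|t0] := eqVneq t 0; [rewrite !mul0r | rewrite shift].
  have := congr1 (fun q : {poly k} => q.[0]) E; rewrite !line_horner !scale0r !addr0 => ->.
  exact: pevalZ.
have lE : line x w F = peval F w *: 'X^d.
  by apply: poly_ext => t; rewrite line_horner hornerZ hornerXn shift0 mulrC.
case/negP: xww; apply/eqP; rewrite (@grad_deriv k 5 F x w w ((line x w F)^`())).
  rewrite lE !derivZ hornerZ derivXn derivMn hornerMn derivXn hornerMn hornerXn expr0n.
  by case: d d3 => [|[|[|d']]] // _; rewrite /= !mul0rn mulr0.
move=> t; rewrite line_deriv horner_sum dotpE; apply: eq_bigr => i _.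
by rewrite hornerZ line_horner [grad _ _ _ _]mxE.
Qed.

End Frame.

Theorem threefold_no_good x : ~ good F x.
Proof.
move=> xgood; have [y [w [a [c [Bfree ww Fl rel]]]]] := adapted_frame hchar d3 Fhom sect xgood.
exact: (frame_absurd xgood Bfree ww Fl rel).
Qed.

End ThreefoldDegree.

(** * From hyperplane sections to the hypersurface *)

Lemma section_planes (k : closedFieldType) n s (F : {mpoly k[n.+1]}) (p : 'rV[k]_n.+1)
    (e : 'cV[k]_n.+1) :
  covered_by_linear_divisors s [:: linform e; F] -> p != 0 -> peval F p = 0 ->
  dotp p e = 0 ->
  exists M : 'M[k]_(s, n.+1), [/\ row_free M, (p <= M)%MS &
    forall x : 'rV_n.+1, (x <= M)%MS -> dotp x e = 0 /\ peval F x = 0].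
Proof.
move=> cov p0 Fp pe; case: (cov p p0) => [q|M [Mfree pM MF]].
  by rewrite !inE => /orP[] /eqP-> //; rewrite meval_linform.
exists M; split=> // x xM.
have inM q : q \in [:: linform e; F] -> peval q x = 0.
  move=> qF; apply/(lin_in_schemeP M q).1: xM => q'.
  by rewrite inE => /eqP->; apply: MF.
by rewrite -meval_linform !inM ?inE ?eqxx ?orbT.
Qed.

Lemma grad_neq0_point (k : closedFieldType) n d (F : {mpoly k[n]}) p :
  (2 <= d)%N -> F \is d.-homog -> grad F p != 0 -> p != 0.
Proof.
move=> d2 Fhom; apply: contraNneq => ->; apply/eqP/colP => i.
rewrite !mxE -(scale0r 0) (pevalZ _ _ (mderiv_dhomog i Fhom)) expr0n.
by case: d d2 {Fhom} => [|[|d']] // _; rewrite mul0r.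
Qed.

Theorem theorem7p5 (k : closedFieldType) (hchar : [pchar k] =i pred0)
    (n d : nat) (F : {mpoly k[n.+1]})
    (hhom : F \is [in k[n.+1], d.-homog])
    (hirr : mirreducible F)
    (hnonlin : (2 <= d)%N)
    (hdim : (5 <= n)%N \/ (n = 4%N /\ (3 <= d)%N))
    (hsect : forall h : 'cV[k]_(n.+1), h != 0 ->
       covered_by_linear_divisors (n - 2) [:: linform h; F]) :
  covered_by_linear_divisors (n - 1) [:: F].
Proof.
have n4 : (4 <= n)%N by lia.
have n0 : (0 < n)%N by lia.
have hess0 : n = 4%N -> forall p : 'rV_n.+1, peval F p = 0 -> \det (hess F p) = 0.
  move=> nE p Fp; apply/eqP/negPn/negP => dp.
  have d3 : (3 <= d)%N by move: nE hdim; lia.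
  subst n; apply: (@threefold_no_good k hchar d F d3 hhom hirr _ p) => //.
  by move=> q e q0 e0 Fq qe; apply: section_planes => //; apply: hsect.
have [i0 nF0] := not_divides_partial hchar hnonlin hhom hirr.
have [G nFG GP] := nonzero_second_form hchar hnonlin hhom hirr nF0.
(* It suffices to treat points [q] where [G] is nonzero; the gradient is nonzero there, which also
   excludes the zero vector. *)
move=> p p0 Fp; apply: (covered_at_closed n0 hhom hirr nFG); last by apply: Fp; rewrite inE.
move=> q Fq Gq; have [g0 second] := GP q Fq Gq.
apply: (covered_of_split hchar n4 hnonlin hhom Fq _ g0 _ second).
- move=> e e0 qe; apply: section_planes => //; first exact: hsect.
  exact: grad_neq0_point hnonlin hhom g0.
- by case: hdim => [|[nE _]]; [left | right; split=> //; apply: hess0].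
Qed.
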